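(* Let $X$ be a complex Banach space with open unit ball $\mathbb{B}$. Let $h\in\mathcal{M}$, with $h(x)=x+\sum_{k=2}^\infty H_k(x)$ its series of homogeneous polynomials near the origin, and let $f$ be the unique normalized solution to the equation $Df(x)[h(x)]=f(x)$. Then for any $e\in\partial\mathbb{B}$ (with $e^*\in J(e)$ given) and $\lambda,\mu\in\mathbb{C}$ we have $$\Psi_e(h,2\lambda,2\mu)=-2\Psi_e(f,1-\lambda,1-\mu).$$ Moreover, $$\left|\langle\Psi_e(h,\lambda,0),e^*\rangle\right|\le2\max\{1,|2\lambda-1|\}\quad\text{for any }\lambda\in\mathbb{C}.$$ In addition, if the homogeneous polynomials $H_2$ and $H_3$ are of one-dimensional type, then $$\left\|\Psi_e(h,\lambda,\mu)\right\|\le2\max\{1,|2\lambda-1|\}\quad\text{for any }\lambda,\mu\in\mathbb{C}.$$ Both estimates are sharp.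
   Context: Notation: $X^*$ is the dual space of $X$ with pairing $\langle x,a\rangle$, $x\in X$, $a\in X^*$, and $J(x)=\{x^*\in X^*:\|x^*\|=\|x\|,\ \langle x,x^*\rangle=\|x\|^2\}$. A mapping $\mathbb{B}\to X$ is holomorphic if it is Fréchet differentiable at every point of $\mathbb{B}$; it is normalized if $f(0)=0$ and $Df(0)=\mathrm{Id}$, and $\mathcal{A}(\mathbb{B})$ is the set of all normalized holomorphic mappings $\mathbb{B}\to X$. $D^kf(0)$ is the $k$-th Fréchet derivative at $0$ (a bounded symmetric $k$-linear operator). A homogeneous polynomial $P:X\to X$ is of one-dimensional type if $P(x)=s(x)x$ with $s$ a scalar-valued holomorphic function. $\mathcal{M}=\{h\in\mathcal{A}(\mathbb{B}):\ \mathrm{Re}\langle h(x),x^*\rangle\ge0\text{ for all }x\in\mathbb{B}\setminus\{0\},\ x^*\in J(x)\}$. It is known that for every $h\in\mathcal{M}$ there is a unique normalized (starlike) mapping $f$ with $Df(x)[h(x)]=f(x)$ in $\mathbb{B}$. Fekete–Szegő mapping: for a normalized holomorphic mapping $f$ with $P_k(x)=\frac1{k!}D^kf(0)[x^k]$, and given $\lambda,\mu\in\mathbb{C}$, $e\in\partial\mathbb{B}$, $e^*\in J(e)$, $$\Psi_e(f,\lambda,\mu)=P_3(e)-\frac{\mu}{2}D^2f(0)[e,P_2(e)]-(\lambda-\mu)\langle P_2(e),e^*\rangle P_2(e).$$ *)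

(* Defs.v *)
From HB Require Import structures.
From mathcomp Require Import all_boot all_order all_algebra.
From mathcomp Require Import complex.
From mathcomp Require Import all_classical all_reals all_analysis.

Set Implicit Arguments.
Unset Strict Implicit.
Unset Printing Implicit Defensive.

Import Order.TTheory GRing.Theory Num.Theory.
Import numFieldNormedType.Exports.

Local Open Scope classical_set_scope.
Local Open Scope complex_scope.
Local Open Scope ring_scope.

Section Definitions.
Variables (R : realType) (X : completeNormedModType R[i]).

Definition unit_ball : set X := [set x | `|x| < 1].

Definition holomorphic_on (Y : normedModType R[i]) (A : set X) (f : X -> Y) :=
  forall x, A x -> differentiable f x.

(* The norms of X and of R[i] take values in R[i] (in its nonnegative reals);
   complex.Re brings them to R, where suprema are available. *)
Definition dual_norm (a : X -> R[i]^o) : R :=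
  sup [set complex.Re `|a x| | x in [set x : X | `|x| <= 1]].

Definition duality_map (x : X) : set {linear X -> R[i]^o} :=
  [set a | [/\ continuous a, (dual_norm a)%:C = `|x| & a x = `|x| ^+ 2]].

Definition normalized_holomorphic (f : X -> X) :=
  [/\ holomorphic_on unit_ball f, f 0 = 0 & forall v, 'd f 0 v = v].

Definition class_M (h : X -> X) :=
  normalized_holomorphic h /\
  forall x a, unit_ball x -> x != 0 -> duality_map x a ->
    0 <= complex.Re (a (h x)).

(* frechetD f [:: v1; ...; vk] x is D^k f(x)[v1, ..., vk]: the Fréchet
   derivative at x, applied to v1, of y |-> D^(k-1) f(y)[v2, ..., vk]. *)
Fixpoint frechetD (f : X -> X) (vs : seq X) : X -> X :=
  if vs is v :: vs' then fun x => 'd (frechetD f vs') x v else f.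

Definition taylor_poly (f : X -> X) (k : nat) (x : X) : X :=
  (k`!%:R^-1 : R[i]) *: frechetD f (nseq k x) 0.

Definition one_dim_type (P : X -> X) :=
  exists s : X -> R[i]^o,
    holomorphic_on setT s /\ forall x, P x = (s x : R[i]) *: x.

Definition fekete_szego (e : X) (a : X -> R[i]^o) (f : X -> X)
    (lambda mu : R[i]) : X :=
  let P2e := taylor_poly f 2 e in
  taylor_poly f 3 e - (mu / 2) *: frechetD f [:: e; P2e] 0
  - ((lambda - mu) * a P2e) *: P2e.

End Definitions.

(* Main.v *)
(* The analytic input is elementary Cauchy theory.  Goursat's bisection is run
   directly on dyadic midpoint Riemann sums, so that no integral is needed; with
   a square contour it bounds a holomorphic function at the centre by 4 times
   its supremum on the square.  This gives Cauchy estimates with crude constants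
   for Banach-valued functions, then Weierstrass' theorem on uniform limits, and
   so the smoothness of holomorphic mappings and the symmetry of their second
   derivatives.  Sharp constants are recovered by applying the crude bound to
   powers (maximum principle) and to iterates (Schwarz' lemma).

   Comparing the expansions of Df(tv)[h(tv)] and f(tv) up to o(t^3) gives
   H2 = -P2 and H3 = -2 P3 - D^2 f(0)[v, H2], hence the identity.  For the
   estimates, p(z) = a(h(ze)) / z has nonnegative real part and p(0) = 1; with
   z phi = (p - 1) / (p + 1) the Schwarz-Pick inequality for phi at 0 is exactly
   |p2 - p1^2 / 2| <= 2 - |p1|^2 / 2.  The extremal mappings are
   x |-> (1 + w) / (1 - w) x with w = a(x) or w = a(x)^2. *)
Require Import Defs.
From HB Require Import structures.
From mathcomp Require Import all_boot all_order all_algebra complex.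
From mathcomp Require Import all_classical all_reals all_analysis.
From mathcomp Require Import ring lra.
Import Order.TTheory GRing.Theory Num.Theory.
Import numFieldNormedType.Exports.
Local Open Scope classical_set_scope.
Local Open Scope complex_scope.
Local Open Scope ring_scope.
Set Implicit Arguments.
Unset Strict Implicit.
Unset Printing Implicit Defensive.

(** In a Banach space of arbitrary dimension a holomorphic mapping is bounded only locally, so every
    estimate starts from a bound near one point. Contour integrals are replaced by statements that
    hold for all sufficiently fine midpoint sums. The constant 4 of the mean bound compares two
    contributions on the square: [psi(w)/w] gives at most [16 M], while [psi(0)/w] gives at least
    [4 |psi(0)|]. Comparing coefficients determines the second derivative of h at 0 only on the
    diagonal, but the term with mu evaluates it at the pair (e, H2(e)); symmetry of second
    derivatives is what allows to polarize. When H2 and H3 are of one-dimensional type, mu cancels,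
    so the third estimate reduces to the second. *)

(** * Identities in abelian groups, by reflection *)

Inductive zexpr := ZVar of nat | ZAdd of zexpr & zexpr | ZOpp of zexpr | ZZero.

Fixpoint zval (V : zmodType) (env : seq V) (e : zexpr) : V :=
  match e with
  | ZVar n => env`_n
  | ZAdd a b => zval env a + zval env b
  | ZOpp a => - zval env a
  | ZZero => 0
  end.

Fixpoint zcoef (e : zexpr) (k : nat) : int :=
  match e with
  | ZVar n => (n == k)%:R
  | ZAdd a b => zcoef a k + zcoef b k
  | ZOpp a => - zcoef a k
  | ZZero => 0
  end.

Lemma zvalE (V : zmodType) (env : seq V) e :
  zval env e = \sum_(i < size env) env`_i *~ zcoef e i.
Proof.
elim: e => [n|a IHa b IHb|a IHa|] /=.
- have [nl|nl] := ltnP n (size env).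
    rewrite (bigD1 (Ordinal nl)) //= eqxx mulr1z big1 ?addr0 // => i ni.
    rewrite (_ : (n == i) = false) ?mulr0z //.
    by apply: contraNF ni => /eqP ni; apply/eqP/val_inj.
  rewrite nth_default // big1 // => i _.
  by rewrite (_ : (n == i) = false) ?mulr0z // gtn_eqF // (leq_trans _ nl).
- by rewrite IHa IHb -big_split; apply: eq_bigr => i _; rewrite mulrzDr.
- by rewrite IHa -sumrN; apply: eq_bigr => i _; rewrite mulrNz.
- by rewrite big1 // => i _; rewrite mulr0z.
Qed.

Lemma zmod_identity (V : zmodType) (env : seq V) e1 e2 :
  all (fun k => zcoef e1 k == zcoef e2 k) (iota 0 (size env)) ->
  zval env e1 = zval env e2.
Proof.
move=> /allP H; rewrite !zvalE; apply: eq_bigr => i _.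
by rewrite (eqP (H i _)) // mem_iota /=.
Qed.

(** Scaled vectors count as one atom as soon as scalar and vector agree, even if the implicit
    structure arguments of [GRing.scale] differ. *)
Ltac zsame x y :=
  match constr:((x, y)) with
  | (?z, ?z) => constr:(true)
  | (@GRing.scale _ _ ?k ?a, @GRing.scale _ _ ?k ?a) => constr:(true)
  | _ => constr:(false)
  end.

Ltac zmem x env :=
  match env with
  | ?y :: ?t => match zsame x y with true => constr:(true) | _ => zmem x t end
  | _ => constr:(false)
  end.

Ltac zcollect env t :=
  match t with
  | (?a + ?b)%R => let e := zcollect env a in zcollect e b
  | (- ?a)%R => zcollect env a
  | 0%R => env
  | ?x => match zmem x env with true => env | _ => constr:(x :: env) end
  end.

Ltac zindex x env :=
  match env with
  | ?y :: ?t => match zsame x y with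
                | true => constr:(O)
                | _ => let n := zindex x t in constr:(S n)
                end
  end.

Ltac zreify env t :=
  match t with
  | (?a + ?b)%R =>
      let x := zreify env a in let y := zreify env b in constr:(ZAdd x y)
  | (- ?a)%R => let x := zreify env a in constr:(ZOpp x)
  | 0%R => constr:(ZZero)
  | ?x => let n := zindex x env in constr:(ZVar n)
  end.

(* Decides identities of abelian groups, where [ring] does not apply. *)
Ltac zmod :=
  match goal with
  | |- @eq ?T ?l ?r =>
      let e1 := zcollect (@nil T) l in let env := zcollect e1 r in
      let x := zreify env l in let y := zreify env r in
      exact (@zmod_identity _ env x y isT)
  end.

(** * Real-valued norms *)

(* Norms are valued in R[i], where [lra] and [nra] do not apply; [nm] is the same
   number in R. *)
Definition nm (R : realType) (V : normedZmodType R[i]) (x : V) : R :=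
  complex.Re `|x|.

Section RealNorm.
Variable R : realType.
Local Notation C := R[i].
Implicit Types (V : normedZmodType C) (Y : normedModType C) (z w : C) (r s : R).

Lemma nmE V (x : V) : `|x| = (nm x)%:C.
Proof.
rewrite /nm; have := normr_ge0 x; case: `|x| => a b /=.
by rewrite lecE /= => /andP[/eqP -> _].
Qed.

Lemma nm_ge0 V (x : V) : 0 <= nm x.
Proof. by rewrite -ler0c -nmE. Qed.

Lemma nm_le V (x : V) r : (`|x| <= r%:C) = (nm x <= r).
Proof. by rewrite nmE lecR. Qed.

Lemma nm_lt V (x : V) r : (`|x| < r%:C) = (nm x < r).
Proof. by rewrite nmE ltcR. Qed.

Lemma nm_lt1 V (x : V) : (`|x| < 1) = (nm x < 1).
Proof. exact: nm_lt x 1. Qed.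

Lemma nm0 V : nm (0 : V) = 0.
Proof. by rewrite /nm normr0. Qed.

Lemma nm_eq0 V (x : V) : (nm x == 0) = (x == 0).
Proof.
rewrite -[RHS]normr_eq0 nmE.
by rewrite -(inj_eq (@complexI R)).
Qed.

Lemma nm_gt0 V (x : V) : (0 < nm x) = (x != 0).
Proof. by rewrite lt_neqAle nm_ge0 andbT eq_sym nm_eq0. Qed.

Lemma nmN V (x : V) : nm (- x) = nm x.
Proof. by rewrite /nm normrN. Qed.

Lemma nm_dist V (x y : V) : nm (x - y) = nm (y - x).
Proof. by rewrite /nm distrC. Qed.

Lemma nm_leD V (x y : V) : nm (x + y) <= nm x + nm y.
Proof. by rewrite -lecR -nmE rmorphD /= -!nmE ler_normD. Qed.

Lemma nm_leB V (x y : V) : nm (x - y) <= nm x + nm y.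
Proof. by rewrite -(nmN y) nm_leD. Qed.

Lemma nm_geB V (x y : V) : nm x - nm y <= nm (x - y).
Proof. by rewrite lerBlDr; apply: le_trans (nm_leD _ _); rewrite subrK. Qed.

Lemma nm_trans V (x y z : V) : nm (x - z) <= nm (x - y) + nm (y - z).
Proof. by rewrite (le_trans _ (nm_leD _ _)) // addrA subrK. Qed.

Lemma nmM z w : nm (z * w) = nm z * nm w.
Proof. by apply: (@complexI R); rewrite rmorphM /= -!nmE normrM. Qed.

Lemma nmZ Y z (y : Y) : nm (z *: y) = nm z * nm y.
Proof. by apply: (@complexI R); rewrite rmorphM /= -!nmE normrZ. Qed.

Lemma nm1 : nm (1 : C) = 1.
Proof. by apply: (@complexI R); rewrite -nmE normr1. Qed.

Lemma nmX z n : nm (z ^+ n) = nm z ^+ n.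
Proof. by apply: (@complexI R); rewrite -nmE normrX rmorphXn /= -nmE. Qed.

Lemma nmV z : nm (z^-1) = (nm z)^-1.
Proof. by apply: (@complexI R); rewrite -nmE normfV fmorphV /= -nmE. Qed.

Lemma nm_real r : nm (r%:C) = `|r|.
Proof.
apply: (@complexI R); rewrite -nmE normc_def /=.
by rewrite expr0n /= addr0 sqrtr_sqr.
Qed.

Lemma nm_nat n : nm (n%:R : C) = n%:R.
Proof. by apply: (@complexI R); rewrite -nmE normr_nat rmorph_nat. Qed.

Lemma nm_sqr z : nm z ^+ 2 = complex.Re z ^+ 2 + complex.Im z ^+ 2.
Proof. by apply: (@complexI R); rewrite rmorphXn /= -nmE add_Re2_Im2. Qed.

Lemma nm_conj z : nm (z^*) = nm z.
Proof.
apply/eqP; rewrite -(@eqrXn2 _ 2) ?nm_ge0 // !nm_sqr; case: z => a b /=.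
by rewrite sqrrN.
Qed.

Lemma Re_le_nm z : `|complex.Re z| <= nm z.
Proof.
rewrite -(@ler_pXn2r _ 2) ?nnegrE ?nm_ge0 // nm_sqr real_normK ?num_real //.
by rewrite lerDl sqr_ge0.
Qed.

Lemma Im_le_nm z : `|complex.Im z| <= nm z.
Proof.
rewrite -(@ler_pXn2r _ 2) ?nnegrE ?nm_ge0 // nm_sqr real_normK ?num_real //.
by rewrite lerDr sqr_ge0.
Qed.

Lemma nm_le_ReIm z : nm z <= `|complex.Re z| + `|complex.Im z|.
Proof.
rewrite -(@ler_pXn2r _ 2) ?nnegrE ?addr_ge0 ?nm_ge0 // nm_sqr.
rewrite -(real_normK (num_real (complex.Re z))).
rewrite -(real_normK (num_real (complex.Im z))).
by rewrite sqrrD -addrA lerD2l lerDr mulrn_wge0 ?mulr_ge0.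
Qed.

Lemma nm_i : nm ('i : C) = 1.
Proof.
by apply/eqP; rewrite -(@eqrXn2 _ 2) ?nm_ge0 // nm_sqr /= expr0n expr1n add0r.
Qed.

Lemma cReD z w : complex.Re (z + w) = complex.Re z + complex.Re w.
Proof. by case: z w => a b []. Qed.
Lemma cImD z w : complex.Im (z + w) = complex.Im z + complex.Im w.
Proof. by case: z w => a b []. Qed.
Lemma cReN z : complex.Re (- z) = - complex.Re z.
Proof. by case: z. Qed.
Lemma cImN z : complex.Im (- z) = - complex.Im z.
Proof. by case: z. Qed.
Lemma cReM z w : complex.Re (z * w) =
  complex.Re z * complex.Re w - complex.Im z * complex.Im w.
Proof. by case: z w => a b []. Qed.
Lemma cImM z w : complex.Im (z * w) =
  complex.Re z * complex.Im w + complex.Im z * complex.Re w.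
Proof. by case: z w => a b []. Qed.

End RealNorm.

(** * Bisection arguments *)

Section Bisection.
Variable R : realType.
Local Notation C := R[i].

(** The intervals of centre [u k] and radius [2B/2^k] are nested, as the radius drops by exactly the
    [B/2^k] allowed for the step; the supremum of the left endpoints lies in all of them. *)
Lemma real_geometric_limit (u : nat -> R) (B : R) :
  (forall k, `|u k.+1 - u k| <= B / 2 ^+ k) ->
  exists l, forall k, `|l - u k| <= 2 * B / 2 ^+ k.
Proof.
move=> Hu.
have B0 : 0 <= B by have := Hu 0%N; rewrite expr0 divr1; apply: le_trans.
pose e k : R := 2 * B / 2 ^+ k.
have eS k : e k = 2 * e k.+1.
  by rewrite /e exprS invfM; field; rewrite expf_neq0.
have eE k : B / 2 ^+ k = e k.+1.
  by rewrite /e exprS invfM; field; rewrite expf_neq0.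
have lo k : u k - e k <= u k.+1 - e k.+1.
  by have := Hu k; rewrite eE ler_norml => /andP[]; have := eS k; lra.
have hi k : u k.+1 + e k.+1 <= u k + e k.
  by have := Hu k; rewrite eE ler_norml => /andP[]; have := eS k; lra.
have e0 k : 0 <= e k by rewrite /e divr_ge0 ?mulr_ge0 ?exprn_ge0.
have los k m : u k - e k <= u (k + m)%N - e (k + m)%N.
  elim: m => [|m IH]; first by rewrite addn0.
  by rewrite addnS; apply: le_trans IH _.
have his k m : u (k + m)%N + e (k + m)%N <= u k + e k.
  elim: m => [|m IH]; first by rewrite addn0.
  by rewrite addnS; apply: le_trans IH.
have lohi k m : u k - e k <= u m + e m.
  have [km|mk] := leqP k m.
    by have := los k (m - k)%N; rewrite subnKC //; have := e0 m; lra.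
  by have := his m (k - m)%N; rewrite subnKC 1?ltnW //; have := e0 k; lra.
pose A := range (fun k => u k - e k).
have A0 : A !=set0 by exists (u 0%N - e 0%N), 0%N.
have ub m : ubound A (u m + e m) by move=> _ [k _ <-].
exists (sup A) => k; rewrite -/(e k).
have h1 : sup A <= u k + e k by apply: ge_sup.
have h2 : u k - e k <= sup A.
  by apply: ub_le_sup; [exists (u k + e k) | exists k].
by rewrite ler_norml; apply/andP; split; lra.
Qed.

Lemma geometric_limit (u : nat -> C) (B : R) :
  (forall k, nm (u k.+1 - u k) <= B / 2 ^+ k) ->
  exists l, forall k, nm (l - u k) <= 4 * B / 2 ^+ k.
Proof.
move=> Hu.
have [a Ha] : exists a, forall k, `|a - complex.Re (u k)| <= 2 * B / 2 ^+ k.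
  apply: real_geometric_limit => k; apply: le_trans (Hu k).
  by rewrite -cReN -cReD Re_le_nm.
have [b Hb] : exists b, forall k, `|b - complex.Im (u k)| <= 2 * B / 2 ^+ k.
  apply: real_geometric_limit => k; apply: le_trans (Hu k).
  by rewrite -cImN -cImD Im_le_nm.
exists (a +i* b) => k; apply: le_trans (nm_le_ReIm _) _.
rewrite cReD cImD cReN cImN /=; have := Ha k; have := Hb k.
have -> : 4 * B / 2 ^+ k = 2 * B / 2 ^+ k + 2 * B / 2 ^+ k by ring.
by move=> h1 h2; rewrite lerD.
Qed.

(** Common pattern of the proofs by halving: repeated choice of a bad half makes the base points a
    geometric Cauchy sequence. The limit is within 4 sizes of each base, so local information at [z]
    applies to a small bad object. *)
Lemma bisection (T : Type) (base : T -> C) (size : T -> R)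
    (bad : T -> Prop) (t0 : T) :
  (forall t, bad t -> exists t', [/\ bad t', size t' = size t / 2
     & nm (base t' - base t) <= size t]) ->
  bad t0 ->
  exists z, forall eps : R, 0 < eps -> exists t,
    [/\ bad t, size t < eps & nm (z - base t) <= 4 * size t].
Proof.
move=> step bad0.
pose next (t : {t | bad t}) : {t' | bad t'} :=
  let w := cid (step _ (svalP t)) in
  exist _ (sval w) (let: And3 b _ _ := svalP w in b).
pose s k := iter k next (exist _ t0 bad0).
have sz k : size (sval (s k)) = size t0 / 2 ^+ k.
  elim: k => [|k IH]; first by rewrite expr0 divr1.
  rewrite /= exprSr invfM mulrA -IH; rewrite /next.
  by case: (cid _) => /= t' [].
have [z Hz] : exists z, forall k,
    nm (z - base (sval (s k))) <= 4 * size t0 / 2 ^+ k.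
  apply: (@geometric_limit (fun k => base (sval (s k)))) => k.
  by rewrite -sz /= /next; case: (cid _) => /= t' [].
exists z => eps eps0.
have [k Hk] : exists k, size t0 / 2 ^+ k < eps.
  pose k := Num.bound (`|size t0 / eps|).
  exists k; rewrite ltr_pdivrMr ?exprn_gt0 //.
  have h1 : size t0 / eps < k%:R.
    exact: le_lt_trans (ler_norm _) (archi_boundP (normr_ge0 _)).
  have h2 : k%:R <= 2 ^+ k :> R.
    by rewrite -natrX ler_nat ltnW // ltn_expl.
  by rewrite mulrC -ltr_pdivrMr //; apply: lt_le_trans h1 h2.
exists (sval (s k)); split; [exact: svalP | by rewrite sz | ].
by rewrite sz mulrA.
Qed.

End Bisection.

(** * Goursat's lemma for midpoint sums *)

(** The [x] are the half-sides of a triangle in order, the [y] the sides of its medial triangle,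
    each traversed once in either direction. *)
Lemma triangle_split (V : zmodType) (x1 x2 x3 x4 x5 x6 y1 y2 y3 : V) :
  x1 + x2 + (x3 + x4) + (x5 + x6) =
  x1 + y1 + x6 + (x2 + x3 - y2) + (- y3 + x4 + x5) + (y2 + y3 - y1).
Proof.
rewrite [RHS](AC (3*3*3*3) ((1*4)*(5*8)*(9*3)*((2*12)*(10*6)*(11*7)))) /=.
by rewrite !subrr !addr0.
Qed.

Lemma triangle_affine (V : zmodType) (a1 a2 a3 x1 x2 x3 x4 x5 x6 : V) :
  x1 + x3 + x5 = 0 -> x2 + x4 + x6 = 0 ->
  a1 - (x1 + x2) + (a2 - (x3 + x4)) + (a3 - (x5 + x6)) = a1 + a2 + a3.
Proof.
move=> e1 e2; rewrite [X in X + _]addrACA -opprD addrACA -opprD.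
by rewrite [X in X + (x5 + x6)]addrACA [X in _ - X]addrACA e1 e2 addr0 subr0.
Qed.

Section MidpointSums.
Variables (R : realType) (Y : normedModType R[i]).
Local Notation C := R[i].
Implicit Types (g : C -> Y) (p q a b c z w : C).

Definition is_cder g z (d : Y) := forall eps : R, 0 < eps ->
  exists2 del, 0 < del & forall w, nm (w - z) < del ->
    nm (g w - g z - (w - z) *: d) <= eps * nm (w - z).

(* The midpoint Riemann sum of g on [p, q] with 2^n subintervals.  Additivity
   under halving holds exactly (by definition), and not only in the limit. *)
Fixpoint midsum n g p q : Y :=
  if n is n'.+1 then midsum n' g p ((p + q) / 2) + midsum n' g ((p + q) / 2) q
  else (q - p) *: g ((p + q) / 2).

Lemma midsum_rev n g p q : midsum n g q p = - midsum n g p q.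
Proof.
elim: n p q => [|n IH] p q /=; first by rewrite -scaleNr opprB [q + p]addrC.
by rewrite [q + p]addrC opprD [RHS]addrC; congr (_ + _); apply: IH.
Qed.

Lemma midsumB n g1 g2 p q :
  midsum n (fun z => g1 z - g2 z) p q = midsum n g1 p q - midsum n g2 p q.
Proof.
elim: n p q => [|n IH] p q /=; first by rewrite scalerBr.
by rewrite !IH opprD addrACA.
Qed.

(** The midpoint rule is exact on affine functions, at every level [n]; this replaces the vanishing
    of the integral of an affine function over a closed contour. *)
Lemma midsum_affine n z (y d : Y) p q :
  midsum n (fun w => y + (w - z) *: d) p q =
  (q - p) *: y + (((q - z) ^+ 2 - (p - z) ^+ 2) / 2) *: d.
Proof.
elim: n p q => [|n IH] p q /=.
  by rewrite scalerDr scalerA; congr (_ + _ *: _); field.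
rewrite !IH addrACA -!(scalerDl y) -!(scalerDl d).
by congr (_ *: _ + _ *: _); field.
Qed.

Definition midconvex (D : C -> Prop) :=
  forall p q, D p -> D q -> D ((p + q) / 2).

Lemma midsum_bound n g (D : C -> Prop) K p q :
  midconvex D -> (forall w, D w -> nm (g w) <= K) -> D p -> D q ->
  nm (midsum n g p q) <= K * nm (q - p).
Proof.
move=> Dm gK; elim: n p q => [|n IH] p q Dp Dq /=.
  by rewrite nmZ mulrC ler_wpM2r ?nm_ge0 // gK //; apply: Dm.
apply: le_trans (nm_leD _ _) _.
have D2 := Dm _ _ Dp Dq.
have h1 := IH _ _ Dp D2; have h2 := IH _ _ D2 Dq.
apply: le_trans (lerD h1 h2) _; rewrite -mulrDr.
have -> : (p + q) / 2 - p = (q - p) / 2 by field.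
have -> : q - (p + q) / 2 = (q - p) / 2 by field.
suff -> : nm ((q - p) / 2) + nm ((q - p) / 2) = nm (q - p) by [].
by rewrite nmM nmV nm_nat; field.
Qed.

Lemma midconvex_ball z r : midconvex (fun w => nm (w - z) <= r).
Proof.
move=> p q hp hq; have -> : (p + q) / 2 - z = 2^-1 * (p - z) + 2^-1 * (q - z).
  by field.
apply: le_trans (nm_leD _ _) _; rewrite !nmM nmV nm_nat; lra.
Qed.

Definition tri n g a b c := midsum n g a b + midsum n g b c + midsum n g c a.

Lemma triS n g a b c (ab := (a + b) / 2) (bc := (b + c) / 2)
    (ca := (c + a) / 2) :
  tri n.+1 g a b c = tri n g a ab ca + tri n g ab b bc + tri n g ca bc c
    + tri n g ab bc ca.
Proof.
rewrite /tri /= -/ab -/bc -/ca.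
rewrite (midsum_rev n g ab bc) (midsum_rev n g bc ca) (midsum_rev n g ab ca).
exact: triangle_split.
Qed.

(** The dichotomy is on being eventually bounded by [e] times the squared perimeter. If all four
    quarters satisfy this, so does the triangle; a failure therefore descends to arbitrarily small
    triangles around a point [z] of [D], where [g] is affine up to a small error and the bound holds
    for every [n]. *)
Lemma goursat g (D : C -> Prop) a b c : midconvex D ->
  (forall z, (forall eps : R, 0 < eps -> exists2 w, D w & nm (w - z) < eps) ->
    D z) ->
  (forall z, D z -> exists d, is_cder g z d) -> D a -> D b -> D c ->
  forall eta : R, 0 < eta ->
    exists n0, forall n, (n0 <= n)%N -> nm (tri n g a b c) <= eta.
Proof.
move=> Dm Dcl dg Da Db Dc eta eta0.
pose T := (C * C * C)%type.
pose per (t : T) := nm (t.1.2 - t.1.1) + nm (t.2 - t.1.2) + nm (t.1.1 - t.2).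
pose good e (t : T) := exists n0, forall n, (n0 <= n)%N ->
  nm (tri n g t.1.1 t.1.2 t.2) <= e * per t ^+ 2.
suff H e : 0 < e -> good e (a, b, c).
  have per0 : 0 <= per (a, b, c) by rewrite /per !addr_ge0 ?nm_ge0.
  have p1 : 0 < per (a, b, c) ^+ 2 + 1.
    by rewrite ltr_wpDl ?sqr_ge0.
  have [n0 Hn] := H (eta / (per (a, b, c) ^+ 2 + 1)) (divr_gt0 eta0 p1).
  exists n0 => n /Hn /le_trans; apply.
  rewrite mulrAC ler_pdivrMr // ler_pM2l //; lra.
move=> e0; apply: contrapT => bad0.
pose bad (t : T) := [/\ ~ good e t, D t.1.1, D t.1.2 & D t.2].
have [||z Hz] := @bisection R T (fun t => t.1.1) per bad (a, b, c); last 2 first.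
- by split.
- have Dz : D z.
    apply: Dcl => eps eps0; have [] := Hz (eps / 4); first by rewrite divr_gt0.
    move=> t [[_ Dt _ _] small near]; exists t.1.1 => //; rewrite nm_dist.
    by apply: le_lt_trans near _; lra.
  have [d Hd] := dg z Dz.
  (* Vertices lie within 5 perimeters of [z], so the affine approximation is off by at most [e/6]
     times [5p], hence by [e p]; along the contour this yields [e p^2]. *)
  have [del del0 Hdel] := Hd (e / 6) (divr_gt0 e0 (ltr0n _ 6)).
  have [|t [[nt _ _ _] small near]] := Hz (del / 6).
    by rewrite divr_gt0.
  apply: nt; exists 0%N => n _.
  set u := t.1.1 in near *; set v := t.1.2; set w := t.2.
  set p := per t in small near *.
  have pE : p = nm (v - u) + nm (w - v) + nm (u - w) by [].
  have p0 : 0 <= p by rewrite pE !addr_ge0 ?nm_ge0.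
  have hu : nm (u - z) <= 5 * p by rewrite nm_dist; lra.
  have hv : nm (v - z) <= 5 * p.
    have := nm_trans v u z; rewrite nm_dist in near.
    have := nm_ge0 (w - v); have := nm_ge0 (u - w); lra.
  have hw : nm (w - z) <= 5 * p.
    have := nm_trans w u z; rewrite nm_dist in near.
    have := nm_ge0 (w - v); have := nm_ge0 (v - u); have := nm_dist w u; lra.
  pose g' x := g x - (g z + (x - z) *: d).
  have triB : tri n g u v w = tri n g' u v w.
    rewrite /tri /g' !midsumB !midsum_affine.
    symmetry; apply: triangle_affine.
      rewrite -!(scalerDl (g z)) (_ : v - u + (w - v) + (u - w) = 0).
        by rewrite scale0r.
      by ring.
    rewrite -!(scalerDl d) (_ : _ + _ + _ = 0) ?scale0r //.
    by ring.
  have g'K x : nm (x - z) <= 5 * p -> nm (g' x) <= e * p.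
    move=> hx; rewrite /g' opprD addrA.
    apply: (@le_trans _ _ (e / 6 * nm (x - z))); first by apply: Hdel; lra.
    apply: (@le_trans _ _ (e / 6 * (5 * p))); last by nra.
    by rewrite ler_pM2l ?divr_gt0.
  have B x y : nm (x - z) <= 5 * p -> nm (y - z) <= 5 * p ->
      nm (midsum n g' x y) <= e * p * nm (y - x).
    move=> hx hy.
    apply: (@midsum_bound n g' (fun w => nm (w - z) <= 5 * p)) => //.
    exact: midconvex_ball.
  rewrite triB /tri; apply: le_trans (nm_leD _ _) _.
  have h1 := nm_leD (midsum n g' u v) (midsum n g' v w).
  have := B _ _ hu hv; have := B _ _ hv hw; have := B _ _ hw hu.
  rewrite expr2 mulrA {3}pE !mulrDr; lra.
move=> t [nt D1 D2 D3].
set u := t.1.1 in D1 *; set v := t.1.2 in D2 *; set w := t.2 in D3 *.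
have pE : per t = nm (v - u) + nm (w - v) + nm (u - w) by [].
set uv := (u + v) / 2; set vw := (v + w) / 2; set wu := (w + u) / 2.
have Duv : D uv by apply: Dm. have Dvw : D vw by apply: Dm.
have Dwu : D wu by apply: Dm.
have nh (x y : C) : x = y / 2 -> nm x = nm y / 2.
  by move=> ->; rewrite nmM nmV nm_nat.
have e1 : nm (uv - u) = nm (v - u) / 2 by apply: nh; rewrite /uv; field.
have e2 : nm (v - uv) = nm (v - u) / 2 by apply: nh; rewrite /uv; field.
have e3 : nm (vw - v) = nm (w - v) / 2 by apply: nh; rewrite /vw; field.
have e4 : nm (w - vw) = nm (w - v) / 2 by apply: nh; rewrite /vw; field.
have e5 : nm (wu - w) = nm (u - w) / 2 by apply: nh; rewrite /wu; field.
have e6 : nm (u - wu) = nm (u - w) / 2 by apply: nh; rewrite /wu; field.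
have f1 : nm (wu - uv) = nm (w - v) / 2 by apply: nh; rewrite /wu /uv; field.
have f2 : nm (uv - vw) = nm (u - w) / 2 by apply: nh; rewrite /vw /uv; field.
have f3 : nm (vw - wu) = nm (v - u) / 2 by apply: nh; rewrite /wu /vw; field.
pose t1 : T := (u, uv, wu); pose t2 : T := (uv, v, vw).
pose t3 : T := (wu, vw, w); pose t4 : T := (uv, vw, wu).
have p1 : per t1 = per t / 2 by rewrite pE /per /= e1 f1 e6; field.
have p2 : per t2 = per t / 2 by rewrite pE /per /= e2 e3 f2; field.
have p3 : per t3 = per t / 2 by rewrite pE /per /= f3 e4 e5; field.
have p4 : per t4 = per t / 2.
  by rewrite pE /per /= (nm_dist vw) f2 (nm_dist wu) f3 (nm_dist uv) f1; field.
have n1 := nm_ge0 (v - u); have n2 := nm_ge0 (w - v); have n3 := nm_ge0 (u - w).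
have [[N1 H1]|b1] := pselect (good e t1); last first.
  by exists t1; split=> //; rewrite /= subrr nm0 pE; lra.
have [[N2 H2]|b2] := pselect (good e t2); last first.
  by exists t2; split=> //; rewrite /= -/u e1 pE; lra.
have [[N3 H3]|b3] := pselect (good e t3); last first.
  by exists t3; split=> //; rewrite /= -/u nm_dist e6 pE; lra.
have [[N4 H4]|b4] := pselect (good e t4); last first.
  by exists t4; split=> //; rewrite /= -/u e1 pE; lra.
(* Level [n.+1] of the triangle consists of level [n] of the quarters, hence the successor in the
   threshold. The four bounds [e (per/2)^2] add up to [e per^2]. *)
case: nt; exists (maxn (maxn N1 N2) (maxn N3 N4)).+1 => -[//|n].
rewrite ltnS !geq_max => /andP[/andP[/H1 k1 /H2 k2] /andP[/H3 k3 /H4 k4]].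
rewrite triS -/u -/v -/w -/uv -/vw -/wu.
rewrite p1 in k1; rewrite p2 in k2; rewrite p3 in k3; rewrite p4 in k4.
rewrite /= in k1 k2 k3 k4.
apply: le_trans (nm_leD _ _) _; have := nm_leD (tri n g u uv wu + tri n g uv v vw) (tri n g wu vw w).
have := nm_leD (tri n g u uv wu) (tri n g uv v vw).
have -> : e * per t ^+ 2 = 4 * (e * (per t / 2) ^+ 2) by field.
lra.
Qed.

End MidpointSums.

(** * Complex derivatives *)

Section Continuity.
Variable R : realType.
Local Notation C := R[i].

Lemma near_nmP (V : normedModType C) (x : V) (P : V -> Prop) :
  (\forall y \near x, P y) <->
  exists2 del : R, 0 < del & forall y, nm (y - x) < del -> P y.
Proof.
split.
  move=> /nbhs_ballP [e /= e0 He].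
  have eE : e = (complex.Re e)%:C.
    by move: e0; rewrite ltcE; case: (e) => a b /= /andP[/eqP -> _].
  exists (complex.Re e); first by move: e0; rewrite eE ltcR.
  move=> y hy; apply: He; rewrite -ball_normE /ball_ /=.
  by rewrite eE nm_lt nm_dist.
move=> [del del0 H]; apply/nbhs_ballP; exists del%:C; first by rewrite /= ltcR.
by move=> y; rewrite -ball_normE /ball_ /= nm_lt nm_dist; apply: H.
Qed.

Lemma cvg_nmP (U V : normedModType C) (s : U -> V) (x : U) (l : V) :
  (s y @[y --> x] --> l) <->
  forall eps : R, 0 < eps ->
    exists2 del : R, 0 < del & forall y, nm (y - x) < del -> nm (s y - l) <= eps.
Proof.
split.
  move=> /cvgrPdist_le H eps eps0; have := H eps%:C.
  rewrite ltcR => /(_ eps0) /near_nmP [del del0 Hd]; exists del => // y /Hd.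
  by rewrite nm_le nm_dist.
move=> H; apply/cvgrPdist_le => e e0.
have eE : e = (complex.Re e)%:C.
  by move: e0; rewrite ltcE; case: (e) => a b /= /andP[/eqP -> _].
have e1 : 0 < complex.Re e by move: e0; rewrite eE ltcR.
have [del del0 Hd] := H _ e1.
by apply/near_nmP; exists del => // y /Hd; rewrite eE nm_le nm_dist.
Qed.

End Continuity.

Section Slope.
Variable K : numFieldType.
Local Notation C := (K^o).
Implicit Types (Y : normedModType K) (z w : C).

(** Caratheodory's form of differentiability: a factor [s], continuous at [z], replaces the
    difference quotient. The rules of calculus become algebra plus continuity, and the chain rule
    needs no division by [k w - k z], which may vanish. *)
Definition has_slope Y (g : C -> Y) z (d : Y) :=
  exists s : C -> Y, [/\ \forall w \near z, g w = g z + (w - z) *: s w,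
    s z = d & s w @[w --> z] --> s z].

Lemma slope_cont Y (g : C -> Y) z d : has_slope g z d -> g w @[w --> z] --> g z.
Proof.
move=> [s [gs _ sc]].
have <- : g z + (z - z) *: s z = g z by rewrite subrr scale0r addr0.
have H : (g z + (w - z) *: s w) @[w --> z] --> g z + (z - z) *: s z.
  apply: (@cvgD _ _ _ (nbhs z) _); first exact: (@cvg_cst _ _ _ (nbhs z) _).
  apply: (@cvgZ _ _ _ (nbhs z) _) => //.
  by apply: (@cvgB _ _ _ (nbhs z) _); [exact: cvg_id | exact: (@cvg_cst _ _ _ (nbhs z) _)].
apply: cvg_trans H; apply: (@near_eq_cvg _ _ (nbhs z) _); near=> w.
by near: w; apply: filterS gs => w ->.
Unshelve. all: by end_near.
Qed.

Lemma slope_cst Y (c : Y) z : has_slope (fun=> c) z 0.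
Proof.
exists (fun=> 0); split=> //; last exact: (@cvg_cst _ _ _ (nbhs z) _).
by near=> w; rewrite scaler0 addr0.
Unshelve. all: by end_near.
Qed.

Lemma slope_id z : has_slope (fun w : C => w) z 1.
Proof.
exists (fun=> 1); split=> //; last exact: (@cvg_cst _ _ _ (nbhs z) _).
by near=> w; rewrite -[_ *: _]/(_ * _) mulr1 addrC subrK.
Unshelve. all: by end_near.
Qed.

Lemma slopeD Y (g h : C -> Y) z d e : has_slope g z d -> has_slope h z e ->
  has_slope (fun w => g w + h w) z (d + e).
Proof.
move=> [s [gs <- sc]] [t [ht <- tc]].
exists (fun w => s w + t w); split=> //; last first.
  exact: (@cvgD _ _ _ (nbhs z) _).
near=> w; have -> : g w = g z + (w - z) *: s w by near: w.
have -> : h w = h z + (w - z) *: t w by near: w.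
by rewrite scalerDr addrACA.
Unshelve. all: by end_near.
Qed.

Lemma slopeZ Y (k : C -> C) (g : C -> Y) z e d :
  has_slope k z e -> has_slope g z d ->
  has_slope (fun w => k w *: g w) z (e *: g z + k z *: d).
Proof.
move=> ke gd; have gc := slope_cont gd.
move: ke gd => [s [ks <- sc]] [t [gt <- tc]].
exists (fun w => s w *: g w + k z *: t w); split=> //; last first.
  apply: (@cvgD _ _ _ (nbhs z) _); first exact: (@cvgZ _ _ _ (nbhs z) _).
  by apply: (@cvgZ _ _ _ (nbhs z) _) => //; exact: (@cvg_cst _ _ _ (nbhs z) _).
near=> w; have kE : k w = k z + (w - z) *: s w by near: w.
have gE : g w = g z + (w - z) *: t w by near: w.
rewrite [in LHS]kE scalerDl [in k z *: g w]gE !scalerDr !scalerA -!addrA.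
congr (_ + _); rewrite [k z * _]mulrC addrC; congr (_ + _).
Unshelve. all: by end_near.
Qed.

Lemma slopeV (k : C -> C) z (e : C) : has_slope k z e -> k z != 0 ->
  has_slope (fun w => (k w)^-1 : C) z (- e / k z ^+ 2).
Proof.
move=> ke kz; have kc := slope_cont ke.
move: ke => [s [ks <- sc]].
exists (fun w => - s w / (k w * k z)); split=> //; last first.
  apply: (@cvgM _ _ (nbhs z) _); first exact: (@cvgN _ _ _ (nbhs z) _).
  apply: (@cvgV _ _ (nbhs z) _); first by rewrite mulf_neq0.
  by apply: (@cvgM _ _ (nbhs z) _) => //; exact: (@cvg_cst _ _ _ (nbhs z) _).
have kn : \forall w \near z, k w != 0.
  exact: (@cvgr_neq0 _ _ _ (nbhs z) _ k (k z) kc kz).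
near=> w; have kE : k w = k z + (w - z) *: s w by near: w.
have kw : k w != 0 by near: w.
rewrite -[_ *: (_ / _)]/((w - z) * _).
have sE : (w - z) * s w = k w - k z by rewrite kE [k z + _]addrC addrK.
by rewrite mulrA mulrN sE; field; rewrite kw kz.
Unshelve. all: by end_near.
Qed.

Lemma slope_comp Y (g : C -> Y) (k : C -> C) z e d :
  has_slope k z e -> has_slope g (k z) d ->
  has_slope (fun w => g (k w)) z (e *: d).
Proof.
move=> ke; have kc := slope_cont ke.
move: ke => [s [ks <- sc]] [t [gt <- tc]].
exists (fun w => s w *: t (k w)); split=> //; last first.
  by apply: (@cvgZ _ _ _ (nbhs z) _) => //; apply: (cvg_comp _ _ kc tc).
have gk : \forall w \near z, g (k w) = g (k z) + (k w - k z) *: t (k w).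
  exact: kc gt.
near=> w; have kE : k w = k z + (w - z) *: s w by near: w.
have -> : g (k w) = g (k z) + (k w - k z) *: t (k w) by near: w.
by rewrite [k w - _](_ : _ = (w - z) *: s w) ?scalerA // kE [k z + _]addrC addrK.
Unshelve. all: by end_near.
Qed.

Lemma slope_near Y (g h : C -> Y) z d :
  (\forall w \near z, g w = h w) -> has_slope g z d -> has_slope h z d.
Proof.
move=> gh [s [gs sd sc]]; exists s; split=> //.
have ghz : g z = h z by apply: (nbhs_singleton gh).
near=> w; have <- : g w = h w by near: w.
by rewrite -ghz; near: w.
Unshelve. all: by end_near.
Qed.

End Slope.

Section ComplexDerivative.
Variable R : realType.
Local Notation C := (R[i]^o).
Implicit Types (Y : normedModType R[i]) (z w : C).

Lemma is_cderP Y (g : C -> Y) z d : is_cder g z d <-> has_slope g z d.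
Proof.
split.
  move=> H; pose s w := if w == z then d else (w - z)^-1 *: (g w - g z).
  exists s; split; last 2 first.
  - by rewrite /s eqxx.
  - apply/cvg_nmP => eps eps0; have [del del0 Hd] := H eps eps0.
    exists del => // w /Hd; rewrite /s eqxx; have [->|wz] := eqVneq w z.
      by move=> _; rewrite subrr nm0 ltW.
    rewrite -subr_eq0 in wz.
    have -> : (w - z)^-1 *: (g w - g z) - d =
              (w - z)^-1 *: (g w - g z - (w - z) *: d).
      by rewrite [RHS]scalerBr scalerK.
    move=> h; rewrite nmZ nmV mulrC ler_pdivrMr ?nm_gt0 //; exact: h.
  apply/near_nmP; exists 1 => // w _; rewrite /s; case: eqVneq => [->|wz].
    by rewrite subrr scale0r addr0.
  by rewrite scalerKV ?subr_eq0 // addrC subrK.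
move=> [s [/near_nmP [d1 d10 H1] <- /cvg_nmP Hs]] eps eps0.
have [d2 d20 H2] := Hs eps eps0.
exists (Num.min d1 d2); first by rewrite lt_min d10.
move=> w; rewrite lt_min => /andP[/H1 -> /H2 h].
by rewrite (addrC (g z)) addrK -scalerBr nmZ mulrC ler_wpM2r ?nm_ge0.
Qed.

Lemma is_cder_cont Y (g : C -> Y) z d : is_cder g z d ->
  forall eps : R, 0 < eps ->
    exists2 del : R, 0 < del & forall w, nm (w - z) < del -> nm (g w - g z) <= eps.
Proof. by move=> /is_cderP /slope_cont /cvg_nmP. Qed.

Lemma is_cder_cst Y (c : Y) z : is_cder (fun=> c) z 0.
Proof. exact/is_cderP/slope_cst. Qed.

Lemma is_cder_id z : is_cder (fun w : C => w) z 1.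
Proof. exact/is_cderP/slope_id. Qed.

Lemma is_cderD Y (g h : C -> Y) z d e : is_cder g z d -> is_cder h z e ->
  is_cder (fun w => g w + h w) z (d + e).
Proof. by move=> /is_cderP gd /is_cderP he; exact/is_cderP/slopeD. Qed.

Lemma is_cderZ Y (k : C -> C) (g : C -> Y) z e d :
  is_cder k z e -> is_cder g z d ->
  is_cder (fun w => k w *: g w) z (e *: g z + k z *: d).
Proof. by move=> /is_cderP gd /is_cderP he; exact/is_cderP/slopeZ. Qed.

Lemma is_cderM (k g : C -> C) z e d :
  is_cder k z e -> is_cder g z d ->
  is_cder (fun w => k w * g w : C) z (e * g z + k z * d).
Proof. exact: is_cderZ. Qed.

Lemma is_cderV (k : C -> C) z e : is_cder k z e -> k z != 0 ->
  is_cder (fun w => (k w)^-1 : C) z (- e / k z ^+ 2).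
Proof. by move=> /is_cderP ke kz; exact/is_cderP/slopeV. Qed.

Lemma is_cder_comp Y (g : C -> Y) (k : C -> C) z e d :
  is_cder k z e -> is_cder g (k z) d -> is_cder (fun w => g (k w)) z (e *: d).
Proof. by move=> /is_cderP ke /is_cderP gd; apply/is_cderP/slope_comp. Qed.

Lemma is_cderB Y (g h : C -> Y) z d e : is_cder g z d -> is_cder h z e ->
  is_cder (fun w => g w - h w) z (d - e).
Proof.
move=> gd he.
have -> : (fun w => g w - h w) = (fun w => g w + (-1 : C) *: h w).
  by apply/funext => w; rewrite scaleN1r.
have -> : d - e = d + (0 *: h z + (-1 : C) *: e).
  by rewrite scale0r add0r scaleN1r.
by apply: is_cderD => //; apply: is_cderZ => //; exact: is_cder_cst.
Qed.

Lemma is_cder_near Y (g h : C -> Y) z d (del : R) : 0 < del ->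
  (forall w, nm (w - z) < del -> g w = h w) -> is_cder g z d -> is_cder h z d.
Proof.
move=> del0 gh /is_cderP gd; apply/is_cderP; apply: slope_near gd.
by apply/near_nmP; exists del.
Qed.

End ComplexDerivative.

(** * The mean value bound on a square *)

Lemma sector_cancel (V : zmodType) (r1 r2 r3 r4 e1 e2 e3 e4 : V) :
  (r1 + e1 - r2) + (r2 + e2 - r3) + (r3 + e3 - r4) + (r4 + e4 - r1) =
  e1 + e2 + e3 + e4.
Proof.
rewrite [LHS](AC (3*3*3*3)
  (2*5*8*11*((1*12)*(4*3)*(7*6)*(10*9)))) /=.
by rewrite !subrr !addr0.
Qed.

Lemma addrB4 (V : zmodType) (a1 a2 a3 a4 b1 b2 b3 b4 : V) :
  (a1 - b1) + (a2 - b2) + (a3 - b3) + (a4 - b4) =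
  a1 + a2 + a3 + a4 - (b1 + b2 + b3 + b4).
Proof.
by rewrite !opprD [LHS](AC (2*2*2*2) ((1*3*5*7)*(2*4*6*8))).
Qed.

Section PuncturedDisc.
Variables (R : realType) (Y : normedModType R[i]).
Local Notation C := R[i].
Implicit Types (g : C -> Y) (p q a b c z w : C).

Definition vanishing (u : nat -> Y) := forall eta : R, 0 < eta ->
  exists n0, forall n, (n0 <= n)%N -> nm (u n) <= eta.

Lemma vanishingD u v : vanishing u -> vanishing v ->
  vanishing (fun n => u n + v n).
Proof.
move=> hu hv eta eta0; have e2 : 0 < eta / 2 by rewrite divr_gt0.
have [n1 H1] := hu _ e2; have [n2 H2] := hv _ e2.
exists (maxn n1 n2) => n; rewrite geq_max => /andP[/H1 h1 /H2 h2].
by apply: le_trans (nm_leD _ _) _; lra.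
Qed.

Lemma vanishing_ext u v : (forall n, u n = v n) -> vanishing u -> vanishing v.
Proof.
by move=> uv hu eta /hu [n0 H]; exists n0 => n /H; rewrite uv.
Qed.

Lemma vanishing_shift k u : vanishing u -> vanishing (fun n => u (n + k)%N).
Proof.
move=> hu eta /hu [n0 H]; exists n0 => n nn; apply: H.
by rewrite (leq_trans nn) // leq_addr.
Qed.

(** A half-plane cut with a disc. For [k = (1 - 'i) / z] the line [Re (k w) = 1] carries the edge
    from [z] to ['i z], and [Re (k w) = 1/2] the parallel one from [z/2] to ['i z/2]; the wedges
    beyond these lines avoid 0. *)
Definition wedge (k : C) (r0 r : R) w := r0 <= complex.Re (k * w) /\ nm w <= r.

Lemma wedge_midconvex k (s r : R) : midconvex (wedge k s r).
Proof.
move=> p q [p1 p2] [q1 q2]; split.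
  have -> : k * ((p + q) / 2) = (2^-1 : R)%:C * (k * p + k * q).
    by rewrite fmorphV rmorph_nat /=; field.
  rewrite cReM cReD /=; lra.
rewrite nmM nmV nm_nat; have := nm_leD p q; lra.
Qed.

Lemma wedge_closed k (s r : R) z :
  (forall eps : R, 0 < eps -> exists2 w, wedge k s r w & nm (w - z) < eps) ->
  wedge k s r z.
Proof.
move=> H; split.
  apply/ler_addgt0Pl => e e0.
  have k1 : 0 < nm k + 1 by rewrite ltr_wpDl ?nm_ge0.
  have [w [w1 _] wz] := H _ (divr_gt0 e0 k1).
  have : complex.Re (k * (w - z)) <= e.
    apply: le_trans (ler_norm _) _; apply: le_trans (Re_le_nm _) _.
    rewrite nmM; have := nm_ge0 (w - z); have := nm_ge0 k.
    move: wz; rewrite ltr_pdivlMr //; nra.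
  rewrite mulrBr cReD cReN; lra.
apply/ler_addgt0Pl => e e0; have [w [_ w2] wz] := H _ e0.
by have := nm_geB z w; rewrite nm_dist; lra.
Qed.

Definition punctured g z := forall w, w != 0 -> nm w <= nm z ->
  exists d, is_cder g w d.

(** One side of the square with vertices [z], ['i z], [-z], [-'i z]; multiplication by ['i] permutes
    the sides. *)
Definition edge n g z := midsum n g z ('i * z).
Definition quad n g z := edge n g z + edge n g ('i * z) +
  edge n g (- z) + edge n g (- ('i * z)).

Lemma nm_iz z : nm ('i * z) = nm z.
Proof. by rewrite nmM nm_i mul1r. Qed.

Lemma ii z : 'i * ('i * z) = - z.
Proof. by rewrite mulrA -expr2 sqr_i mulN1r. Qed.

Lemma tri_vanishing g z a b c (k := (1 - 'i) / z) : z != 0 -> punctured g z ->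
  wedge k (1 / 2) (nm z) a -> wedge k (1 / 2) (nm z) b ->
  wedge k (1 / 2) (nm z) c -> vanishing (fun n => tri n g a b c).
Proof.
move=> z0 gz Da Db Dc.
apply: (goursat (@wedge_midconvex k (1 / 2) (nm z)) _ _ Da Db Dc).
  exact: wedge_closed.
move=> w [w1 w2]; apply: gz => //; apply/eqP => w0.
by move: w1; rewrite w0 mulr0 /=; lra.
Qed.

(** Of the four quarters of the triangle [0, z, 'i z], only the one at the origin meets the
    puncture, and it is the same triangle at half scale, one level lower. Goursat's lemma disposes
    of the other three. *)
Lemma sector_vanishing g z : z != 0 -> punctured g z ->
  vanishing (fun n => tri n.+1 g 0 z ('i * z) - tri n g 0 (z / 2) ('i * (z / 2))).
Proof.
move=> z0 gz; set k := (1 - 'i) / z.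
pose u := 'i * z; pose D := wedge k (1 / 2) (nm z).
have kz : k * z = 1 - 'i by rewrite /k divfK.
have ku : k * u = 1 + 'i.
  by rewrite /u mulrCA kz mulrBr mulr1 -expr2 sqr_i opprK addrC.
have nz := nm_ge0 z.
have h (x : C) : nm (x / 2) = nm x / 2 by rewrite nmM nmV nm_nat.
have hR (x : C) : complex.Re (x / 2) = complex.Re x / 2.
  have -> : x / 2 = (2^-1 : R)%:C * x by rewrite fmorphV rmorph_nat mulrC.
  by rewrite cReM /=; lra.
have Dz : D z by split=> //; rewrite kz /=; lra.
have Du : D u by split; [rewrite ku /=; lra | rewrite /u nm_iz].
have Dz2 : D (z / 2) by split; [rewrite mulrA hR kz /=; lra | rewrite h; lra].
have Du2 : D (u / 2).
  by split; [rewrite mulrA hR ku /=; lra | rewrite h /u nm_iz; lra].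
have Dm : D ((z + u) / 2) by apply: wedge_midconvex.
have V1 := tri_vanishing z0 gz Dz2 Dz Dm.
have V2 := tri_vanishing z0 gz Du2 Dm Du.
have V3 := tri_vanishing z0 gz Dz2 Dm Du2.
apply: vanishing_ext (vanishingD (vanishingD V1 V2) V3) => n.
have -> : 'i * (z / 2) = u / 2 by rewrite mulrA.
rewrite triS !add0r !addr0 -/u; apply/eqP; rewrite eq_sym subr_eq.
by rewrite [X in _ == X]addrC !addrA.
Qed.

Lemma quadE n g z : quad n g z = tri n g 0 z ('i * z) +
  tri n g 0 ('i * z) (- z) + tri n g 0 (- z) (- ('i * z)) +
  tri n g 0 (- ('i * z)) z.
Proof.
rewrite /quad /edge !mulrN !ii opprK /tri.
rewrite (midsum_rev n g 0 ('i * z)) (midsum_rev n g 0 (- z)).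
rewrite (midsum_rev n g 0 (- ('i * z))) (midsum_rev n g 0 z).
by symmetry; exact: sector_cancel.
Qed.

Lemma puncturedN g z w : nm w = nm z -> punctured g z -> punctured g w.
Proof. by move=> e gz x x0 xw; apply: gz => //; rewrite -e. Qed.

(** Adding the four sectors cancels their radial sides. This is the invariance of the contour
    integral when the square shrinks towards the puncture. *)
Lemma quad_halve g z : z != 0 -> punctured g z ->
  vanishing (fun n => quad n.+1 g z - quad n g (z / 2)).
Proof.
move=> z0 gz.
have i0 : 'i != 0 :> C by rewrite -nm_gt0 nm_i.
have iz0 : 'i * z != 0 by rewrite mulf_neq0.
have nz0 : - z != 0 by rewrite oppr_eq0.
have niz0 : - ('i * z) != 0 by rewrite oppr_eq0.
have V1 := sector_vanishing z0 gz.
have V2 := sector_vanishing iz0 (puncturedN (nm_iz z) gz).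
have V3 := sector_vanishing nz0 (puncturedN (nmN z) gz).
have e4 : nm (- ('i * z)) = nm z by rewrite nmN nm_iz.
have V4 := sector_vanishing niz0 (puncturedN e4 gz).
apply: vanishing_ext (vanishingD (vanishingD (vanishingD V1 V2) V3) V4) => n.
rewrite !quadE addrB4.
have -> : 'i * z / 2 = 'i * (z / 2) by rewrite mulrA.
have -> : - z / 2 = - (z / 2) by rewrite mulNr.
have -> : - ('i * z) / 2 = - ('i * (z / 2)) by rewrite mulNr mulrA.
by rewrite !mulrN !ii !opprK.
Qed.

Lemma quad_shrink g z k : z != 0 -> punctured g z ->
  vanishing (fun n => quad (n + k)%N g z - quad n g (z / 2 ^+ k)).
Proof.
elim: k z => [|k IH] z z0 gz.
  move=> eta eta0; exists 0%N => n _.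
  by rewrite addn0 expr0 divr1 subrr nm0 ltW.
have z20 : z / 2 != 0 by rewrite mulf_neq0 ?invr_eq0 ?pnatr_eq0.
have gz2 : punctured g (z / 2).
  move=> w w0 wz; apply: gz => //; apply: le_trans wz _.
  by rewrite nmM nmV nm_nat; have := nm_ge0 z; lra.
have V1 := vanishing_shift k (quad_halve z0 gz).
apply: vanishing_ext (vanishingD V1 (IH _ z20 gz2)) => n.
by rewrite addnS exprS invfM mulrA addrA subrK.
Qed.

Lemma nm_1i : nm (1 - 'i : C) <= 2.
Proof. by apply: le_trans (nm_leB _ _) _; rewrite nm1 nm_i. Qed.

(** On the edge [Re (k w) >= 1] with [|k| <= 2 / |z|], so it stays outside radius [|z| / 2], where
    the bound [K] applies; its length is at most [2 |z|]. *)
Lemma edge_bound n g z K : z != 0 ->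
  (forall w, nm z / 2 <= nm w -> nm w <= nm z -> nm (g w) <= K) ->
  nm (edge n g z) <= 2 * K * nm z.
Proof.
move=> z0 gK; set k := (1 - 'i) / z.
have nz : 0 < nm z by rewrite nm_gt0.
have kz : k * z = 1 - 'i by rewrite /k divfK.
have ku : k * ('i * z) = 1 + 'i.
  by rewrite mulrCA kz mulrBr mulr1 -expr2 sqr_i opprK addrC.
have K0 : 0 <= K.
  by apply: le_trans (nm_ge0 (g z)) (gK z _ _) => //; lra.
have B w : wedge k 1 (nm z) w -> nm (g w) <= K.
  move=> [w1 w2]; apply: gK => //.
  have : 1 <= nm k * nm w.
    by rewrite -nmM (le_trans w1) // (le_trans (ler_norm _)) // Re_le_nm.
  rewrite /k nmM nmV mulrAC ler_pdivlMr // mul1r.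
  by have := nm_1i; have := nm_ge0 w; nra.
apply: (@le_trans _ _ (K * nm ('i * z - z))).
  apply: (midsum_bound n (@wedge_midconvex k 1 (nm z)) B); split=> //.
  - by rewrite kz /=; lra.
  - by rewrite ku /=; lra.
  - by rewrite nm_iz.
have := nm_leB ('i * z) z; rewrite nm_iz; nra.
Qed.

Lemma quad_bound n g z K : z != 0 ->
  (forall w, nm z / 2 <= nm w -> nm w <= nm z -> nm (g w) <= K) ->
  nm (quad n g z) <= 8 * K * nm z.
Proof.
move=> z0 gK.
have E w : nm w = nm z -> nm (edge n g w) <= 2 * K * nm z.
  move=> wz; rewrite -wz; apply: edge_bound; last by rewrite wz.
  by rewrite -nm_gt0 wz nm_gt0.
have h1 := E z erefl; have h2 := E _ (nm_iz z); have h3 := E _ (nmN z).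
have h4 : nm (edge n g (- ('i * z))) <= 2 * K * nm z.
  by apply: E; rewrite nmN nm_iz.
apply: le_trans (nm_leD _ _) _.
have := nm_leD (edge n g z + edge n g ('i * z)) (edge n g (- z)).
have := nm_leD (edge n g z) (edge n g ('i * z)); lra.
Qed.

Lemma quad_vanishing g z : z != 0 -> punctured g z ->
  (forall eps : R, 0 < eps -> exists2 del : R, 0 < del &
     forall w, w != 0 -> nm w < del -> nm w * nm (g w) <= eps) ->
  vanishing (fun n => quad n g z).
Proof.
move=> z0 gz sm eta eta0.
(* As [|w| >= |x| / 2] on the small square, [eta / 32] gives [|g w| <= eta / (16 |x|)], which
   [quad_bound] turns into [eta / 2]. The other half of [eta] pays for the shrinking. *)
have [del del0 Hd] := sm (eta / 32) (divr_gt0 eta0 (ltr0n _ 32)).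
have nz : 0 < nm z by rewrite nm_gt0.
have [k Hk] : exists k, nm z / 2 ^+ k < del.
  pose k := Num.bound `|nm z / del|; exists k.
  rewrite ltr_pdivrMr ?exprn_gt0 //.
  have h1 : nm z / del < k%:R.
    exact: le_lt_trans (ler_norm _) (archi_boundP (normr_ge0 _)).
  have h2 : k%:R <= 2 ^+ k :> R by rewrite -natrX ler_nat ltnW // ltn_expl.
  by rewrite mulrC -ltr_pdivrMr //; apply: lt_le_trans h1 h2.
have e2 : 0 < eta / 2 by rewrite divr_gt0.
have [n0 Hn] := quad_shrink k z0 gz e2.
pose x := z / 2 ^+ k.
have nx : nm x = nm z / 2 ^+ k by rewrite nmM nmV nmX nm_nat.
have nx0 : 0 < nm x by rewrite nx divr_gt0 ?exprn_gt0.
have x0 : x != 0 by rewrite -nm_gt0.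
exists (n0 + k)%N => n hn.
have kn : (k <= n)%N by apply: leq_trans hn; rewrite leq_addl.
have := Hn (n - k)%N; rewrite leq_subRL // addnC => /(_ hn).
rewrite subnK // -/x => h1.
have h2 : nm (quad (n - k) g x) <= 8 * (eta / 16 / nm x) * nm x.
  apply: quad_bound => // w w1 w2.
  have w0 : 0 < nm w by lra.
  have := Hd w; rewrite -nm_gt0 => /(_ w0).
  have -> : nm w < del by apply: le_lt_trans w2 _; rewrite nx.
  move=> /(_ isT) h; rewrite ler_pdivlMr //.
  have := nm_ge0 (g w); nra.
have -> : quad n g z = quad n g z - quad (n - k) g x + quad (n - k) g x.
  by rewrite subrK.
apply: le_trans (nm_leD _ _) _.
have : 8 * (eta / 16 / nm x) * nm x = eta / 2 by field; rewrite gt_eqF.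
lra.
Qed.

Definition chord z (t : R) : C := ((1 - t) +i* t) * z.

(** A discrete logarithm: each term is [(chord t - chord s) / chord u], where [z] cancels, and its
    imaginary part is [(t - s) / N] with [N = (1-u)^2 + u^2 <= 1]. So the imaginary part grows at
    least like [t - s], before any limit; over a full edge this gives 1 in place of [pi/2]. *)
Lemma midsum_inv n (y : Y) z (s t : R) : z != 0 -> 0 <= s -> s <= t -> t <= 1 ->
  exists2 c : C, midsum n (fun w => w^-1 *: y) (chord z s) (chord z t) = c *: y
    & t - s <= complex.Im c.
Proof.
move=> z0; have mid (a b : R) : (chord z a + chord z b) / 2 = chord z ((a + b) / 2).
  rewrite /chord -mulrDl mulrAC; congr (_ * _).
  have -> : (2^-1 : C) = (2^-1 : R)%:C by rewrite fmorphV rmorph_nat.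
  apply/eqP; rewrite eq_complex /=; by apply/andP; split; apply/eqP; field.
elim: n s t => [|n IH] s t s0 st t1 /=.
  rewrite mid; set u := (s + t) / 2.
  exists ((chord z t - chord z s) / chord z u); first by rewrite scalerA.
  rewrite /chord -mulrBl invfM mulrACA divff // mulr1.
  have u0 : 0 <= u by rewrite /u; lra.
  have u1 : u <= 1 by rewrite /u; lra.
  have D : 0 < (1 - u) ^+ 2 + u ^+ 2 by nra.
  have D1 : (1 - u) ^+ 2 + u ^+ 2 <= 1 by nra.
  rewrite cImM /=; set N := (1 - u) ^+ 2 + u ^+ 2.
  have -> : (1 - t - (1 - s)) * - (u / N) + (t - s) * ((1 - u) / N) =
    (t - s) / N by field; rewrite gt_eqF.
  by rewrite ler_pdivlMr //; apply: ler_piMr => //; rewrite subr_ge0.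
have m1 : s <= (s + t) / 2 by lra.
have m2 : (s + t) / 2 <= t by lra.
have [c1 E1 I1] := IH _ _ s0 m1 (le_trans m2 t1).
have [c2 E2 I2] := IH _ _ (le_trans s0 m1) m2 t1.
exists (c1 + c2); first by rewrite mid E1 E2 scalerDl.
by rewrite cImD; lra.
Qed.

Lemma quad_inv n (y : Y) z : z != 0 ->
  4 * nm y <= nm (quad n (fun w => w^-1 *: y) z).
Proof.
move=> z0.
have E w : w != 0 ->
    exists2 c : C, edge n (fun w => w^-1 *: y) w = c *: y & 1 <= complex.Im c.
  move=> w0; have [c Ec Ic] := midsum_inv n y w0 (lexx 0) ler01 (lexx 1).
  exists c; last by rewrite subr0 in Ic.
  rewrite /edge -Ec /chord subrr subr0.
  by rewrite -[1 +i* 0]/(1 : C) mul1r.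
have i0 : 'i != 0 :> C by rewrite -nm_gt0 nm_i.
have [c1 E1 I1] := E _ z0.
have [|c2 E2 I2] := E ('i * z); first by rewrite mulf_neq0.
have [|c3 E3 I3] := E (- z); first by rewrite oppr_eq0.
have [|c4 E4 I4] := E (- ('i * z)); first by rewrite oppr_eq0 mulf_neq0.
rewrite /quad E1 E2 E3 E4 -!(scalerDl y) nmZ ler_wpM2r ?nm_ge0 //.
apply: le_trans (Im_le_nm _); apply: le_trans (ler_norm _).
by rewrite !cImD; lra.
Qed.

(* The constant 4 is irrelevant: for sharp estimates, this is applied to powers or
   to iterates. *)
Lemma mean_bound (psi : C -> Y) z M : z != 0 -> punctured psi z ->
  (forall eps : R, 0 < eps -> exists2 del : R, 0 < del &
     forall w, nm w < del -> nm (psi w - psi 0) <= eps) ->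
  (forall w, nm z / 2 <= nm w -> nm w <= nm z -> nm (psi w) <= M) ->
  nm (psi 0) <= 4 * M.
Proof.
move=> z0 pz pc pM.
have nz : 0 < nm z by rewrite nm_gt0.
(* The difference [g] is the Cauchy kernel with its pole removed by continuity of [psi] at 0, so its
   sums over the square vanish and those of [g1] and [g2] can be compared. *)
pose g1 w := w^-1 *: psi w; pose g2 w := w^-1 *: psi 0.
pose g w := g1 w - g2 w.
have gE w : g w = w^-1 *: (psi w - psi 0) by rewrite scalerBr.
have V : vanishing (fun n => quad n g z).
  apply: quad_vanishing => // [w w0 wz|eps eps0].
    have [d Hd] := pz w w0 wz.
    have := is_cderZ (is_cderV (is_cder_id w) w0)
                     (is_cderB Hd (is_cder_cst (psi 0) w)).
    by rewrite (_ : (fun _ => _) = g) => [H|]; [eexists; exact: H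
      | apply/funext => x; rewrite gE].
  have [del del0 Hd] := pc eps eps0; exists del => // w w0 /Hd h.
  by rewrite gE nmZ nmV mulrA mulfV ?mul1r // gt_eqF // nm_gt0.
have B n : nm (quad n g1 z) <= 16 * M.
  have -> : 16 * M = 8 * (M / (nm z / 2)) * nm z by field; rewrite gt_eqF.
  apply: quad_bound => // w w1 w2; rewrite /g1 nmZ nmV mulrC.
  have w0 : 0 < nm w by lra.
  have h := pM w w1 w2; have h0 := nm_ge0 (psi w).
  rewrite ler_pdivrMr // mulrAC ler_pdivlMr; last lra.
  nra.
have S n : quad n g z = quad n g1 z - quad n g2 z.
  by rewrite /quad /edge /g !midsumB addrB4.
apply/ler_addgt0Pl => e e0; have [n0 Hn] := V e e0.
have h1 := Hn n0 (leqnn _); have h2 := B n0.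
have h3 : 4 * nm (psi 0) <= nm (quad n0 g2 z) := quad_inv n0 (psi 0) z0.
have h4 := nm_geB (quad n0 g2 z) (quad n0 g1 z).
rewrite S nm_dist in h1; lra.
Qed.

End PuncturedDisc.

(** * Cauchy estimates and uniform limits *)

Section CauchyEstimates.
Variables (R : realType) (Y : normedModType R[i]).
Local Notation C := R[i].
Implicit Types (g : C -> Y) (w z : C) (r M K : R).

Lemma is_cder_shift g z w d : is_cder g (z + w) d ->
  is_cder (fun x => g (z + x)) w d.
Proof.
move=> H; have Hk : @is_cder R C^o (fun x => z + x) w (0 + 1).
  by apply: is_cderD; [exact: is_cder_cst | exact: is_cder_id].
by have := is_cder_comp Hk H; rewrite add0r scale1r.
Qed.

(** This is [mean_bound] for the difference quotient, completed by [d] at the centre. For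
    [|w| >= r/2] the quotient is at most [2M / (r/2) = 4M/r]. *)
Lemma cauchy_deriv1 g z r M d : 0 < r ->
  (forall w, nm (w - z) <= r -> exists d, is_cder g w d) ->
  (forall w, nm (w - z) <= r -> nm (g w) <= M) ->
  is_cder g z d -> nm d <= 16 * M / r.
Proof.
move=> r0 dg gM gd.
pose psi (w : C) := if w == 0 then d else w^-1 *: (g (z + w) - g z).
have near0 (w : C) : z + w - z = w by rewrite addrC addKr.
have r0' : r%:C != 0 :> C by rewrite -nm_gt0 nm_real gtr0_norm.
have nr : nm (r%:C : C) = r by rewrite nm_real gtr0_norm.
have M0 : nm (g z) <= M by apply: gM; rewrite subrr nm0 ltW.
have -> : 16 * M / r = 4 * (4 * M / r) by field; rewrite gt_eqF.
have -> : d = psi 0 by rewrite /psi eqxx.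
apply: (@mean_bound _ _ psi r%:C _ r0').
- move=> w w0; rewrite nr => wr.
  have [e He] : exists d, is_cder g (z + w) d by apply: dg; rewrite near0.
  have := is_cderZ (is_cderV (is_cder_id w) w0)
    (is_cderB (is_cder_shift He) (is_cder_cst (g z) w)).
  set e' := (X in is_cder _ _ X) => H; exists e'.
  apply: (@is_cder_near _ _ _ _ w e' (nm w)) H; first by rewrite nm_gt0.
  move=> x; rewrite /psi; case: eqVneq => // ->.
  by rewrite sub0r nmN ltxx.
- move=> eps eps0; have [del del0 Hd] := gd eps eps0.
  exists del => // w wd; rewrite {2}/psi eqxx /psi.
  case: eqVneq => [_|w0]; first by rewrite subrr nm0 ltW.
  have := Hd (z + w); rewrite near0 => /(_ wd) h.
  have -> : w^-1 *: (g (z + w) - g z) - d =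
            w^-1 *: (g (z + w) - g z - w *: d).
    by rewrite [RHS]scalerBr scalerK.
  by rewrite nmZ nmV mulrC ler_pdivrMr ?nm_gt0.
- move=> w; rewrite nr => w1 w2; rewrite /psi.
  have w0 : 0 < nm w by lra.
  case: eqVneq => [w00|_]; first by rewrite w00 nm0 ltxx in w0.
  rewrite nmZ nmV mulrC ler_pdivrMr //.
  have h1 : nm (g (z + w)) <= M by apply: gM; rewrite near0.
  have h2 := nm_leB (g (z + w)) (g z).
  have h3 : 0 <= M := le_trans (nm_ge0 _) M0.
  rewrite mulrAC ler_pdivlMr //; nra.
Qed.

(** Bisection of the segment in place of integration: if the bound with [K + eta] fails on a
    segment, it fails on one half, and near the limit point this contradicts differentiability. The
    slack [eta] absorbs the error of the linear approximation. *)
Lemma mean_value g z r K a b :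
  (forall w, nm (w - z) <= r -> exists2 d, is_cder g w d & nm d <= K) ->
  nm (a - z) <= r -> nm (b - z) <= r ->
  nm (g b - g a) <= K * nm (b - a).
Proof.
move=> dg ra rb; apply/ler_addgt0Pl => e e0.
have b1 : 0 < nm (b - a) + 1 by rewrite ltr_wpDl ?nm_ge0.
pose eta := e / (nm (b - a) + 1); have eta0 : 0 < eta by rewrite divr_gt0.
suff : nm (g b - g a) <= (K + eta) * nm (b - a).
  move=> h; apply: le_trans h _; rewrite mulrDl addrC lerD2r.
  rewrite /eta mulrAC ler_pdivrMr // ler_pM2l //; lra.
pose size (t : C * C) := nm (t.2 - t.1).
pose bad (t : C * C) := [/\ ~ nm (g t.2 - g t.1) <= (K + eta) * size t,
  nm (t.1 - z) <= r & nm (t.2 - z) <= r].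
apply: contrapT => nab.
have [||x Hx] := @bisection R (C * C)%type fst size bad (a, b); last 2 first.
- by split.
- have xz : nm (x - z) <= r.
    apply/ler_addgt0Pl => s s0; have [|t [[_ t1 _] st xt]] := Hx (s / 4).
      by rewrite divr_gt0.
    have := nm_trans x t.1 z; lra.
  have [d Hd dK] := dg x xz.
  have [del del0 Hdel] := Hd (eta / 9) (divr_gt0 eta0 (ltr0n _ 9)).
  have [|t [[nt _ _] st xt]] := Hx (del / 9); first by rewrite divr_gt0.
  apply: nt; set p := t.1 in xt *; set q := t.2.
  have sE : size t = nm (q - p) by [].
  have s0 := nm_ge0 (q - p); rewrite -sE in s0.
  have px : nm (p - x) <= 4 * size t by rewrite nm_dist.
  have qx : nm (q - x) <= 5 * size t by have := nm_trans q p x; lra.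
  have h1 := Hdel p; have h2 := Hdel q.
  have {h1} h1 : nm (g p - g x - (p - x) *: d) <= eta / 9 * nm (p - x).
    by apply: h1; lra.
  have {h2} h2 : nm (g q - g x - (q - x) *: d) <= eta / 9 * nm (q - x).
    by apply: h2; lra.
  have E : g q - g p = (q - p) *: d +
      (g q - g x - (q - x) *: d - (g p - g x - (p - x) *: d)).
    have -> : q - p = (q - x) - (p - x) by rewrite opprB addrA subrK.
    rewrite scalerBl; set A := _ *: d; set B := _ *: d.
    zmod.
  rewrite E; apply: le_trans (nm_leD _ _) _; rewrite nmZ -sE.
  have := nm_leB (g q - g x - (q - x) *: d) (g p - g x - (p - x) *: d).
  have := nm_ge0 d; nra.
move=> [p q] [/= nt p1 q1]; pose m := (p + q) / 2.
have mz : nm (m - z) <= r by exact: midconvex_ball.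
have e1 : nm (m - p) = nm (q - p) / 2.
  have -> : m - p = (q - p) / 2 by rewrite /m; field.
  by rewrite nmM nmV nm_nat.
have e2 : nm (q - m) = nm (q - p) / 2.
  have -> : q - m = (q - p) / 2 by rewrite /m; field.
  by rewrite nmM nmV nm_nat.
have sE : size (p, q) = nm (q - p) by [].
have [h1|h1] := boolP (nm (g m - g p) <= (K + eta) * size (p, m)); last first.
  exists (p, m); split; [by split=> //; apply/negP | exact: e1 |].
  by rewrite /= subrr nm0 nm_ge0.
have [h2|h2] := boolP (nm (g q - g m) <= (K + eta) * size (m, q)); last first.
  exists (m, q); split; [by split=> //; apply/negP | exact: e2 |].
  by rewrite /= e1 sE; have := nm_ge0 (q - p); lra.
case: nt; rewrite sE; rewrite /size /= e1 in h1; rewrite /size /= e2 in h2.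
have := nm_trans (g q) (g m) (g p); lra.
Qed.

(** A second-order remainder, obtained before second derivatives are known to exist. The Cauchy
    bound for [g (s + w) - g w], itself small by the mean value inequality, controls [g' s - g' 0];
    the mean value inequality once more gives the remainder. The constant 2048 is 16 times 32 times
    4. *)
Lemma cauchy_deriv2 g g' r M t : 0 < r ->
  (forall w, nm w <= r -> is_cder g w (g' w)) ->
  (forall w, nm w <= r -> nm (g w) <= M) -> nm t <= r / 4 ->
  nm (g t - g 0 - t *: g' 0) <= 2048 * M / r ^+ 2 * nm t ^+ 2.
Proof.
move=> r0 gd gM tr.
have M0 : 0 <= M by apply: le_trans (nm_ge0 (g 0)) (gM 0 _); rewrite nm0 ltW.
have g1 w : nm w <= r / 2 -> nm (g' w) <= 32 * M / r.
  move=> wr; have -> : 32 * M / r = 16 * M / (r / 2) by field; rewrite gt_eqF.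
  have wx x : nm (x - w) <= r / 2 -> nm x <= r.
    by move=> h; have := nm_leD (x - w) w; rewrite subrK; lra.
  apply: (@cauchy_deriv1 g w).
  - by rewrite divr_gt0.
  - by move=> x /wx xr; exists (g' x); apply: gd.
  - by move=> x /wx /gM.
  - by apply: gd; lra.
have g2 s : nm s <= nm t -> nm (g' s - g' 0) <= 2048 * M / r ^+ 2 * nm t.
  move=> st; pose h w := g (s + w) - g w.
  have hd w : nm w <= r / 4 -> is_cder h w (g' (s + w) - g' w).
    move=> wr; apply: is_cderB; last by apply: gd; lra.
    by apply: is_cder_shift; apply: gd; have := nm_leD s w; lra.
  have -> : 2048 * M / r ^+ 2 * nm t = 16 * (32 * M / r * nm t) / (r / 4).
    by field; rewrite gt_eqF.
  apply: (@cauchy_deriv1 h 0 (r / 4)); first by rewrite divr_gt0.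
  - move=> w; rewrite subr0 => wr; exists (g' (s + w) - g' w); exact: hd.
  - move=> w; rewrite subr0 => wr.
    have := @mean_value g 0 (r / 2) (32 * M / r) w (s + w).
    rewrite !subr0 addrK => H; apply: le_trans (H _ _ _) _.
    + move=> x; rewrite subr0 => xr; exists (g' x); last exact: g1.
      by apply: gd; lra.
    + lra.
    + by have := nm_leD s w; lra.
    + by rewrite ler_wpM2l // divr_ge0 ?mulr_ge0 // ltW.
  - by have := hd 0; rewrite addr0; apply; rewrite nm0 divr_ge0 // ltW.
have := @mean_value (fun w => g w - w *: g' 0) 0 (nm t)
  (2048 * M / r ^+ 2 * nm t) 0 t.
rewrite !subr0 nm0 scale0r subr0 => H.
rewrite addrAC expr2 mulrA; apply: H => //; last exact: nm_ge0.
move=> w; rewrite subr0 => wt; exists (g' w - g' 0); last exact: g2.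
have := is_cderZ (is_cder_id w) (is_cder_cst (g' 0) w).
rewrite scaler0 addr0 scale1r => Hc; apply: is_cderB => //.
by apply: gd; lra.
Qed.

End CauchyEstimates.

(** * Fréchet derivatives and their Cauchy estimates *)

Section Frechet.
Variables (R : realType) (X Y : normedModType R[i]).
Local Notation C := R[i].
Implicit Types (f : X -> Y) (x y v : X) (z : C) (r M K : R).

Lemma differentiable_nm f x : differentiable f x ->
  forall eps : R, 0 < eps -> exists2 del : R, 0 < del &
    forall y, nm y < del -> nm (f (x + y) - f x - 'd f x y) <= eps * nm y.
Proof.
move=> df eps eps0; have /diff_locallyP [_ /eqaddoP H] := df.
have := H eps%:C; rewrite ltcR => /(_ eps0) /near_nmP [del del0 Hd].
exists del => // y yd; have := Hd y; rewrite subr0 => /(_ yd).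
rewrite !nmE -rmorphM lecR; congr (nm _ <= _).
by rewrite /= [in LHS]fctE /= opprD addrA [x + y]addrC.
Qed.

Definition is_fder f x (L : X -> Y) := [/\ linear L,
  exists2 K : R, 0 <= K & forall y, nm (L y) <= K * nm y &
  forall eps : R, 0 < eps -> exists2 del : R, 0 < del &
    forall y, nm y < del -> nm (f (x + y) - f x - L y) <= eps * nm y].

Lemma is_fder_diff f x (L : X -> Y) : is_fder f x L ->
  differentiable f x /\ forall y, 'd f x y = L y.
Proof.
move=> [Ll [K _ LK] H].
pose L' : {linear X -> Y} := HB.pack L (GRing.isLinear.Build _ _ _ _ L Ll).
have K1 : 0 < `|K| + 1 by rewrite ltr_wpDl.
have Lc : continuous L'.
  move=> u; apply/cvg_nmP => eps eps0.
  exists (eps / (`|K| + 1)); first by rewrite divr_gt0.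
  move=> y yu; have -> : L' y - L' u = L' (y - u) by rewrite linearB.
  apply: le_trans (LK _) _.
  move: yu; rewrite ltr_pdivlMr // => yu.
  have := ler_norm K; have := nm_ge0 (y - u); nra.
have HL : f \o shift x = cst (f x) + L' +o_ 0 id.
  apply/eqaddoP => e e0.
  have eE : e = (complex.Re e)%:C.
    by move: e0; rewrite ltcE; case: (e) => a b /= /andP[/eqP -> _].
  have e1 : 0 < complex.Re e by move: e0; rewrite eE ltcR.
  have [del del0 Hd] := H _ e1; apply/near_nmP; exists del => // y.
  rewrite subr0 => /Hd; rewrite eE !nmE -rmorphM lecR; congr (nm _ <= _).
  by rewrite /= [in RHS]fctE /= opprD addrA [x + y]addrC.
have dE := diff_unique Lc HL.
split; last by move=> y; rewrite dE.
apply/diff_locallyP; rewrite dE; split => //.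
Qed.

Lemma diff_is_fder f x : differentiable f x -> is_fder f x ('d f x).
Proof.
move=> df; split; last exact: differentiable_nm; first exact: linearP.
have [k k0 Hk] := linear_lipschitz (diff_continuous df).
have kE : k = (complex.Re k)%:C.
  by move: k0; rewrite ltcE; case: (k) => a b /= /andP[/eqP -> _].
exists (complex.Re k); first by move: k0; rewrite kE ltcR => /ltW.
by move=> y; have := Hk y; rewrite kE !nmE -rmorphM lecR.
Qed.

Lemma is_fderB f g x (L M : X -> Y) : is_fder f x L -> is_fder g x M ->
  is_fder (fun y => f y - g y) x (fun y => L y - M y).
Proof.
move=> [Ll [K K0 LK] Hf] [Ml [K' K'0 MK] Hg]; split.
- by move=> k u v; rewrite Ll Ml scalerBr; zmod.
- exists (K + K'); first exact: addr_ge0.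
  move=> y; rewrite mulrDl.
  by have := nm_leB (L y) (M y); have := LK y; have := MK y; lra.
- move=> eps eps0; have e2 : 0 < eps / 2 by rewrite divr_gt0.
  have [d1 d10 H1] := Hf _ e2; have [d2 d20 H2] := Hg _ e2.
  exists (Num.min d1 d2); first by rewrite lt_min d10.
  move=> y; rewrite lt_min => /andP[/H1 h1 /H2 h2].
  have -> : f (x + y) - g (x + y) - (f x - g x) - (L y - M y) =
    f (x + y) - f x - L y - (g (x + y) - g x - M y) by zmod.
  by apply: le_trans (nm_leB _ _) _; lra.
Qed.

Lemma is_fderZ f x (L : X -> Y) (k : C) : is_fder f x L ->
  is_fder (fun y => k *: f y) x (fun y => k *: L y).
Proof.
move=> [Ll [K K0 LK] Hf]; split.
- by move=> c u v; rewrite Ll scalerDr !scalerA mulrC.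
- exists (nm k * K); first by rewrite mulr_ge0 ?nm_ge0.
  by move=> y; rewrite nmZ -mulrA ler_wpM2l ?nm_ge0.
- move=> eps eps0; have k1 : 0 < nm k + 1 by rewrite ltr_wpDl ?nm_ge0.
  have [del del0 H] := Hf _ (divr_gt0 eps0 k1); exists del => // y /H h.
  rewrite -!scalerBr nmZ.
  apply: le_trans (ler_wpM2l (nm_ge0 k) h) _.
  rewrite mulrA ler_wpM2r ?nm_ge0 // mulrCA ger_pMr //.
  by rewrite ler_pdivrMr // mul1r; lra.
Qed.

Lemma is_fder_shift f x u (L : X -> Y) : is_fder f (x + u) L ->
  is_fder (fun y => f (y + u)) x L.
Proof.
move=> [Ll LK Hf]; split => // eps /Hf [del del0 H]; exists del => // y /H.
by rewrite [x + u + y]addrAC.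
Qed.

Lemma is_cder_line f x v z : differentiable f (x + z *: v) ->
  is_cder (fun w : C => f (x + w *: v)) z ('d f (x + z *: v) v).
Proof.
move=> df eps eps0; have v1 : 0 < nm v + 1 by rewrite ltr_wpDl ?nm_ge0.
have [del del0 Hd] := differentiable_nm df (divr_gt0 eps0 v1).
exists (del / (nm v + 1)); first by rewrite divr_gt0.
move=> w; rewrite ltr_pdivlMr // => wz.
have E : x + z *: v + (w - z) *: v = x + w *: v.
  by rewrite scalerBl addrACA subrr addr0.
have := Hd ((w - z) *: v); rewrite linearZ E nmZ => H; have nw := nm_ge0 (w - z).
have h : nm (w - z) * nm v < del by lra.
apply: le_trans (H h) _.
rewrite mulrAC ler_pdivrMr //; have := nm_ge0 v; nra.
Qed.

(** The one-variable estimate on the complex line [x + w v]; the radius [r / (2 |v|)] keeps [w v] in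
    the open ball and doubles the constant 16. *)
Lemma frechet_cauchy1 f x r M v : 0 < r ->
  (forall y, nm (y - x) < r -> differentiable f y) ->
  (forall y, nm (y - x) < r -> nm (f y) <= M) ->
  nm ('d f x v) <= 32 * M / r * nm v.
Proof.
move=> r0 df fM; have [->|v0] := eqVneq v 0.
  by rewrite linear0 !nm0 mulr0.
have nv : 0 < nm v by rewrite nm_gt0.
pose rho := r / (2 * nm v); have rho0 : 0 < rho by rewrite divr_gt0 ?mulr_gt0.
have B (w : C) : nm w <= rho -> nm (x + w *: v - x) < r.
  move=> h; rewrite addrC addKr nmZ.
  by move: h; rewrite /rho ler_pdivlMr ?mulr_gt0 //; nra.
have -> : 32 * M / r * nm v = 16 * M / rho.
  by rewrite /rho; field; rewrite !gt_eqF.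
have D (w : C) : nm w <= rho ->
    is_cder (fun w : C => f (x + w *: v)) w ('d f (x + w *: v) v).
  by move=> /B h; apply: is_cder_line; apply: df.
apply: (@cauchy_deriv1 _ _ (fun w : C => f (x + w *: v)) 0 rho) => //.
- by move=> w; rewrite subr0 => wr; eexists; exact: D.
- by move=> w; rewrite subr0 => /B /fM.
- by have := D 0; rewrite scale0r addr0; apply; rewrite nm0 ltW.
Qed.

(** The same line, at parameter 1: [nm y <= r / 8] says that 1 is within a quarter of the radius
    [r / (2 |y|)], and 8192 is 4 times 2048. *)
Lemma frechet_cauchy2 f x r M y : 0 < r ->
  (forall y, nm (y - x) < r -> differentiable f y) ->
  (forall y, nm (y - x) < r -> nm (f y) <= M) -> nm y <= r / 8 ->
  nm (f (x + y) - f x - 'd f x y) <= 8192 * M / r ^+ 2 * nm y ^+ 2.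
Proof.
move=> r0 df fM yr; have [->|v0] := eqVneq y 0.
  by rewrite linear0 addr0 subrr subr0 !nm0 expr0n mulr0.
have nv : 0 < nm y by rewrite nm_gt0.
pose rho := r / (2 * nm y); have rho0 : 0 < rho by rewrite divr_gt0 ?mulr_gt0.
have B (w : C) : nm w <= rho -> nm (x + w *: y - x) < r.
  move=> h; rewrite addrC addKr nmZ.
  by move: h; rewrite /rho ler_pdivlMr ?mulr_gt0 //; nra.
have -> : 8192 * M / r ^+ 2 * nm y ^+ 2 = 2048 * M / rho ^+ 2 * nm (1 : C) ^+ 2.
  by rewrite nm1 /rho; field; rewrite !gt_eqF.
have := @cauchy_deriv2 _ _ (fun w : C => f (x + w *: y))
  (fun w : C => 'd f (x + w *: y) y) rho M 1 rho0.
rewrite scale0r addr0 !scale1r; apply.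
- by move=> w /B h; apply: is_cder_line; apply: df.
- by move=> w /B /fM.
- rewrite nm1 /rho -mulrA -invfM ler_pdivlMr ?mulr_gt0 //; lra.
Qed.

Lemma differentiable_bounded f x : differentiable f x ->
  exists r M, [/\ 0 < r, 0 <= M & forall y, nm (y - x) < r -> nm (f y) <= M].
Proof.
move=> /differentiable_continuous /cvg_nmP /(_ 1 ltr01) [r r0 Hr].
exists r, (nm (f x) + 1); split=> //; first by rewrite addr_ge0 ?nm_ge0.
by move=> y /Hr h; have := nm_leD (f y - f x) (f x); rewrite subrK; lra.
Qed.

End Frechet.

(** * Weierstrass' theorem on uniform limits *)

Section Weierstrass.
Variables (R : realType) (X : normedModType R[i]) (Y : completeNormedModType R[i]).
Local Notation C := R[i].

Lemma complete_limit (u : nat -> Y) :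
  (forall eps : R, 0 < eps -> exists N, forall n m, (N <= n)%N -> (N <= m)%N ->
     nm (u n - u m) <= eps) ->
  exists l, forall eps : R, 0 < eps -> exists N, forall n, (N <= n)%N ->
     nm (u n - l) <= eps.
Proof.
move=> H.
have cu : cauchy (u @ \oo).
  apply: cauchy_exP => e e0.
  have eE : e = (complex.Re e)%:C.
    by move: e0; rewrite ltcE; case: (e) => a b /= /andP[/eqP -> _].
  have e1 : 0 < complex.Re e by move: e0; rewrite eE ltcR.
  have [N HN] := H _ (divr_gt0 e1 (ltr0n _ 2)).
  exists (u N); exists N => // n /= Nn.
  rewrite -ball_normE /ball_ /= eE nm_lt.
  by apply: le_lt_trans (HN N n (leqnn _) Nn) _; lra.
have /cvgrPdist_le Hl : u @ \oo --> lim (u @ \oo) by apply: cauchy_cvg.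
exists (lim (u @ \oo)) => eps eps0.
have := Hl eps%:C; rewrite ltcR => /(_ eps0) [N _ HN].
by exists N => n /HN /=; rewrite nm_le nm_dist.
Qed.

Lemma weierstrass (F : nat -> X -> Y) (f : X -> Y) (x : X) (r M : R) : 0 < r ->
  (forall n y, nm (y - x) < r -> differentiable (F n) y) ->
  (forall y, nm (y - x) < r -> nm (f y) <= M) ->
  (forall eps : R, 0 < eps -> exists N, forall n, (N <= n)%N ->
     forall y, nm (y - x) < r -> nm (F n y - f y) <= eps) ->
  differentiable f x /\ forall v (eps : R), 0 < eps -> exists N, forall n, (N <= n)%N ->
     nm ('d (F n) x v - 'd f x v) <= eps.
Proof.
move=> r0 dF fM Ff.
have [D [DE DL]] : exists D : nat -> X -> Y,
    (forall n v, 'd (F n) x v = D n v) /\ forall n, linear (D n).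
  by exists (fun n v => 'd (F n) x v); split=> // n; exact: linearP.
have cauchyF (eps : R) : 0 < eps -> exists N, forall n m, (N <= n)%N -> (N <= m)%N ->
    forall v, nm (D n v - D m v) <= eps * nm v.
  (* The two distances to [f] add up to [eps r / 32], which the factor [32 / r] of the Cauchy
     estimate turns into [eps]. *)
  move=> eps0; have e1 : 0 < eps * r / 64 by rewrite divr_gt0 ?mulr_gt0.
  have [N HN] := Ff _ e1; exists N => n m Nn Nm v; rewrite -!DE.
  have d1 : differentiable (F n) x by apply: dF; rewrite subrr nm0.
  have d2 : differentiable (F m) x by apply: dF; rewrite subrr nm0.
  have [_ <-] := is_fder_diff (is_fderB (diff_is_fder d1) (diff_is_fder d2)).
  have -> : eps * nm v = 32 * (eps * r / 32) / r * nm v.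
    by field; rewrite gt_eqF.
  apply: (frechet_cauchy1 _ r0) => y yr.
    have [d1' d2'] := (dF n y yr, dF m y yr).
    exact: (is_fder_diff (is_fderB (diff_is_fder d1') (diff_is_fder d2'))).1.
  have h1 := HN n Nn y yr; have h2 := HN m Nm y yr.
  have := nm_trans (F n y) (f y) (F m y).
  rewrite (nm_dist (f y)) => h; apply: le_trans h _; lra.
have lim_ex v : exists l, forall eps : R, 0 < eps -> exists N, forall n,
    (N <= n)%N -> nm (D n v - l) <= eps.
  apply: complete_limit => eps eps0.
  have v1 : 0 < nm v + 1 by rewrite ltr_wpDl ?nm_ge0.
  have [N HN] := cauchyF _ (divr_gt0 eps0 v1); exists N => n m Nn Nm.
  apply: le_trans (HN n m Nn Nm v) _; rewrite mulrAC ler_pdivrMr //.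
  by rewrite ler_pM2l //; lra.
have [L HL] := choice lim_ex.
have unifL (eps : R) : 0 < eps -> exists N, forall n, (N <= n)%N ->
    forall v, nm (D n v - L v) <= eps * nm v.
  move=> eps0; have [N HN] := cauchyF _ eps0; exists N => n Nn v.
  apply/ler_addgt0Pl => e e0; have [N' HN'] := HL v e e0.
  have h1 := HN n (maxn N N') Nn (leq_maxl _ _) v.
  have h2 := HN' (maxn N N') (leq_maxr _ _).
  by have := nm_trans (D n v) (D (maxn N N') v) (L v); lra.
have Ll : linear L.
  move=> k u v; apply/eqP; rewrite -subr_eq0 -nm_eq0 eq_le nm_ge0 andbT.
  apply/ler_addgt0Pl => e e0; rewrite addr0.
  pose q := nm (k *: u + v) + nm k * nm u + nm v + 1.
  have q0 : 0 < q by rewrite ltr_wpDl ?addr_ge0 ?mulr_ge0 ?nm_ge0.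
  have [N HN] := unifL _ (divr_gt0 e0 q0).
  have h1 := HN N (leqnn _) (k *: u + v).
  have h2 := HN N (leqnn _) u; have h3 := HN N (leqnn _) v.
  set s := e / q in h1 h2 h3.
  have E : L (k *: u + v) - (k *: L u + L v) =
     k *: (D N u - L u) + (D N v - L v)
       - (D N (k *: u + v) - L (k *: u + v)).
    rewrite DL scalerBr; set A := k *: _; set B := k *: _.
    zmod.
  rewrite E; apply: le_trans (nm_leB _ _) _.
  have := nm_leD (k *: (D N u - L u)) (D N v - L v).
  rewrite nmZ; have hk := ler_wpM2l (nm_ge0 k) h2 => hs.
  have : s * q = e by rewrite /s divfK // gt_eqF.
  have s0 : 0 < s by rewrite divr_gt0.
  rewrite /q; nra.
have [N1 HN1] := unifL 1 ltr01.
have [N2 HN2] := Ff 1 ltr01.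
have dN1 : differentiable (F N1) x by apply: dF; rewrite subrr nm0.
have [r1 [M1 [r10 M10 B1]]] := differentiable_bounded dN1.
pose r' := Num.min r r1; have r'0 : 0 < r' by rewrite lt_min r0.
have LK y : nm (L y) <= (32 * M1 / r' + 1) * nm y.
  have h1 : nm (D N1 y) <= 32 * M1 / r' * nm y.
    rewrite -DE; apply: (frechet_cauchy1 _ r'0) => w; rewrite lt_min => /andP[w1 w2].
      exact: dF.
    exact: B1.
  have h2 := HN1 N1 (leqnn _) y.
  by have := nm_geB (L y) (D N1 y); rewrite nm_dist mulrDl; lra.
have M0 : 0 <= M.
  by apply: le_trans (nm_ge0 (f x)) (fM x _); rewrite subrr nm0.
pose B := 8192 * (M + 1) / r ^+ 2.
have B0 : 0 <= B.
  apply: divr_ge0; last by rewrite exprn_ge0 // ltW.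
  by apply: mulr_ge0; [exact: ler0n | rewrite addr_ge0].
have quadratic y : nm y <= r / 8 -> nm (f (x + y) - f x - L y) <= B * nm y ^+ 2.
  move=> yr; apply/ler_addgt0Pl => e e0.
  have y1 : 0 < 2 + nm y by rewrite ltr_wpDr ?nm_ge0.
  have e1 : 0 < e / (2 + nm y) by rewrite divr_gt0.
  have [N3 HN3] := Ff _ e1; have [N4 HN4] := unifL _ e1.
  pose n := maxn N2 (maxn N3 N4).
  have n2 : (N2 <= n)%N by rewrite leq_max leqnn.
  have n3 : (N3 <= n)%N by rewrite !leq_max leqnn !orbT.
  have n4 : (N4 <= n)%N by rewrite !leq_max leqnn !orbT.
  have h1 : nm (F n (x + y) - F n x - D n y) <= B * nm y ^+ 2.
    rewrite -DE; apply: (frechet_cauchy2 r0) => // w wr; first exact: dF.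
    have := nm_leD (F n w - f w) (f w); rewrite subrK.
    by have := HN2 n n2 w wr; have := fM w wr; lra.
  have h2 : nm (F n (x + y) - f (x + y)) <= e / (2 + nm y).
    by apply: HN3 => //; rewrite addrC addKr; lra.
  have h3 : nm (F n x - f x) <= e / (2 + nm y).
    by apply: HN3 => //; rewrite subrr nm0.
  have h4 := HN4 n n4 y.
  have E : f (x + y) - f x - L y = (F n (x + y) - F n x - D n y)
     - ((F n (x + y) - f (x + y)) - (F n x - f x) - (D n y - L y)).
    zmod.
  rewrite E; apply: le_trans (nm_leB _ _) _.
  have := nm_leB (F n (x + y) - f (x + y) - (F n x - f x)) (D n y - L y).
  have := nm_leB (F n (x + y) - f (x + y)) (F n x - f x).
  have : e / (2 + nm y) * (2 + nm y) = e by rewrite divfK // gt_eqF.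
  rewrite mulrDr; lra.
have [df dE] : differentiable f x /\ forall y, 'd f x y = L y.
  apply: is_fder_diff; split; [exact: Ll | |].
    by exists (32 * M1 / r' + 1); first by rewrite addr_ge0 ?divr_ge0 ?mulr_ge0 // ltW.
  move=> eps eps0.
  have B1' : 0 < B + 1 by rewrite ltr_wpDl.
  exists (Num.min (r / 8) (eps / (B + 1))).
    by rewrite lt_min !divr_gt0.
  move=> y; rewrite lt_min => /andP[y1]; rewrite ltr_pdivlMr // => y2.
  apply: le_trans (quadratic y (ltW y1)) _.
  rewrite expr2 mulrA ler_wpM2r ?nm_ge0 //; have := nm_ge0 y; nra.
split=> // v eps eps0; have [N HN] := HL v eps eps0.
by exists N => n Nn; have := HN n Nn; rewrite -DE -dE.
Qed.

End Weierstrass.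

(** * Smoothness of holomorphic mappings *)

Section Smoothness.
Variables (R : realType) (X : normedModType R[i]) (Y : completeNormedModType R[i]).
Local Notation C := R[i].

(** Difference quotients in direction [v] converge to the directional derivative uniformly near [x],
    at rate [O(t)] by the quadratic remainder, so [weierstrass] applies to them. The last clause is
    kept because symmetry of second derivatives rests on it. *)
Lemma directional_weierstrass (f : X -> Y) (x v : X) (r : R) : 0 < r ->
  (forall y, nm (y - x) < r -> differentiable f y) ->
  exists t : nat -> C, [/\ forall n, t n != 0,
    forall eps : R, 0 < eps -> exists N, forall n, (N <= n)%N -> nm (t n) <= eps,
    differentiable (fun y => 'd f y v) x &
    forall u (eps : R), 0 < eps -> exists N, forall n, (N <= n)%N ->
      nm ((t n)^-1 *: ('d f (x + t n *: v) u - 'd f x u)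
          - 'd (fun y => 'd f y v) x u) <= eps].
Proof.
move=> r0 df.
have dx : differentiable f x by apply: df; rewrite subrr nm0.
have [r1 [M [r10 M0 fM]]] := differentiable_bounded dx.
pose s := Num.min r r1; have s0 : 0 < s by rewrite lt_min r0.
have sr y : nm (y - x) < s -> differentiable f y /\ nm (f y) <= M.
  by rewrite lt_min => /andP[/df ? /fM ?].
pose del := s / 4; have del0 : 0 < del by rewrite divr_gt0.
(* The choice of [tau] makes [|t n v| <= del / 4], an eighth of the radius [2 del] on which the
   quadratic remainder is applied. *)
have v1 : 0 < nm v + 1 by rewrite ltr_wpDl ?nm_ge0.
pose tau := del / 4 / (nm v + 1); have tau0 : 0 < tau by rewrite !divr_gt0.
pose t (n : nat) : C := (tau / n.+1%:R)%:C.
have nt n : nm (t n) = tau / n.+1%:R by rewrite nm_real gtr0_norm // divr_gt0.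
have t0 n : t n != 0 by rewrite -nm_gt0 nt divr_gt0.
have ttau n : nm (t n) <= tau.
  by rewrite nt ler_pdivrMr // ler_peMr ?(ltW tau0) // ler1n.
have tlim (eps : R) : 0 < eps -> exists N, forall n, (N <= n)%N -> nm (t n) <= eps.
  move=> eps0; exists (Num.bound `|tau / eps|) => n Nn.
  rewrite nt ler_pdivrMr // mulrC -ler_pdivrMr //.
  have h := archi_boundP (normr_ge0 (tau / eps)).
  apply: le_trans (ler_norm _) _; apply: le_trans (ltW h) _.
  by rewrite ler_nat (leq_trans Nn).
have tv n : nm (t n *: v) <= del / 4.
  rewrite nmZ; apply: (@le_trans _ _ (tau * (nm v + 1))).
    by apply: ler_pM; rewrite ?nm_ge0 ?ttau // lerDl.
  by rewrite /tau divfK // gt_eqF.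
pose B := 8192 * M / (2 * del) ^+ 2 * nm v ^+ 2.
have d2 : 0 < 2 * del by rewrite mulr_gt0.
have near_y y : nm (y - x) < del -> forall w, nm (w - y) < 2 * del -> nm (w - x) < s.
  move=> yx w wy; have := nm_trans w y x; rewrite /del in yx wy *; lra.
pose F n y := (t n)^-1 *: (f (y + t n *: v) - f y).
have FE n y : nm (y - x) < del -> nm (F n y - 'd f y v) <= B * nm (t n).
  move=> yx; have tn0 : 0 < nm (t n) by rewrite nm_gt0.
  have := @frechet_cauchy2 R X Y f y (2 * del) M (t n *: v) d2.
  have b1 w : nm (w - y) < 2 * del -> differentiable f w.
    by move=> /(near_y _ yx) /sr[].
  have b2 w : nm (w - y) < 2 * del -> nm (f w) <= M.
    by move=> /(near_y _ yx) /sr[].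
  have b3 : nm (t n *: v) <= 2 * del / 8 by have := tv n; lra.
  move=> /(_ b1 b2 b3); rewrite linearZ.
  set a := 'd f y v => h.
  have -> : F n y - a = (t n)^-1 *: (f (y + t n *: v) - f y - t n *: a).
    by rewrite [RHS]scalerBr scalerK.
  rewrite nmZ nmV mulrC ler_pdivrMr //; apply: le_trans h _.
  by rewrite nmZ /B exprMn !mulrA [_ * nm (t n) * nm (t n)]mulrC; nra.
have fF n y : nm (y - x) < del -> is_fder (F n) y
    (fun u => (t n)^-1 *: ('d f (y + t n *: v) u - 'd f y u)).
  move=> yx; apply: is_fderZ; apply: is_fderB.
    apply: is_fder_shift; apply: diff_is_fder.
    apply: (sr _ _).1; have := nm_trans (y + t n *: v) y x.
    rewrite [y + _ - y]addrC addKr; have := tv n; rewrite /del in yx *; lra.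
  by apply: diff_is_fder; apply: (sr _ _).1; apply: (near_y y yx); rewrite subrr nm0.
have dG y : nm (y - x) < del -> nm ('d f y v) <= 32 * M / (2 * del) * nm v.
  move=> yx; apply: frechet_cauchy1 => // w wy; by have [] := sr w (near_y _ yx _ wy).
have UF (eps : R) : 0 < eps -> exists N, forall n, (N <= n)%N ->
     forall y, nm (y - x) < del -> nm (F n y - 'd f y v) <= eps.
  move=> eps0; have B1 : 0 < `|B| + 1 by rewrite ltr_wpDl.
  have [N HN] := tlim _ (divr_gt0 eps0 B1); exists N => n /HN h y /(FE n) h'.
  apply: le_trans h' _; apply: (@le_trans _ _ (`|B| * nm (t n))).
    by rewrite ler_wpM2r ?nm_ge0 ?ler_norm.
  move: h; rewrite ler_pdivlMr //; have := nm_ge0 (t n); nra.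
have dF n y : nm (y - x) < del -> differentiable (F n) y.
  by move=> /(fF n) /is_fder_diff [].
have [W1 W2] := weierstrass del0 dF dG UF.
exists t; split=> // u eps eps0; have [N HN] := W2 u eps eps0.
exists N => n Nn.
have xx : nm (x - x) < del by rewrite subrr nm0.
have E := (is_fder_diff (fF n x xx)).2 u.
rewrite -E; exact: HN.
Qed.

Lemma directional_differentiable (f : X -> Y) (x v : X) (r : R) : 0 < r ->
  (forall y, nm (y - x) < r -> differentiable f y) ->
  differentiable (fun y => 'd f y v) x.
Proof. by move=> r0 df; have [t []] := directional_weierstrass v r0 df. Qed.

Definition seq_to (V : normedModType C) (q : nat -> V) (a : V) :=
  forall eps : R, 0 < eps -> exists N, forall n, (N <= n)%N -> nm (q n - a) <= eps.

Lemma seq_to_unique (V : normedModType C) (q : nat -> V) (a b : V) :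
  seq_to q a -> seq_to q b -> a = b.
Proof.
move=> ha hb; apply/eqP; rewrite -subr_eq0 -nm_eq0 eq_le nm_ge0 andbT.
apply/ler_addgt0Pl => e e0; rewrite addr0.
have e2 : 0 < e / 2 by rewrite divr_gt0.
have [N1 H1] := ha _ e2; have [N2 H2] := hb _ e2.
have h1 := H1 _ (leq_maxl N1 N2); have h2 := H2 _ (leq_maxr N1 N2).
have := nm_trans a (q (maxn N1 N2)) b; rewrite (nm_dist a (q _)); lra.
Qed.

Lemma is_fder_quotient (g : X -> Y) (x v : X) (L : X -> Y) (t : nat -> C) :
  is_fder g x L -> (forall n, t n != 0) ->
  (forall eps : R, 0 < eps -> exists N, forall n, (N <= n)%N -> nm (t n) <= eps) ->
  seq_to (fun n => (t n)^-1 *: (g (x + t n *: v) - g x)) (L v).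
Proof.
move=> [Ll _ K] t0 tlim e e0.
have LZ k : L (k *: v) = k *: L v.
  have L0 : L 0 = 0 by have := Ll (-1) 0 0; rewrite scaler0 add0r scaleN1r addNr.
  by have := Ll k v 0; rewrite addr0 L0 addr0.
have v1 : 0 < nm v + 1 by rewrite ltr_wpDl ?nm_ge0.
have [del del0 Hd] := K _ (divr_gt0 e0 v1).
have [N HN] := tlim (del / (2 * (nm v + 1))) (divr_gt0 del0 (mulr_gt0 (ltr0Sn _ _) v1)).
exists N => n /HN h2.
have tn0 : 0 < nm (t n) by rewrite nm_gt0.
have small : nm (t n *: v) < del.
  rewrite nmZ; move: h2; rewrite ler_pdivlMr ?mulr_gt0 // => h2.
  have := nm_ge0 v; nra.
have := Hd _ small; rewrite LZ nmZ => h3.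
set q := g _ - g x in h3 *.
have -> : (t n)^-1 *: q - L v = (t n)^-1 *: (q - t n *: L v).
  by rewrite [RHS]scalerBr scalerK.
rewrite nmZ nmV mulrC ler_pdivrMr //; apply: le_trans h3 _.
rewrite mulrAC ler_pdivrMr // -mulrA ler_pM2l //.
by rewrite ler_pM2l //; lra.
Qed.

(** The quotients [('d f (x + t v) u - 'd f x u) / t] have two limits: the left side, because
    derivatives of difference quotients converge, and the right side, because [y |-> 'd f y u] is
    differentiable. *)
Lemma second_deriv_sym (f : X -> Y) (x u v : X) (r : R) : 0 < r ->
  (forall y, nm (y - x) < r -> differentiable f y) ->
  'd (fun y => 'd f y v) x u = 'd (fun y => 'd f y u) x v.
Proof.
move=> r0 df; have [t [t0 tlim _ H]] := directional_weierstrass v r0 df.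
have dGu := directional_differentiable u r0 df.
exact: seq_to_unique (H u) (is_fder_quotient v (diff_is_fder dGu) t0 tlim).
Qed.

End Smoothness.

(** * Expansions up to [o(t^n)] *)

Section Small.
Variables (R : realType) (Y : normedModType R[i]).
Local Notation C := R[i].
Implicit Types (F G : C -> Y) (n k : nat).

Definition small n F := forall eps : R, 0 < eps -> exists2 del : R, 0 < del &
  forall t, nm t < del -> nm (F t) <= eps * nm t ^+ n.

Lemma smallD n F G : small n F -> small n G -> small n (fun t => F t + G t).
Proof.
move=> hF hG eps eps0; have e2 : 0 < eps / 2 by rewrite divr_gt0.
have [d1 d10 H1] := hF _ e2; have [d2 d20 H2] := hG _ e2.
exists (Num.min d1 d2); first by rewrite lt_min d10.
move=> t; rewrite lt_min => /andP[/H1 h1 /H2 h2].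
by apply: le_trans (nm_leD _ _) _; lra.
Qed.

Lemma smallN n F : small n F -> small n (fun t => - F t).
Proof. by move=> h eps /h [d d0 H]; exists d => // t; rewrite nmN; apply: H. Qed.

Lemma smallB n F G : small n F -> small n G -> small n (fun t => F t - G t).
Proof. by move=> hF /smallN; apply: smallD. Qed.

Lemma small_pow n k F : small n F -> small (k + n) (fun t => t ^+ k *: F t).
Proof.
move=> h eps /h [d d0 H]; exists d => // t /H {}H.
by rewrite nmZ nmX exprD mulrCA ler_wpM2l ?exprn_ge0 ?nm_ge0.
Qed.

Lemma smallS n F : small n.+1 F -> small n F.
Proof.
move=> h eps eps0; have [d d0 H] := h eps eps0.
exists (Num.min d 1); first by rewrite lt_min d0 ltr01.
move=> t; rewrite lt_min => /andP[/H {}H t1]; apply: le_trans H _.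
rewrite exprS mulrCA ler_piMl ?mulr_ge0 ?exprn_ge0 ?nm_ge0 //; exact: ltW.
Qed.

Lemma small_monomial n (A : Y) : small n (fun t => t ^+ n.+1 *: A).
Proof.
move=> eps eps0; have A1 : 0 < nm A + 1 by rewrite ltr_wpDl ?nm_ge0.
exists (eps / (nm A + 1)); first by rewrite divr_gt0.
move=> t; rewrite ltr_pdivlMr // => h.
rewrite nmZ nmX exprS mulrAC ler_wpM2r ?exprn_ge0 ?nm_ge0 //.
by have := nm_ge0 t; nra.
Qed.

Lemma small_coef_eq0 n (A : Y) : small n (fun t => t ^+ n *: A) -> A = 0.
Proof.
move=> h; apply/eqP; rewrite -nm_eq0 eq_le nm_ge0 andbT.
apply/ler_addgt0Pl => e e0; rewrite addr0; have [d d0 H] := h e e0.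
have := H (d / 2)%:C; rewrite nmZ nmX nm_real gtr0_norm ?divr_gt0 //.
have -> : d / 2 < d by lra.
by move=> /(_ isT); rewrite mulrC ler_pM2r // exprn_gt0 // divr_gt0.
Qed.

Lemma small_ext n F G : F =1 G -> small n F -> small n G.
Proof. by move=> /funext ->. Qed.

Lemma small_23_eq0 (A B : Y) :
  small 3 (fun t => t ^+ 2 *: A + t ^+ 3 *: B) -> A = 0 /\ B = 0.
Proof.
move=> h; have A0 : A = 0.
  apply: (@small_coef_eq0 2).
  apply: (@small_ext 2 (fun t => t ^+ 2 *: A + t ^+ 3 *: B - t ^+ 3 *: B)).
    by move=> t; rewrite addrK.
  by apply: smallB (smallS h) _; exact: small_monomial.
split=> //; apply: (@small_coef_eq0 3); apply: small_ext h => t.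
by rewrite A0 scaler0 add0r.
Qed.

Lemma small_primitive n F F' (r : R) : 0 < r ->
  (forall t, nm t < r -> is_cder F t (F' t)) -> F 0 = 0 ->
  small n F' -> small n.+1 F.
Proof.
move=> r0 dF F0 h eps eps0; have [d d0 H] := h eps eps0.
exists (Num.min d r); first by rewrite lt_min d0.
move=> t; rewrite lt_min => /andP[td tr].
have := @mean_value R Y F 0 (nm t) (eps * nm t ^+ n) 0 t.
rewrite F0 !subr0 nm0 nm_ge0 lexx => HH.
rewrite exprSr mulrA; apply: HH => // w; rewrite subr0 => wt; exists (F' w).
  by apply: dF; apply: le_lt_trans tr.
apply: le_trans (H w (le_lt_trans wt td)) _; rewrite ler_pM2l //.
by rewrite lerXn2r ?nnegrE ?nm_ge0.
Qed.

Variables (g : nat -> C -> Y) (r : R).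
Hypothesis r0 : 0 < r.
Hypothesis dg : forall k t, nm t < r -> is_cder (g k) t (g k.+1 t).

Lemma taylor_young0 k : small 0 (fun t => g k t - g k 0).
Proof.
move=> eps eps0.
have [|d d0 H] := @is_cder_cont R Y (g k) 0 (g k.+1 0) _ eps eps0.
  by apply: dg; rewrite nm0.
by exists d => // t; have := H t; rewrite subr0 expr0 mulr1.
Qed.

Lemma is_cder_monomial k (A : Y) t :
  is_cder (fun t : C => t ^+ k.+1 *: A) t ((k.+1%:R * t ^+ k) *: A).
Proof.
have H : @is_cder R R[i]^o (fun t : C => t ^+ k.+1) t (k.+1%:R * t ^+ k).
  elim: k => [|k IH].
    by rewrite expr0 mulr1; exact: is_cder_id.
  have -> : k.+2%:R * t ^+ k.+1 = 1 * t ^+ k.+1 + t * (k.+1%:R * t ^+ k).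
    by rewrite mulrCA -exprS -mulrDl (natrD _ 1 k.+1).
  have -> : (fun t : C => t ^+ k.+2) = (fun t : C => t * t ^+ k.+1).
    by apply/funext => x; rewrite exprS.
  exact: is_cderM (is_cder_id t) IH.
have := is_cderZ H (is_cder_cst A t).
by rewrite scaler0 addr0.
Qed.

(** The remainder of [g k] has as derivative the remainder of [g k.+1] of one order less, so each
    order follows from the previous one by [small_primitive]; this is why [k] is kept general. *)
Lemma taylor_young1 k : small 1 (fun t => g k t - (g k 0 + t *: g k.+1 0)).
Proof.
apply: (small_primitive r0 _ _ (taylor_young0 k.+1)).
  move=> t tr; apply: is_cderB; first exact: dg.
  rewrite -[X in is_cder _ _ X]add0r; apply: is_cderD; first exact: is_cder_cst.
  have := is_cder_monomial 0 (g k.+1 0) t.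
  by rewrite expr0 mulr1 scale1r.
by rewrite scale0r addr0 subrr.
Qed.

Lemma taylor_young2 k : small 2 (fun t =>
  g k t - (g k 0 + t *: g k.+1 0 + t ^+ 2 *: ((2^-1 : C) *: g k.+2 0))).
Proof.
apply: (small_primitive r0 _ _ (taylor_young1 k.+1)).
  move=> t tr; apply: is_cderB; first exact: dg.
  apply: is_cderD.
    rewrite -[X in is_cder _ _ X]add0r; apply: is_cderD; first exact: is_cder_cst.
    have := is_cder_monomial 0 (g k.+1 0) t.
    by rewrite expr0 mulr1 scale1r.
  have := is_cder_monomial 1 (2^-1 *: g k.+2 0) t.
  by rewrite scalerA mulrAC divff ?pnatr_eq0 // mul1r.
by rewrite expr0n /= !scale0r !addr0 subrr.
Qed.

Lemma taylor_young3 k : small 3 (fun t =>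
  g k t - (g k 0 + t *: g k.+1 0 + t ^+ 2 *: ((2^-1 : C) *: g k.+2 0)
           + t ^+ 3 *: ((6^-1 : C) *: g k.+3 0))).
Proof.
apply: (small_primitive r0 _ _ (taylor_young2 k.+1)).
  move=> t tr; apply: is_cderB; first exact: dg.
  apply: is_cderD; first apply: is_cderD.
  - rewrite -[X in is_cder _ _ X]add0r; apply: is_cderD; first exact: is_cder_cst.
    have := is_cder_monomial 0 (g k.+1 0) t.
    by rewrite expr0 mulr1 scale1r.
  - have := is_cder_monomial 1 (2^-1 *: g k.+2 0) t.
    by rewrite scalerA mulrAC divff ?pnatr_eq0 // mul1r.
  - have := is_cder_monomial 2 (6^-1 *: g k.+3 0) t.
    rewrite (_ : _ *: (6^-1 *: _) = t ^+ 2 *: (2^-1 *: g k.+3 0)) //.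
    by rewrite !scalerA; congr (_ *: _); field.
by rewrite !expr0n /= !scale0r !addr0 subrr.
Qed.

End Small.

(** * Coefficients of starlike mappings *)

Section Taylor.
Variables (R : realType) (X : completeNormedModType R[i]).
Local Notation C := R[i].
Implicit Types (f h : X -> X) (u v w x y : X).

Lemma unit_ball_near x : unit_ball x ->
  exists2 r : R, 0 < r & forall y, nm (y - x) < r -> unit_ball y.
Proof.
rewrite /unit_ball /= nm_lt1 => x1; exists (1 - nm x); first by rewrite subr_gt0.
by move=> y h; rewrite nm_lt1; have := nm_leD (y - x) x; rewrite subrK; lra.
Qed.

Lemma unit_ball0 : unit_ball (0 : X).
Proof. by rewrite /unit_ball /= normr0 ltr01. Qed.

Lemma frechetD_holomorphic f vs : holomorphic_on (@unit_ball R X) f ->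
  holomorphic_on (@unit_ball R X) (frechetD f vs).
Proof.
move=> hf; elim: vs => [|v vs IH] //= x /unit_ball_near [r r0 Hr].
by apply: (directional_differentiable v r0) => y /Hr; apply: IH.
Qed.

Lemma frechetD2_sym f u v x : holomorphic_on (@unit_ball R X) f -> unit_ball x ->
  frechetD f [:: u; v] x = frechetD f [:: v; u] x.
Proof.
move=> hf /unit_ball_near [r r0 Hr].
by apply: (second_deriv_sym u v r0) => y /Hr; apply: hf.
Qed.

Lemma frechetD2_linear f v x : linear (fun u => frechetD f [:: u; v] x).
Proof. by move=> k u w; exact: linearP. Qed.

Lemma frechetD2_add f u v w x : frechetD f [:: u + v; w] x =
  frechetD f [:: u; w] x + frechetD f [:: v; w] x.
Proof. by have := frechetD2_linear f w x 1 u v; rewrite !scale1r. Qed.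

Lemma frechetD2_scale f k u w x : frechetD f [:: k *: u; w] x =
  k *: frechetD f [:: u; w] x.
Proof. exact: linearZ. Qed.

Lemma frechetD_line f vs v (t : C) : holomorphic_on (@unit_ball R X) f ->
  nm t < (nm v + 1)^-1 ->
  is_cder (fun z : C => frechetD f vs (z *: v)) t (frechetD f (v :: vs) (t *: v)).
Proof.
move=> hf ht; have H := frechetD_holomorphic vs hf.
have v1 : 0 < nm v + 1 by rewrite ltr_wpDl ?nm_ge0.
have D : differentiable (frechetD f vs) (0 + t *: v).
  apply: H; rewrite /unit_ball /= nm_lt1 add0r nmZ.
  have : nm t * (nm v + 1) < 1 by rewrite -ltr_pdivlMr // div1r.
  by have := nm_ge0 t; lra.
have := is_cder_line D; rewrite add0r.
by have -> : (fun w : C => frechetD f vs (0 + w *: v)) =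
    (fun z : C => frechetD f vs (z *: v))
  by apply/funext => z; rewrite add0r.
Qed.

Definition line f v (k : nat) (t : C) := frechetD f (nseq k v) (t *: v).

Lemma line_radius v : 0 < (nm v + 1)^-1.
Proof. by rewrite invr_gt0 ltr_wpDl ?nm_ge0. Qed.

Lemma line_cder f v k (t : C) : holomorphic_on (@unit_ball R X) f ->
  nm t < (nm v + 1)^-1 -> is_cder (line f v k) t (line f v k.+1 t).
Proof. exact: frechetD_line. Qed.

Lemma line0 f v k : line f v k 0 = frechetD f (nseq k v) 0.
Proof. by rewrite /line scale0r. Qed.

Lemma taylor_poly2 f v : taylor_poly f 2 v = (2^-1 : C) *: frechetD f [:: v; v] 0.
Proof. by []. Qed.

Lemma taylor_poly3 f v : taylor_poly f 3 v = (6^-1 : C) *: frechetD f [:: v; v; v] 0.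
Proof. by []. Qed.

Lemma normalized_expansion f v : normalized_holomorphic f ->
  small 3 (fun t : C => f (t *: v) -
    (t *: v + t ^+ 2 *: taylor_poly f 2 v + t ^+ 3 *: taylor_poly f 3 v)).
Proof.
move=> [hf f0 df].
have dl k (t : C) : nm t < (nm v + 1)^-1 -> is_cder (line f v k) t (line f v k.+1 t).
  by apply: line_cder.
have := taylor_young3 (line_radius v) dl 0; rewrite !line0.
have e0 : frechetD f (nseq 0 v) 0 = 0 by exact: f0.
have e1 : frechetD f (nseq 1 v) 0 = v by exact: df.
move=> H; apply: small_ext H => t.
by rewrite e0 e1 add0r -taylor_poly2 -taylor_poly3.
Qed.

(** Lets the Taylor polynomials of an explicit mapping be read off from its expansion, without
    computing iterated Fréchet derivatives. *)
Lemma expansion_unique f v (A B : X) : normalized_holomorphic f ->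
  small 3 (fun t : C => f (t *: v) - (t *: v + t ^+ 2 *: A + t ^+ 3 *: B)) ->
  taylor_poly f 2 v = A /\ taylor_poly f 3 v = B.
Proof.
move=> nf H; have H' := normalized_expansion v nf.
have [] := @small_23_eq0 R X (taylor_poly f 2 v - A) (taylor_poly f 3 v - B).
  apply: small_ext (smallB H H') => t; rewrite !scalerBr.
  by move: (taylor_poly f 2 v) (taylor_poly f 3 v) => P Q; zmod.
by move=> /subr0_eq -> /subr0_eq ->.
Qed.

(** The left side combines remainders that will be [o(t^3)]: that of [f], those of [Df(tv)] in the
    directions [v], [H2], [H3] to orders 2, 1, 0, and [dr], the image of the remainder of [h]. What
    survives are the coefficients of [t^2] and [t^3], written [s2] and [s3]. *)
Lemma koenigs_algebra (t s2 s3 : C) (v P2 P3 H2 H3 D F dv d2 d3 dr : X) :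
  t * t = s2 -> t * s2 = s3 -> s2 * t = s3 ->
  F = t *: dv + s2 *: d2 + s3 *: d3 + dr ->
  F - (t *: v + s2 *: P2 + s3 *: P3)
  - t *: (dv - (v + t *: (P2 + P2) + s2 *: (P3 + P3 + P3)))
  - s2 *: (d2 - (H2 + t *: D)) - s3 *: (d3 - H3) - dr =
  s2 *: (P2 + H2) + s3 *: (P3 + P3 + D + H3).
Proof.
move=> e2 e3 e3' ->; rewrite !scalerBr !scalerDr !scalerA e2 e3 e3'.
zmod.
Qed.

Lemma additive_expansion (L : X -> X) (t s2 s3 : C) (v H2 H3 r y : X) :
  (forall k x, L (k *: x) = k *: L x) -> (forall x x', L (x + x') = L x + L x') ->
  t *: v + s2 *: H2 + s3 *: H3 + r = y ->
  L y = t *: L v + s2 *: L H2 + s3 *: L H3 + L r.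
Proof. by move=> LZ LD <-; rewrite !LD !LZ. Qed.

Lemma starlike_coefficients f h v : normalized_holomorphic f ->
  normalized_holomorphic h -> (forall x, unit_ball x -> 'd f x (h x) = f x) ->
  taylor_poly h 2 v = - taylor_poly f 2 v /\
  taylor_poly h 3 v = - (taylor_poly f 3 v + taylor_poly f 3 v
     + frechetD f [:: v; taylor_poly h 2 v] 0).
Proof.
move=> nf nh E; have [hf f0 df] := nf.
set P2 := taylor_poly f 2 v; set P3 := taylor_poly f 3 v.
set H2 := taylor_poly h 2 v; set H3 := taylor_poly h 3 v.
have two : frechetD f [:: v; v] 0 = P2 + P2.
  rewrite /P2 taylor_poly2 -scalerDl (_ : 2^-1 + 2^-1 = 1 :> C) ?scale1r //.
  by field.
have three : (2^-1 : C) *: frechetD f [:: v; v; v] 0 = P3 + P3 + P3.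
  rewrite /P3 taylor_poly3 -!scalerDl; congr (_ *: _); by field.
have dl w k (t : C) : nm t < (nm v + 1)^-1 ->
    is_cder (line (frechetD f [:: w]) v k) t (line (frechetD f [:: w]) v k.+1 t).
  by apply: line_cder; apply: frechetD_holomorphic.
have dl0 w : line (frechetD f [:: w]) v 0 0 = w.
  by rewrite line0; exact: df.
have dl1 w : line (frechetD f [:: w]) v 1 0 = frechetD f [:: v; w] 0 by rewrite line0.
have dl2 w : line (frechetD f [:: w]) v 2 0 = frechetD f [:: v; v; w] 0 by rewrite line0.
have SF := normalized_expansion v nf; have SH := normalized_expansion v nh.
have Sv := taylor_young2 (line_radius v) (dl v) 0.
rewrite dl0 dl1 dl2 two three in Sv.
have S2 := taylor_young1 (line_radius v) (dl H2) 0; rewrite dl0 dl1 in S2.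
have S3 := taylor_young0 (line_radius v) (dl H3) 0; rewrite dl0 in S3.
pose r (t : C) := h (t *: v) - (t *: v + t ^+ 2 *: H2 + t ^+ 3 *: H3).
pose dr (t : C) := 'd f (t *: v) (r t).
(* [Df(tv)] is bounded uniformly for small [t] by the Cauchy estimate, so it maps the [o(t^3)]
   remainder of [h] to [o(t^3)]. *)
have Sr : small 3 dr.
  have d0 : differentiable f 0 by apply: hf; exact: unit_ball0.
  have [r1 [M [r10 M0 fM]]] := differentiable_bounded d0.
  pose s := Num.min r1 1; have s0 : 0 < s by rewrite lt_min r10 ltr01.
  have K y u : nm y < s / 2 -> nm ('d f y u) <= 32 * M / (s / 2) * nm u.
    move=> ys; apply: frechet_cauchy1; first by rewrite divr_gt0.
      move=> w wy; apply: hf; rewrite /unit_ball /= nm_lt1.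
      have := nm_leD (w - y) y; rewrite subrK.
      have : s <= 1 by rewrite ge_min lexx orbT.
      lra.
    move=> w wy; apply: fM; rewrite subr0.
    have := nm_leD (w - y) y; rewrite subrK.
    have : s <= r1 by rewrite ge_min lexx.
    lra.
  pose K0 := 32 * M / (s / 2).
  have K00 : 0 <= K0 by rewrite divr_ge0 ?mulr_ge0 ?divr_ge0 // ltW.
  move=> eps eps0; have K1 : 0 < K0 + 1 by rewrite ltr_wpDl.
  have [d d00 Hd] := SH _ (divr_gt0 eps0 K1).
  have v1 : 0 < nm v + 1 by rewrite ltr_wpDl ?nm_ge0.
  exists (Num.min d (s / 2 / (nm v + 1))); first by rewrite lt_min d00 !divr_gt0.
  move=> t; rewrite lt_min => /andP[/Hd h1]; rewrite ltr_pdivlMr // => h2.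
  have h3 : nm (t *: v) < s / 2 by rewrite nmZ; have := nm_ge0 t; lra.
  apply: le_trans (K _ _ h3) _; rewrite -/K0.
  apply: (@le_trans _ _ (K0 * (eps / (K0 + 1) * nm t ^+ 3))).
    by rewrite ler_wpM2l.
  rewrite mulrA ler_wpM2r ?exprn_ge0 ?nm_ge0 // mulrA ler_pdivrMr // mulrC.
  by rewrite ler_pM2l // lerDl.
have Ef (t : C) : nm t < (nm v + 1)^-1 -> f (t *: v) = t *: 'd f (t *: v) v +
    t ^+ 2 *: 'd f (t *: v) H2 + t ^+ 3 *: 'd f (t *: v) H3 + dr t.
  move=> ht; have v1 : 0 < nm v + 1 by rewrite ltr_wpDl ?nm_ge0.
  have ub : unit_ball (t *: v).
    rewrite /unit_ball /= nm_lt1 nmZ.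
    have : nm t * (nm v + 1) < 1 by rewrite -ltr_pdivlMr // div1r.
    by have := nm_ge0 t; lra.
  have LZ k y : 'd f (t *: v) (k *: y) = k *: 'd f (t *: v) y by exact: linearZ.
  have LD y y' : 'd f (t *: v) (y + y') = 'd f (t *: v) y + 'd f (t *: v) y'.
    by exact: linearD.
  have HE : t *: v + t ^+ 2 *: H2 + t ^+ 3 *: H3 + r t = h (t *: v).
    have aux (y y' : X) : y + (y' - y) = y' by rewrite addrC subrK.
    exact: aux.
  rewrite -(E _ ub).
  exact: (additive_expansion (L := 'd f (t *: v)) LZ LD HE).
have S : small 3 (fun t : C => t ^+ 2 *: (P2 + H2) + t ^+ 3 *:
    (P3 + P3 + frechetD f [:: v; H2] 0 + H3)).
  have Q := smallB (smallB (smallB (smallB SF (@small_pow _ _ 2 1 _ Sv))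
    (@small_pow _ _ 1 2 _ S2)) (@small_pow _ _ 0 3 _ S3)) Sr.
  move=> eps /Q [d d0 Hd]; exists (Num.min d (nm v + 1)^-1).
    by rewrite lt_min d0 line_radius.
  move=> t; rewrite lt_min => /andP[/Hd h1 /Ef h2].
  by rewrite -(koenigs_algebra v P2 P3 H2 H3 (frechetD f [:: v; H2] 0)
    (esym (expr2 t)) (esym (exprS t 2)) (esym (exprSr t 2)) h2).
have [A B] := small_23_eq0 S.
split; first by apply/eqP; rewrite -addr_eq0 addrC A.
by apply/eqP; rewrite -addr_eq0 addrC B.
Qed.

(** Expanding the diagonal value at [u + w] isolates twice the mixed term, by symmetry; dividing by
    2 carries the relation off the diagonal. *)
Lemma polarization f h u w : holomorphic_on (@unit_ball R X) f ->
  holomorphic_on (@unit_ball R X) h ->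
  (forall v, frechetD h [:: v; v] 0 = - frechetD f [:: v; v] 0) ->
  frechetD h [:: u; w] 0 = - frechetD f [:: u; w] 0.
Proof.
move=> hf hh E.
have A g : holomorphic_on (@unit_ball R X) g -> frechetD g [:: u + w; u + w] 0 =
    frechetD g [:: u; u] 0 + frechetD g [:: w; w] 0 +
    (frechetD g [:: u; w] 0 + frechetD g [:: u; w] 0).
  move=> hg; rewrite frechetD2_add.
  rewrite (frechetD2_sym u (u + w) hg unit_ball0).
  rewrite (frechetD2_sym w (u + w) hg unit_ball0) !frechetD2_add.
  rewrite (frechetD2_sym w u hg unit_ball0).
  move: (frechetD g [:: u; u] 0) (frechetD g [:: u; w] 0) => a b.
  by move: (frechetD g [:: w; w] 0) => c; zmod.
have := E (u + w); rewrite (A _ hf) (A _ hh) !E.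
move: (frechetD f [:: u; u] 0) (frechetD f [:: u; w] 0) => a b.
move: (frechetD f [:: w; w] 0) (frechetD h [:: u; w] 0) => c d H.
have {}H : (2 : C) *: (d + b) = 0.
  rewrite scaler_nat mulr2n.
  have -> : d + b + (d + b) = (- a - c + (d + d)) - (- (a + c + (b + b))) by zmod.
  by rewrite H subrr.
apply/eqP; rewrite -addr_eq0; move/eqP: H.
by rewrite scaler_eq0 pnatr_eq0.
Qed.

(** The inner vector is fixed before the second differentiation, so linearity in it is obtained by
    exchanging the slots. *)
Lemma frechetD2_inner_opp f u w : holomorphic_on (@unit_ball R X) f ->
  frechetD f [:: u; - w] 0 = - frechetD f [:: u; w] 0.
Proof.
move=> hf; rewrite !(frechetD2_sym u _ hf unit_ball0).
by rewrite -scaleN1r frechetD2_scale scaleN1r.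
Qed.

Lemma frechetD2_inner_scale f u k w : holomorphic_on (@unit_ball R X) f ->
  frechetD f [:: u; k *: w] 0 = k *: frechetD f [:: u; w] 0.
Proof.
by move=> hf; rewrite !(frechetD2_sym u _ hf unit_ball0) frechetD2_scale.
Qed.

Lemma fekete_szego_starlike f h (e : X) (a : {linear X -> R[i]^o}) (l m : C) :
  normalized_holomorphic f -> normalized_holomorphic h ->
  (forall x, unit_ball x -> 'd f x (h x) = f x) ->
  fekete_szego e a h (2 * l) (2 * m) =
  (- 2 : C) *: fekete_szego e a f (1 - l) (1 - m).
Proof.
move=> nf nh E; have [hf _ _] := nf; have [hh _ _] := nh.
have [H2 H3] := starlike_coefficients e nf nh E.
have diag v : frechetD h [:: v; v] 0 = - frechetD f [:: v; v] 0.
  have [H _] := starlike_coefficients v nf nh E; move: H.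
  rewrite !taylor_poly2 -scalerN => /eqP; rewrite -subr_eq0 -scalerBr scaler_eq0.
  by rewrite invr_eq0 pnatr_eq0 /= subr_eq0 => /eqP.
rewrite /fekete_szego H3 H2 (polarization _ _ hf hh diag).
have aN : a (- taylor_poly f 2 e) = - a (taylor_poly f 2 e) := linearN a _.
rewrite !(frechetD2_inner_opp _ _ hf) opprK aN.
move: (taylor_poly f 3 e) (frechetD f [:: e; taylor_poly f 2 e] 0) => P3 D.
move: (taylor_poly f 2 e) {aN} => P2.
(* Common value of both sides, with [D = D^2 f(0)[e, P2]]: here [H3 = D - 2 P3], and in the term
   with [m] the sign of [D^2 h(0)] cancels that of [H2 = - P2]. *)
transitivity (D - (P3 + P3) - m *: D - (2 * (l - m) * a P2) *: P2).
  rewrite opprB scalerN opprK.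
  have -> : 2 * m / 2 = m by field.
  have -> : (2 * l - 2 * m) * - a P2 = - (2 * (l - m) * a P2) :> C by ring.
  by rewrite scaleNr.
rewrite !scalerBr !scalerA.
have -> : - 2 * ((1 - m) / 2) = m - 1 by field.
have -> : - 2 * ((1 - l - (1 - m)) * a P2) = 2 * (l - m) * a P2 :> C by ring.
by rewrite scaleNr scaler_nat (mulr2n P3) scalerBl scale1r; zmod.
Qed.

End Taylor.

(** * Schwarz' lemma and Caratheodory functions *)

Section Schwarz.
Variable R : realType.
Local Notation C := (R[i]^o).
Implicit Types (phi psi : C -> C) (z w : C) (r s : R).

Lemma bernoulli (x : R) k : 0 <= x -> 1 + k%:R * x <= (1 + x) ^+ k.
Proof.
move=> x0; elim: k => [|k IH]; first by rewrite mul0r addr0 expr0.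
rewrite exprS; apply: (@le_trans _ _ ((1 + x) * (1 + k%:R * x))).
  rewrite -natr1; have : 0 <= k%:R * x by rewrite mulr_ge0.
  nra.
by rewrite ler_pM2l //; lra.
Qed.

(** Removes the constant [A] from a crude bound on all powers: for [0 < m < x] the powers of [x / m]
    would exceed [A] by Bernoulli's inequality. *)
Lemma power_trick (x m A : R) : 0 <= x -> 0 <= m ->
  (forall k, x ^+ k <= A * m ^+ k) -> x <= m.
Proof.
move=> x0 m0 H; rewrite leNgt; apply/negP => mx.
have [me|mn] := eqVneq m 0.
  by have := H 1%N; rewrite !expr1 me mulr0; lra.
have mp : 0 < m by rewrite lt_neqAle eq_sym mn.
pose y := x / m - 1; have y0 : 0 < y by rewrite subr_gt0 ltr_pdivlMr ?mul1r.
pose k := Num.bound `|A / y|.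
have hk : A / y < k%:R.
  exact: le_lt_trans (ler_norm _) (archi_boundP (normr_ge0 _)).
have yE : 1 + y = x / m by rewrite /y addrC subrK.
have := bernoulli k (ltW y0); rewrite yE expr_div_n.
move=> h1; have := H k; rewrite -ler_pdivrMr ?exprn_gt0 // => h2.
by move: hk; rewrite ltr_pdivrMr //; lra.
Qed.

Lemma is_cderX phi z d k : is_cder phi z d ->
  exists e, is_cder (fun w => phi w ^+ k : C) z e.
Proof.
move=> H; elim: k => [|k [e IH]].
  exists 0; have -> : (fun w => phi w ^+ 0 : C) = (fun=> 1).
    by apply/funext => w; rewrite expr0.
  exact: is_cder_cst.
have -> : (fun w => phi w ^+ k.+1 : C) = (fun w => phi w * phi w ^+ k).
  by apply/funext => w; rewrite exprS.
by eexists; exact: is_cderM H IH.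
Qed.

(** Here [mean_bound] for [psi^k] gives [|psi z|^k <= 4 sqrt(m2)^k], and 16 is the square of that 4.
    A bound on an annulus around [z] suffices, which leaves room for a strict drop away from [z]. *)
Lemma local_maximum psi z (rho m2 : R) : 0 < rho ->
  (forall w, nm (w - z) <= rho -> exists d, is_cder psi w d) ->
  (forall w, rho / 2 <= nm (w - z) -> nm (w - z) <= rho -> nm (psi w) ^+ 2 <= m2) ->
  nm (psi z) ^+ 2 <= m2.
Proof.
move=> rho0 dpsi pm.
have nr : nm (rho%:C : R[i]) = rho by rewrite nm_real gtr0_norm.
have r0 : (rho%:C : R[i]) != 0 by rewrite -nm_gt0 nr.
have sub (w : R[i]) : z + w - z = w by rewrite addrC addKr.
have m20 : 0 <= m2.
  apply: le_trans (sqr_ge0 (nm (psi (z + rho%:C)))) (pm _ _ _); rewrite sub nr //.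
  lra.
apply: (@power_trick _ _ 16) => // [|k]; first exact: sqr_ge0.
pose g (w : R[i]) : C := psi (z + w) ^+ k.
have B : nm (g 0) <= 4 * Num.sqrt m2 ^+ k.
  apply: (mean_bound r0).
  - move=> w w0; rewrite nr => wr.
    have [d Hd] : exists d, is_cder psi (z + w) d by apply: dpsi; rewrite sub.
    exact: is_cderX (is_cder_shift Hd).
  - have [d Hd] : exists d, is_cder psi (z + 0) d.
      by apply: dpsi; rewrite sub nm0 ltW.
    have [e He] := is_cderX k (is_cder_shift Hd).
    move=> eps eps0; have [del d0 HH] := is_cder_cont He eps0.
    by exists del => // w wd; apply: HH; rewrite subr0.
  - move=> w; rewrite nr => w1 w2; rewrite /g nmX lerXn2r ?nnegrE ?nm_ge0 ?sqrtr_ge0 //.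
    rewrite -(@ler_pXn2r _ 2) ?nnegrE ?nm_ge0 ?sqrtr_ge0 // sqr_sqrtr //.
    by apply: pm; rewrite sub.
move: B; rewrite /g addr0 nmX => B.
have := nm_ge0 (psi z); set x := nm (psi z) in B * => x0.
have E1 : (x ^+ 2) ^+ k = (x ^+ k) ^+ 2 by rewrite -!exprM mulnC.
have E2 : m2 ^+ k = (Num.sqrt m2 ^+ k) ^+ 2.
  by rewrite -{1}(sqr_sqrtr m20) -!exprM mulnC.
have s0 : 0 <= Num.sqrt m2 ^+ k by rewrite exprn_ge0 ?sqrtr_ge0.
have y0 : 0 <= x ^+ k by rewrite exprn_ge0.
by rewrite E1 E2; nra.
Qed.

(** Lagrange's identity for the vectors [(1, sqrt(eps) z)] and [(1, sqrt(eps) w)]: the defect in the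
    Cauchy-Schwarz inequality is what makes the kernel peak at [w]. *)
Lemma weight_identity (eps : R) (z w : R[i]) :
  nm (1 + eps%:C * z * w^*) ^+ 2 =
  (1 + eps * nm z ^+ 2) * (1 + eps * nm w ^+ 2) - eps * nm (z - w) ^+ 2.
Proof.
rewrite !nm_sqr; case: z w => a b [c d] /=.
ring.
Qed.

(* The quantity |phi|^2 (1 + eps |z|^2) is almost maximised at some w away from
   the unit circle; multiplying phi by the kernel (1 + eps z conj(w)) / (1 +
   eps |w|^2), which is 1 at w, makes the maximum at w strict. *)
Lemma schwarz phi :
  (forall z, nm z < 1 -> exists d, is_cder phi z d) ->
  (forall z, nm z < 1 -> nm z * nm (phi z) <= 1) ->
  forall z, nm z < 1 -> nm (phi z) <= 1.
Proof.
move=> dphi bphi z0 z01; rewrite leNgt; apply/negP => big.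
pose q := nm (phi z0) ^+ 2; have q1 : 1 < q by rewrite /q; nra.
(* [eps] and [c < 1] satisfy [c q = 1 + eps], and [r^2 > c]. On [r <= |w| < 1] the weighted square
   is thus at most [(1 + eps) / r^2 < q], so values near the supremum occur inside radius [r]. *)
pose eps := (q - 1) / 2; have eps0 : 0 < eps by rewrite /eps; lra.
pose c := (q + 1) / (2 * q).
have c1 : c < 1 by rewrite /c ltr_pdivrMr; lra.
have c0 : 0 < c by rewrite /c divr_gt0; lra.
have cq : c * q = 1 + eps by rewrite /c /eps; field; lra.
pose r := (1 + c) / 2; have r1 : r < 1 by rewrite /r; lra.
have r0 : 0 < r by rewrite /r; lra.
have rc : c < r ^+ 2 by rewrite /r; nra.
pose u z := 1 + eps * nm z ^+ 2.
have u1 z : 1 <= u z by rewrite /u lerDl mulr_ge0 ?sqr_ge0 // ltW.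
have u2 z : nm z < 1 -> u z <= 1 + eps.
  move=> z1; rewrite /u lerD2l ler_piMr ?(ltW eps0) //.
  by rewrite expr_le1 ?nm_ge0 // ltW.
pose V z := nm (phi z) ^+ 2 * u z.
have V0 z : 0 <= V z by rewrite mulr_ge0 ?sqr_ge0 // (le_trans ler01).
pose A := [set V z | z in [set z | nm z < 1]].
have Ab : has_ubound A.
  have [d Hd] : exists d, is_cder phi 0 d by apply: dphi; rewrite nm0.
  have [del del0 Hdel] := is_cder_cont Hd ltr01.
  pose M := nm (phi 0) + 1 + del^-1.
  have M0 : 0 <= M by rewrite !addr_ge0 ?nm_ge0 ?invr_ge0 // ltW.
  exists (M ^+ 2 * (1 + eps)) => _ [z /= z1 <-].
  have hM : nm (phi z) <= M.
    have [zs|zb] := ltP (nm z) del.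
      have := Hdel z; rewrite subr0 => /(_ zs) h.
      have := nm_leD (phi z - phi 0) (phi 0); rewrite subrK.
      have : 0 <= del^-1 by rewrite invr_ge0 ltW.
      rewrite /M; lra.
    have zp : 0 < nm z by lra.
    have h1 : nm (phi z) <= del^-1.
      rewrite -div1r ler_pdivlMr //; have := bphi z z1; have := nm_ge0 (phi z); nra.
    by have := nm_ge0 (phi 0); rewrite /M; lra.
  apply: ler_pM; rewrite ?sqr_ge0 ?u2 //; first by have := u1 z; lra.
  by rewrite lerXn2r ?nnegrE ?nm_ge0.
have Az0 : A (V z0) by exists z0.
pose S := sup A.
have VS z : nm z < 1 -> V z <= S by move=> z1; apply: ub_le_sup => //; exists z.
have qS : q <= S.
  apply: le_trans (VS _ z01); rewrite /V -/q ler_peMr //; lra.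
pose rho := (1 - r) / 2; have rho0 : 0 < rho by rewrite /rho; lra.
(* On [|z - w| >= rho / 2] the weight identity loses at least [eps (rho/2)^2] from a product of at
   most [(1 + eps)^2]: a relative loss of [kap], so that [V w > S (1 - kap)] becomes
   contradictory. *)
pose kap := eps * (rho / 2) ^+ 2 / (1 + eps) ^+ 2.
have kap0 : 0 < kap.
  by rewrite !(divr_gt0, mulr_gt0, exprn_gt0) //; lra.
have Sp : 0 < S by lra.
have e1 : S * (1 - kap) < S by nra.
have e2 : (1 + eps) / r ^+ 2 < S.
  rewrite ltr_pdivrMr ?exprn_gt0 // -cq.
  apply: (@lt_le_trans _ _ (q * r ^+ 2)).
    by rewrite mulrC ltr_pM2l //; lra.
  by rewrite ler_wpM2r ?exprn_ge0 // ltW.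
have [_ [w /= w1 <-] hw] : exists2 y, A y & Num.max (S * (1 - kap)) ((1 + eps) / r ^+ 2) < y.
  by apply: sup_gt; [exists (V z0) | rewrite gt_max e1 e2].
move: hw; rewrite gt_max => /andP[hw1 hw2].
have wr : nm w < r.
  rewrite ltNge; apply/negP => rw; move: hw2; apply/negP; rewrite -leNgt.
  have wp : 0 < nm w by lra.
  rewrite ler_pdivlMr ?exprn_gt0 // /V.
  have h1 : nm (phi w) * r <= 1.
    by have := bphi w w1; have := nm_ge0 (phi w); nra.
  have h2 : (nm (phi w) * r) ^+ 2 <= 1.
    by rewrite expr_le1 // mulr_ge0 ?nm_ge0 // ltW.
  rewrite mulrAC -exprMn; have := u2 w w1; have := u1 w.
  by have := sqr_ge0 (nm (phi w) * r); nra.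
pose k (z : R[i]) : C := (1 + eps%:C * z * w^*) * (u w)^-1%:C.
have uw : 0 < u w by have := u1 w; lra.
have kw : k w = 1.
  have e : 1 + eps%:C * w * w^* = (u w)%:C :> R[i].
    have -> : eps%:C * w * w^* = (eps * nm w ^+ 2)%:C :> R[i].
      rewrite nm_sqr; case: (w) => a b /=; apply/eqP; rewrite eq_complex /=.
      by apply/andP; split; apply/eqP; ring.
    by rewrite /u rmorphD.
  rewrite /k e -rmorphM divff ?gt_eqF //.
have dk z : exists d, is_cder k z d.
  have H1 := is_cderM (is_cder_cst (eps%:C : C) z) (is_cder_id z).
  have H2 := is_cderM H1 (is_cder_cst (w^* : C) z).
  have H3 := is_cderD (is_cder_cst (1 : C) z) H2.
  by eexists; exact: is_cderM H3 (is_cder_cst ((u w)^-1%:C : C) z).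
have : nm (phi w * k w : R[i]) ^+ 2 <= S * (1 - kap) / u w.
  apply: (@local_maximum (fun z => phi z * k z : C) w rho) => //.
  - move=> z zr; have z1 : nm z < 1.
      by have := nm_leD (z - w) w; rewrite subrK /rho in zr *; lra.
    have [d Hd] := dphi z z1; have [d' Hd'] := dk z.
    by eexists; exact: is_cderM Hd Hd'.
  - move=> z zr1 zr; have z1 : nm z < 1.
      by have := nm_leD (z - w) w; rewrite subrK /rho in zr *; lra.
    rewrite nmM exprMn /k nmM exprMn weight_identity -/(u z) -/(u w).
    rewrite nm_real ger0_norm ?invr_ge0 ?(ltW uw) //.
    have uz : 0 < u z by have := u1 z; lra.
    have h1 := VS z z1; rewrite /V in h1.
    have h2 : kap * (u z * u w) <= eps * nm (z - w) ^+ 2.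
      apply: (@le_trans _ _ (kap * (1 + eps) ^+ 2)).
        rewrite ler_pM2l // expr2; apply: ler_pM; rewrite ?u2 //; lra.
      rewrite /kap divfK ?expf_neq0 ?gt_eqF //; last by lra.
      rewrite ler_pM2l // lerXn2r ?nnegrE ?nm_ge0 //; lra.
    rewrite expr2 mulrA mulrA ler_pdivlMr // mulfVK ?gt_eqF //.
    rewrite ler_pdivrMr //.
    apply: (@le_trans _ _ (nm (phi z) ^+ 2 * (u z * (1 - kap) * u w))).
      rewrite -expr2; apply: ler_wpM2l; first exact: sqr_ge0.
      have -> : u z * (1 - kap) * u w = u z * u w - kap * (u z * u w) by ring.
      lra.
    rewrite !mulrA ler_wpM2r ?(ltW uw) //; apply: ler_wpM2r => //.
    have : 0 <= V w / S by rewrite divr_ge0 // ltW.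
    have : kap <= 1.
      rewrite /kap ler_pdivrMr ?exprn_gt0 //; last lra.
      have : (rho / 2) ^+ 2 <= 1 by rewrite expr_le1 // /rho; lra.
      have := sqr_ge0 (rho / 2); nra.
    lra.
rewrite kw mulr1 ler_pdivlMr // -/(V w); lra.
Qed.

Lemma mobius_bound (x b : R[i]) :
  nm (1 - b^* * x) ^+ 2 - nm (x - b) ^+ 2 = (1 - nm x ^+ 2) * (1 - nm b ^+ 2).
Proof. by rewrite !nm_sqr; case: x b => a c [d e] /=; ring. Qed.

(** The [k]-th iterate of [F] is again a self-map of the disc fixing 0, with derivative [d^k]; the
    Cauchy bound on radius [1/2] gives [|d|^k <= 32]. *)
Lemma schwarz_deriv (F : C -> C) d :
  (forall z, nm z < 1 -> exists d, is_cder F z d) ->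
  (forall z, nm z < 1 -> nm (F z) < 1) -> F 0 = 0 -> is_cder F 0 d ->
  nm d <= 1.
Proof.
move=> dF bF F0 Fd.
have H k : [/\ forall z, nm z < 1 -> exists d, is_cder (iter k F) z d,
    forall z, nm z < 1 -> nm (iter k F z) < 1, iter k F 0 = 0
    & is_cder (iter k F) 0 (d ^+ k)].
  elim: k => [|k [H1 H2 H3 H4]].
    split=> //=; last by rewrite expr0; exact: is_cder_id.
    by move=> z _; exists 1; exact: is_cder_id.
  split.
  - move=> z z1; have [e He] := H1 z z1; have [e' He'] := dF _ (H2 z z1).
    by eexists; exact: is_cder_comp He He'.
  - by move=> z /H2 /bF.
  - by rewrite /= H3.
  - rewrite exprSr; apply: is_cder_comp H4 _; by rewrite H3.
apply: (@power_trick _ _ 32) => // [|k]; first exact: nm_ge0.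
have [H1 H2 H3 H4] := H k; rewrite expr1n mulr1 -nmX.
have -> : (32 : R) = 16 * 1 / (1 / 2) by field.
have lt1 (w : R[i]) : nm (w - 0) <= 1 / 2 -> nm w < 1 by rewrite subr0; lra.
apply: (cauchy_deriv1 _ _ _ H4); first by lra.
  by move=> w /lt1 /H1.
by move=> w /lt1 /H2 /ltW.
Qed.

(** The Moebius map taking [b = t phi(0)] to 0 reduces this to Schwarz' lemma. The factor [t < 1]
    makes the bound on [phi] strict, as [|phi(0)| = 1] is allowed; [t] tends to 1 at the end. *)
Lemma schwarz_pick phi c : (forall z, nm z < 1 -> exists d, is_cder phi z d) ->
  (forall z, nm z < 1 -> nm (phi z) <= 1) -> is_cder phi 0 c ->
  nm c <= 1 - nm (phi 0) ^+ 2.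
Proof.
move=> dphi bphi phic.
have p01 : nm (phi 0) <= 1 by apply: bphi; rewrite nm0.
have H (t : R) : 0 < t -> t < 1 -> t * nm c <= 1 - t ^+ 2 * nm (phi 0) ^+ 2.
  move=> t0 t1; pose b : R[i] := t%:C * phi 0.
  have nt : nm (t%:C : R[i]) = t by rewrite nm_real gtr0_norm.
  have b1 : nm b < 1 by rewrite nmM nt; have := nm_ge0 (phi 0); nra.
  have b2 : nm b ^+ 2 < 1 by rewrite expr_lt1 ?nm_ge0.
  pose x z : C := t%:C * phi z.
  have x1 z : nm z < 1 -> nm (x z) < 1.
    by move=> /bphi h; rewrite nmM nt; have := nm_ge0 (phi z); nra.
  pose N z : C := x z - b; pose D z : C := 1 - b^* * x z.
  have D0 z : nm z < 1 -> D z != 0.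
    move=> /x1 h; rewrite -nm_gt0; have := nm_geB (1 : R[i]) (b^* * x z).
    by rewrite nm1 nmM nm_conj; have := nm_ge0 b; have := nm_ge0 (x z); rewrite /D; nra.
  have dx z d : is_cder phi z d -> is_cder x z (t%:C * d : C).
    move=> hd; have := is_cderM (is_cder_cst (t%:C : C) z) hd.
    by rewrite mul0r add0r.
  have dN z d : is_cder phi z d -> is_cder N z (t%:C * d : C).
    by move=> /dx hd; have := is_cderB hd (is_cder_cst (b : C) z); rewrite subr0.
  have dD z d : is_cder phi z d -> is_cder D z (- (b^* * (t%:C * d)) : C).
    move=> /dx hd; have := is_cderM (is_cder_cst (b^* : C) z) hd.
    rewrite mul0r add0r => h; have := is_cderB (is_cder_cst (1 : C) z) h.
    by rewrite sub0r.
  pose F z : C := N z * (D z)^-1.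
  have N0 : N 0 = 0 by rewrite /N /x subrr.
  have nb0 : 0 < 1 - nm b ^+ 2 by lra.
  have D00 : D 0 = (1 - nm b ^+ 2)%:C.
    rewrite /D /x -/b nm_sqr; case: (b) => a a' /=; apply/eqP; rewrite eq_complex /=.
    by apply/andP; split; apply/eqP; ring.
  have z0 : nm (0 : C) < 1 by rewrite nm0.
  have FD : is_cder F 0 (t%:C * c / D 0 : C).
    have := is_cderM (dN _ _ phic) (is_cderV (dD _ _ phic) (D0 0 z0)).
    by rewrite N0 mul0r addr0.
  have : nm (t%:C * c / D 0 : R[i]) <= 1.
    apply: (@schwarz_deriv F) => //.
    - move=> z z1; have [d Hd] := dphi z z1.
      by eexists; exact: is_cderM (dN _ _ Hd) (is_cderV (dD _ _ Hd) (D0 z z1)).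
    - move=> z z1; rewrite /F nmM nmV ltr_pdivrMr ?nm_gt0 ?D0 // mul1r.
      rewrite -(@ltr_pXn2r _ 2) ?nnegrE ?nm_ge0 //.
      have := mobius_bound (x z) b; rewrite -/(D z) -/(N z).
      have : nm (x z) ^+ 2 < 1 by rewrite expr_lt1 ?nm_ge0 // x1.
      nra.
    - by rewrite /F N0 mul0r.
  rewrite !nmM nmV nt D00 nm_real gtr0_norm // ler_pdivrMr // mul1r.
  by rewrite /b nmM nt exprMn.
apply/ler_addgt0Pl => e e0.
set X := nm c in H *; set Y := nm (phi 0) ^+ 2 in H *.
have X0 : 0 <= X := nm_ge0 _; have Y0 : 0 <= Y := sqr_ge0 _.
have k0 : 0 < X + 2 * Y + 1 by lra.
pose s := Num.min (1 / 2) (e / (X + 2 * Y + 1)).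
have s0 : 0 < s by rewrite lt_min divr_gt0 // divr_gt0.
have s1 : s <= 1 / 2 by rewrite ge_min lexx.
have s2 : s * (X + 2 * Y + 1) <= e.
  by rewrite -ler_pdivlMr // ge_min lexx orbT.
have := H (1 - s); have -> : 0 < 1 - s by lra.
have -> : 1 - s < 1 by lra.
move=> /(_ isT isT); nra.
Qed.

(** * The coefficient estimate for functions of nonnegative real part *)

(** For [q = z p(z)] the quotient is [phi], and [c1], [c2] are its first two Taylor coefficients.
    The error is exact, so that differentiability of [phi] at 0 follows from bounds on numerator and
    denominator. *)
Lemma caratheodory_quotient (K : numFieldType) (z q e p1 p2 : K)
    (c1 := p1 / 2) (c2 := (p2 - p1 ^+ 2 / 2) / 2) :
  q = z + z ^+ 2 * p1 + z ^+ 3 * p2 + e -> z * (q + z) != 0 ->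
  (q - z) / (z * (q + z)) - c1 - z * c2 =
    (e * (1 - (c1 + c2 * z) * z) - z ^+ 4 * (c1 * p2 + c2 * p1)
      - z ^+ 5 * (c2 * p2)) / (z * (q + z)).
Proof.
move=> qE D; apply: (mulIf D).
set W := z * (q + z) in D *; rewrite mulfVK //.
set A := (q - z) / W; have AW : A * W = q - z by rewrite /A mulfVK.
have -> : (A - c1 - z * c2) * W = A * W - c1 * W - z * c2 * W by ring.
by rewrite AW /W /c1 /c2 qE; field.
Qed.

(** With [Y = |c1|^2], the bound [1 - Y + |k| Y] is a convex combination of 1 and [|k|]. *)
Lemma caratheodory_coefficients (c1 c2 k : R[i]) :
  nm c2 <= 1 - nm c1 ^+ 2 ->
  nm (2 * c2 - 2 * (k * c1 ^+ 2)) <= 2 * Num.max 1 (nm k).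
Proof.
move=> c2b; apply: le_trans (nm_leB _ _) _.
rewrite !nmM !nm_nat -mulrDr ler_pM2l // -expr2.
set m := Num.max _ _.
have m1 : 1 <= m by rewrite le_max lexx.
have m2 : nm k <= m by rewrite le_max lexx orbT.
have Y0 := sqr_ge0 (nm c1); set Y := nm c1 ^+ 2 in c2b Y0 *.
have c20 := nm_ge0 c2.
have h1 : 0 <= (m - 1) * (1 - Y) by rewrite mulr_ge0 ?subr_ge0 //; lra.
have h2 : 0 <= (m - nm k) * Y by rewrite mulr_ge0 ?subr_ge0.
nra.
Qed.

(** Working with [q = z p(z)] avoids a division at 0: the condition becomes [Re (conj(z) q) >= 0].
    Substituting [p1 = 2 c1] and [p2 = 2 c2 + 2 c1^2] leaves the previous bound with
    [k = 2l - 1]. *)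
Lemma caratheodory_fekete_szego (q : C -> C) (p1 p2 l : R[i]) :
  (forall z, nm z < 1 -> exists d, is_cder q z d) ->
  (forall z, nm z < 1 -> 0 <= complex.Re (z^* * q z)) ->
  small 3 (fun z : R[i] => q z - (z + z ^+ 2 * p1 + z ^+ 3 * p2) : C) ->
  nm (p2 - l * p1 ^+ 2) <= 2 * Num.max 1 (nm (2 * l - 1)).
Proof.
move=> dq req ex.
pose c1 := p1 / 2; pose c2 := (p2 - p1 ^+ 2 / 2) / 2.
(* This is [|p + 1| >= 1], from [Re (conj(z) (q + z)) >= |z|^2]. It bounds the denominator of [phi]
   below by [|z|^2]. *)
have qz (z : R[i]) : nm z < 1 -> nm z <= nm (q z + z).
  move=> /req; have [->|z0] := eqVneq z 0; first by rewrite nm0 nm_ge0.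
  have zp : 0 < nm z by rewrite nm_gt0.
  move=> h; have : nm z ^+ 2 <= nm z * nm (q z + z).
    rewrite -(nm_conj z) -nmM; apply: le_trans (Re_le_nm _).
    apply: le_trans (ler_norm _); rewrite mulrDr cReD nm_conj.
    by rewrite nm_sqr; move: h; case: (z) => a b /=; nra.
  by rewrite expr2 ler_pM2l.
have qz2 (z : R[i]) : nm z < 1 -> nm (q z - z) <= nm (q z + z).
  move=> /req h; rewrite -(@ler_pXn2r _ 2) ?nnegrE ?nm_ge0 // !nm_sqr.
  have h' : 0 <= complex.Re z * complex.Re (q z) + complex.Im z * complex.Im (q z).
    by move: h; rewrite cReM; case: (z) => a b /=; rewrite mulNr opprK.
  rewrite !(cReD, cImD, cReN, cImN); move: h'.
  move: (complex.Re z) (complex.Im z) (complex.Re (q z)) (complex.Im (q z)).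
  by move=> a b c d h'; nra.
pose phi (z : C) : C := if z == 0 then c1 else (q z - z) / (z * (q z + z)).
have den (z : R[i]) : nm z < 1 -> z != 0 -> z * (q z + z) != 0.
  move=> z1 z0; rewrite mulf_neq0 // -nm_gt0; apply: lt_le_trans (qz z z1).
  by rewrite nm_gt0.
have phi0 : phi 0 = c1 by rewrite /phi eqxx.
have dphi0 : is_cder phi 0 (c2 : C).
  (* The numerator consists of an [o(z^3)] part, with factor at most [1 + L], and of terms in [z^4]
     and [z^5], with constant [K]; over a denominator of size at least [|z|^2] this is [o(z)]. *)
  pose K := nm (c1 * p2 + c2 * p1) + nm (c2 * p2).
  have K0 : 0 <= K by rewrite addr_ge0 ?nm_ge0.
  pose L := nm c1 + nm c2; have L0 : 0 <= L by rewrite addr_ge0 ?nm_ge0.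
  have KL : 0 < K + L + 1 by lra.
  move=> eps eps0; have e3 : 0 < eps / (K + L + 1) by rewrite divr_gt0.
  have [d d0 Hd] := ex _ (divr_gt0 e3 (ltr0n _ 2)).
  exists (Num.min (Num.min d (1 / 2)) (eps / (K + L + 1) / 2)).
    by rewrite !lt_min d0 !divr_gt0.
  move=> z; rewrite subr0 !lt_min => /andP[/andP[/Hd h1 h2] h3].
  rewrite phi0; have [->|z0] := eqVneq z 0.
    by rewrite phi0 subrr scale0r subr0 !nm0 mulr0.
  have zp : 0 < nm z by rewrite nm_gt0.
  have z1 : nm z < 1 by lra.
  rewrite /phi (negPf z0); set e := (X in nm X <= _) in h1.
  have qE : q z = z + z ^+ 2 * p1 + z ^+ 3 * p2 + e by rewrite /e addrC subrK.
  have NE : (q z - z) / (z * (q z + z)) - c1 - z * c2 =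
    (e * (1 - (c1 + c2 * z) * z) - z ^+ 4 * (c1 * p2 + c2 * p1)
      - z ^+ 5 * (c2 * p2)) / (z * (q z + z)).
    exact: caratheodory_quotient qE (den z z1 z0).
  rewrite -[z *: c2]/(z * c2) NE nmM nmV ler_pdivrMr ?nm_gt0 ?den //.
  rewrite nmM; have hq := qz z z1.
  have n1 : nm (1 - (c1 + c2 * z) * z) <= 1 + L.
    apply: le_trans (nm_leB _ _) _; rewrite nm1 lerD2l nmM.
    have k1 : nm (c1 + c2 * z) * nm z <= nm (c1 + c2 * z).
      by rewrite ler_piMr ?nm_ge0 // ltW.
    have k2 : nm c2 * nm z <= nm c2 by rewrite ler_piMr ?nm_ge0 // ltW.
    by have := nm_leD c1 (c2 * z); rewrite nmM /L; lra.
  set y := nm z in zp z1 hq h1 h2 h3 *.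
  set X := _ - _ - _.
  have X1 : nm X <= eps / (K + L + 1) / 2 * y ^+ 3 * (1 + L) + y ^+ 4 * K.
    rewrite /X; apply: le_trans (nm_leB _ _) _.
    have g1 := nm_leB (e * (1 - (c1 + c2 * z) * z)) (z ^+ 4 * (c1 * p2 + c2 * p1)).
    have g2 : nm (e * (1 - (c1 + c2 * z) * z)) <= eps / (K + L + 1) / 2 * y ^+ 3 * (1 + L).
      by rewrite nmM; apply: ler_pM; rewrite ?nm_ge0.
    have g3 : nm (z ^+ 4 * (c1 * p2 + c2 * p1)) = y ^+ 4 * nm (c1 * p2 + c2 * p1).
      by rewrite nmM nmX.
    have g4 : nm (z ^+ 5 * (c2 * p2)) <= y ^+ 4 * nm (c2 * p2).
      rewrite nmM nmX ler_wpM2r ?nm_ge0 // exprS ler_piMl ?exprn_ge0 //; exact: ltW.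
    apply: le_trans (lerD (le_trans g1 (lerD g2 (lexx _))) g4) _.
    have Kd : y ^+ 4 * K = y ^+ 4 * nm (c1 * p2 + c2 * p1) + y ^+ 4 * nm (c2 * p2).
      by rewrite -mulrDr.
    rewrite g3 Kd [leRHS]addrA; exact: lexx.
  set E := eps / (K + L + 1) in X1 h3 e3 *.
  have EE : eps = E * (K + L + 1) by rewrite /E divfK // gt_eqF.
  apply: (@le_trans _ _ (eps * y * (y * y))); last first.
    by rewrite ler_wpM2l ?mulr_ge0 ?(ltW eps0) ?(ltW zp) // ler_wpM2l // ltW.
  apply: le_trans X1 _; rewrite EE.
  have y3 : 0 < y ^+ 3 by rewrite exprn_gt0.
  have -> : E * (K + L + 1) * y * (y * y) = (E * (K + L + 1)) * y ^+ 3 by ring.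
  have -> : E / 2 * y ^+ 3 * (1 + L) + y ^+ 4 * K =
    (E / 2 * (1 + L) + y * K) * y ^+ 3 by ring.
  by rewrite ler_pM2r //; nra.
have dphi (z : R[i]) : nm z < 1 -> exists d, is_cder phi z d.
  move=> z1; have [->|z0] := eqVneq z 0; first by exists c2.
  have [d Hd] := dq z z1.
  have H1 := is_cderB Hd (is_cder_id z).
  have H2 := is_cderM (is_cder_id z) (is_cderD Hd (is_cder_id z)).
  have H3 := is_cderM H1 (is_cderV H2 (den z z1 z0)).
  eexists; apply: (@is_cder_near _ _ _ _ z _ (nm z)) H3; first by rewrite nm_gt0.
  move=> w wz; rewrite /phi; case: eqVneq => // w0.
  by rewrite w0 sub0r nmN ltxx in wz.
have bphi (z : R[i]) : nm z < 1 -> nm z * nm (phi z) <= 1.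
  move=> z1; rewrite /phi; case: eqVneq => [->|z0]; first by rewrite nm0 mul0r.
  have zp : 0 < nm z by rewrite nm_gt0.
  have qp : 0 < nm (q z + z) by apply: lt_le_trans (qz z z1).
  have -> : nm z * nm ((q z - z) / (z * (q z + z)) : R[i]) =
      nm (q z - z) / nm (q z + z).
    by rewrite nmM nmV nmM; field; rewrite !gt_eqF.
  by rewrite ler_pdivrMr // mul1r qz2.
have c2b := schwarz_pick dphi (schwarz dphi bphi) dphi0.
rewrite phi0 in c2b.
have -> : p2 - l * p1 ^+ 2 = 2 * c2 - 2 * ((2 * l - 1) * c1 ^+ 2).
  by rewrite /c1 /c2; field.
exact: caratheodory_coefficients c2b.
Qed.

End Schwarz.

(** * The class M *)

Section Functionals.
Variables (R : realType) (X : normedModType R[i]).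
Variable a : {linear X -> R[i]^o}.

Lemma functionalZ k x : a (k *: x) = k * a x.
Proof. exact: linearZ. Qed.

Lemma functionalD x y : a (x + y) = a x + a y.
Proof. exact: linearD. Qed.

Lemma functionalB x y : a (x - y) = a x - a y.
Proof. exact: linearB. Qed.

End Functionals.

(** * Support functionals at a unit vector *)

Section Duality.
Variables (R : realType) (X : completeNormedModType R[i]).
Local Notation C := R[i].
Variables (e : X) (a : {linear X -> R[i]^o}).
Hypotheses (e1 : `|e| = 1) (ae : duality_map e a).

Lemma nm_e : nm e = 1.
Proof. by rewrite /nm e1. Qed.

Lemma support_e : a e = 1.
Proof. by case: ae => _ _ ->; rewrite e1 expr1n. Qed.

(** [dual_norm] is a supremum, meaningful only for a set bounded above; continuity of [a] provides
    the bound, and scaling does the rest. *)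
Lemma support_le x : nm (a x) <= nm x.
Proof.
case: ae => ac an _; have {}an : dual_norm a = 1.
  by apply: (@complexI R); rewrite an e1.
have [k k0 Hk] := linear_lipschitz ac.
have kE : k = (complex.Re k)%:C.
  by move: k0; rewrite ltcE; case: (k) => r s /= /andP[/eqP -> _].
have B y : nm y <= 1 -> nm (a y) <= 1.
  move=> y1; rewrite -an; apply: ub_le_sup.
    exists (complex.Re k) => _ [x' /= x1 <-].
    have := Hk x'; rewrite kE !nmE -rmorphM lecR /= => h; apply: le_trans h _.
    rewrite ler_piMr //; first by move: k0; rewrite kE ltcR => /ltW.
    by rewrite -nm_le.
  by exists y => //=; rewrite (nm_le y 1).
have [->|x0] := eqVneq x 0; first by rewrite linear0 !nm0.
have xp : 0 < nm x by rewrite nm_gt0.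
have nV : nm ((nm x)^-1%:C : C) = (nm x)^-1.
  by rewrite nm_real ger0_norm // invr_ge0 ltW.
have := B ((nm x)^-1%:C *: x).
rewrite functionalZ nmM nmZ nV mulVf ?gt_eqF // => /(_ (lexx _)).
by rewrite mulrC ler_pdivrMr // mul1r.
Qed.

Lemma support_scaled (z : C) : exists b : {linear X -> R[i]^o},
  duality_map (z *: e) b /\ forall x, b x = z^* * a x.
Proof.
pose b0 x : R[i]^o := z^* * a x.
have bl : linear b0.
  move=> k u v; rewrite /b0 linearP mulrDr; congr (_ + _).
  by rewrite -[k *: a u]/(k * a u) -[RHS]/(k * (z^* * a u)) mulrCA.
pose b : {linear X -> R[i]^o} := HB.pack b0 (GRing.isLinear.Build _ _ _ _ b0 bl).
have nb x : nm (b x) = nm z * nm (a x) by rewrite -[b x]/(z^* * a x) nmM nm_conj.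
exists b; split=> //; split.
- move=> x; apply/cvg_nmP => eps eps0.
  have z1 : 0 < nm z + 1 by rewrite ltr_wpDl ?nm_ge0.
  exists (eps / (nm z + 1)); first by rewrite divr_gt0.
  move=> y; rewrite ltr_pdivlMr // => yx.
  have -> : b y - b x = b (y - x) by rewrite linearB.
  rewrite nb; have := support_le (y - x); have := nm_ge0 (y - x).
  by have := nm_ge0 z; have := nm_ge0 (a (y - x)); nra.
- rewrite nmE nmZ nm_e mulr1; congr (_ %:C).
  have ub : ubound [set complex.Re `|b x| | x in [set x : X | `|x| <= 1]] (nm z).
    move=> _ [x /= x1 <-]; suff: nm (b x) <= nm z by [].
    rewrite nb ler_piMr ?nm_ge0 //.
    by apply: le_trans (support_le x) _; rewrite -(nm_le x 1).
  apply/eqP; rewrite eq_le; apply/andP; split.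
    by apply: ge_sup => //; exists (complex.Re `|b e|), e; rewrite //= e1.
  apply: ub_le_sup; first by exists (nm z).
  exists e; first by rewrite /= e1.
  by have := nb e; rewrite support_e nm1 mulr1.
- rewrite -[b _]/(z^* * a (z *: e)) functionalZ nmE nmZ nm_e mulr1.
  rewrite support_e mulr1.
  rewrite -rmorphXn nm_sqr; case: (z) => x y; apply/eqP; rewrite eq_complex /=.
  by apply/andP; split; apply/eqP; ring.
Qed.

Lemma is_cder_support (g : C -> X) (z : C) d : is_cder g z d ->
  is_cder (fun w : R[i]^o => a (g w) : R[i]^o) z (a d).
Proof.
move=> H eps /H [del del0 Hd]; exists del => // w /Hd h; apply: le_trans h.
have -> : a (g w) - a (g z) - (w - z) *: a d = a (g w - g z - (w - z) *: d).
  rewrite (functionalB a (g w - g z)) (functionalB a (g w)).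
  by rewrite (functionalZ a (w - z)).
exact: support_le.
Qed.

Lemma support_expansion (h : X -> X) : normalized_holomorphic h ->
  small 3 (fun z : R[i] => a (h (z *: e)) -
    (z + z ^+ 2 * a (taylor_poly h 2 e) + z ^+ 3 * a (taylor_poly h 3 e)) : R[i]^o).
Proof.
move=> nh; have := normalized_expansion e nh.
move: (taylor_poly h 2 e) (taylor_poly h 3 e) => A B H eps /H [del del0 Hd].
exists del => // z /Hd k; apply: le_trans k.
have -> : a (h (z *: e)) - (z + z ^+ 2 * a A + z ^+ 3 * a B) =
    a (h (z *: e) - (z *: e + z ^+ 2 *: A + z ^+ 3 *: B)).
  rewrite (functionalB a (h _)) (functionalD a (z *: e + z ^+ 2 *: A)).
  rewrite (functionalD a (z *: e)) (functionalZ a z) (functionalZ a (z ^+ 2)).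
  by rewrite (functionalZ a (z ^+ 3)) support_e (mulr1 z).
exact: support_le.
Qed.

Lemma fekete_szego_scalar (h : X -> X) l :
  a (fekete_szego e a h l 0) =
  a (taylor_poly h 3 e) - l * a (taylor_poly h 2 e) ^+ 2 :> C.
Proof.
rewrite /fekete_szego mul0r scale0r !subr0.
move: (taylor_poly h 2 e) (taylor_poly h 3 e) => A B.
by rewrite functionalB functionalZ -mulrA.
Qed.

(** With [q z = a (h (z e))], testing at the point [z e] with [conj(z) a], an element of [J(ze)],
    turns membership in the class into [Re (conj(z) q z) >= 0]; the point [z = 0], excluded there,
    is trivial. *)
Lemma fekete_szego_bound (h : X -> X) l : class_M h ->
  nm (a (fekete_szego e a h l 0) : C) <= 2 * Num.max 1 (nm (2 * l - 1)).
Proof.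
move=> [nh Mh]; have [hh _ _] := nh; rewrite fekete_szego_scalar.
have ball (z : C) : nm z < 1 -> unit_ball (z *: e).
  by rewrite /unit_ball /= nm_lt1 nmZ nm_e mulr1.
apply: (@caratheodory_fekete_szego R (fun z => a (h (z *: e)))).
- move=> z z1; exists (a ('d h (z *: e) e)); apply: is_cder_support.
  have := @is_cder_line R X X h 0 e z; rewrite add0r => H.
  have := H (hh _ (ball z z1)).
  by rewrite (_ : (fun w => h (0 + _)) = (fun w : C => h (w *: e))) //;
    apply/funext => w; rewrite add0r.
- move=> z z1; have [->|z0] := eqVneq z 0.
    by rewrite rmorph0 mul0r.
  have [b [bd bE]] := support_scaled z; rewrite -bE.
  apply: Mh bd; first exact: ball.
  by rewrite -nm_gt0 nmZ nm_e mulr1 nm_gt0.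
- exact: support_expansion.
Qed.

(** [D^2 h(0)[e, H2(e)] = 2 c2^2 e], so the two occurrences of [m] cancel. Only the values of the
    polynomials at [e] enter. *)
Lemma fekete_szego_one_dim (h : X -> X) (c2 c3 l m : C) :
  normalized_holomorphic h ->
  taylor_poly h 2 e = c2 *: e -> taylor_poly h 3 e = c3 *: e ->
  fekete_szego e a h l m = (c3 - l * c2 ^+ 2) *: e.
Proof.
move=> [hh _ _] T2 T3; rewrite /fekete_szego.
have D2 : frechetD h [:: e; taylor_poly h 2 e] 0 = (2 * c2 ^+ 2) *: e.
  rewrite T2 (frechetD2_inner_scale _ _ _ hh).
  have -> : frechetD h [:: e; e] 0 = (2 : C) *: taylor_poly h 2 e.
    by rewrite taylor_poly2 scalerA mulfV ?pnatr_eq0 // scale1r.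
  by rewrite T2 !scalerA; congr (_ *: _); ring.
rewrite D2 T3 T2.
have aE : a (c2 *: e) = c2 by rewrite functionalZ support_e mulr1.
rewrite aE !scalerA -!scalerBl; congr (_ *: _).
by field.
Qed.

End Duality.

(** * Extremal mappings *)

Section Sharpness.
Variables (R : realType) (X : completeNormedModType R[i]).
Local Notation C := R[i].

(* The extremal mappings are x |-> k(a x) x. *)
Definition caratheodory (k : R[i]^o -> R[i]^o) (p1 p2 : C) :=
  [/\ forall z, nm z < 1 -> exists d, is_cder k z d,
      forall z, nm z < 1 -> 0 <= complex.Re (k z), k 0 = 1
    & small 2 (fun t : R[i] => k t - (1 + t * p1 + t ^+ 2 * p2) : R[i]^o)].

Lemma small_cubic (F : C -> R[i]^o) :
  (forall t, nm t <= 1 / 2 -> nm (F t) <= 4 * nm t ^+ 3) -> small 2 F.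
Proof.
move=> H eps eps0; exists (Num.min (1 / 2) (eps / 4)).
  by rewrite lt_min !divr_gt0.
move=> t; rewrite lt_min => /andP[/ltW /H h ht]; apply: le_trans h _.
by rewrite exprS mulrA ler_wpM2r ?exprn_ge0 ?nm_ge0 //; lra.
Qed.

Lemma cayley_ge0 (w : C) : nm w < 1 -> 0 <= complex.Re ((1 + w) / (1 - w)).
Proof.
move=> w1; have w0 : 1 - w != 0.
  by rewrite -nm_gt0; have := nm_geB (1 : C) w; rewrite nm1; lra.
have w2 : nm w ^+ 2 < 1 by rewrite expr_lt1 ?nm_ge0.
have N : 0 < nm (1 - w) ^+ 2 by rewrite exprn_gt0 // nm_gt0.
have : (1 + w) / (1 - w) * (1 - w) = 1 + w by rewrite divfK.
move: {w1 w0} ((1 + w) / (1 - w)) N w2 => c; rewrite !nm_sqr.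
case: c w => x y [u v] /= N w2 [E1 E2]; rewrite -(pmulr_lge0 _ N).
have -> : x * ((1 - u) ^+ 2 + (0 - v) ^+ 2) = (1 + u) * (1 - u) + (0 + v) * (0 - v).
  by rewrite -E1 -E2; ring.
nra.
Qed.

Lemma nm_sub1_half (w : C) : nm w <= 1 / 2 -> 1 / 2 <= nm (1 - w).
Proof. by have := nm_geB (1 : C) w; rewrite nm1; lra. Qed.

Lemma cayley_caratheodory j : (0 < j)%N -> forall p1 p2,
  small 2 (fun t : R[i] => (1 + t ^+ j) / (1 - t ^+ j) - (1 + t * p1 + t ^+ 2 * p2)
     : R[i]^o) ->
  caratheodory (fun z => (1 + z ^+ j) / (1 - z ^+ j)) p1 p2.
Proof.
move=> j0 p1 p2 S.
have jb (z : C) : nm z < 1 -> nm (z ^+ j) < 1.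
  by move=> z1; rewrite nmX expr_lt1 ?nm_ge0.
split=> //.
- move=> z z1; have [d Hd] := is_cderX j (is_cder_id z).
  have H1 := is_cderD (is_cder_cst (1 : R[i]^o) z) Hd.
  have H2 := is_cderB (is_cder_cst (1 : R[i]^o) z) Hd.
  have n0 : (1 : R[i]^o) - z ^+ j != 0.
    by rewrite -nm_gt0; have := nm_geB (1 : C) (z ^+ j); rewrite nm1; have := jb z z1; lra.
  by eexists; exact: is_cderM H1 (is_cderV H2 n0).
- by move=> z /jb; exact: cayley_ge0.
- by rewrite expr0n gtn_eqF // addr0 subr0 divr1.
Qed.

Lemma cayley_small1 :
  small 2 (fun t : R[i] => (1 + t ^+ 1) / (1 - t ^+ 1) - (1 + t * 2 + t ^+ 2 * 2)
     : R[i]^o).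
Proof.
apply: small_cubic => t ht; have h := nm_sub1_half ht.
have t0 : 1 - t != 0 by rewrite -nm_gt0; lra.
have -> : (1 + t ^+ 1) / (1 - t ^+ 1) - (1 + t * 2 + t ^+ 2 * 2) =
    2 * t ^+ 3 / (1 - t) :> C by rewrite expr1; field.
rewrite nmM nmV nmM nmX nm_nat ler_pdivrMr; last lra.
have := exprn_ge0 3 (nm_ge0 t); nra.
Qed.

Lemma cayley_small2 :
  small 2 (fun t : R[i] => (1 + t ^+ 2) / (1 - t ^+ 2) - (1 + t * 0 + t ^+ 2 * 2)
     : R[i]^o).
Proof.
apply: small_cubic => t ht.
have n0 := nm_ge0 t.
have ht2 : nm (t ^+ 2) <= 1 / 2 by rewrite nmX; nra.
have h := nm_sub1_half ht2.
have t0 : 1 - t ^+ 2 != 0 by rewrite -nm_gt0; lra.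
have -> : (1 + t ^+ 2) / (1 - t ^+ 2) - (1 + t * 0 + t ^+ 2 * 2) =
    2 * t ^+ 4 / (1 - t ^+ 2) :> C by field.
rewrite nmM nmV nmM nmX nm_nat ler_pdivrMr; last lra.
have : nm t ^+ 4 <= nm t ^+ 3 by rewrite [nm t ^+ 4]exprS ler_piMl ?exprn_ge0 //; lra.
have := exprn_ge0 3 n0; nra.
Qed.

(** [(1+z)/(1-z)] has [p1 = p2 = 2], giving [-2 (2l - 1)], and is extremal when [|2l - 1| >= 1];
    [(1+z^2)/(1-z^2)] has [p1 = 0], [p2 = 2], giving 2, and is extremal otherwise. *)
Lemma caratheodory_sharp (l : C) : exists k p1 p2, caratheodory k p1 p2 /\
  nm (p2 - l * p1 ^+ 2) = 2 * Num.max 1 (nm (2 * l - 1)).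
Proof.
have [l1|l1] := leP 1 (nm (2 * l - 1)).
  exists (fun z => (1 + z ^+ 1) / (1 - z ^+ 1)), 2, 2; split.
    by apply: cayley_caratheodory => //; exact: cayley_small1.
  have -> : 2 - l * 2 ^+ 2 = - (2 * (2 * l - 1)) by ring.
  by rewrite nmN nmM nm_nat.
exists (fun z => (1 + z ^+ 2) / (1 - z ^+ 2)), 0, 2; split.
  by apply: cayley_caratheodory => //; exact: cayley_small2.
by rewrite expr0n /= mulr0 subr0 nm_nat mulr1.
Qed.

Variables (e : X) (a : {linear X -> R[i]^o}).
Hypotheses (e1 : `|e| = 1) (ae : duality_map e a).

Lemma is_fder_support (k : R[i]^o -> R[i]^o) x d : is_cder k (a x) d ->
  is_fder (fun y => k (a y) : R[i]^o) x (fun v => d * a v).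
Proof.
move=> kd; split.
- move=> c u v; rewrite linearP mulrDr; congr (_ + _).
  by rewrite -[c *: a u]/(c * a u) -[RHS]/(c * (d * a u)) mulrCA.
- exists (nm d); first exact: nm_ge0.
  by move=> y; rewrite nmM ler_wpM2l ?nm_ge0 ?(support_le e1 ae).
- move=> eps eps0; have [del del0 Hd] := kd eps eps0; exists del => // y yd.
  have h := support_le e1 ae y.
  have E : a (x + y) - a x = a y by rewrite linearD addrC addKr.
  have := Hd (a (x + y)); rewrite E => /(_ (le_lt_trans h yd)) H.
  rewrite [d * a y]mulrC; apply: le_trans H _.
  by rewrite ler_pM2l.
Qed.

Lemma is_fder_extremal (k : R[i]^o -> R[i]^o) x d : is_cder k (a x) d ->
  is_fder (fun y => k (a y) *: y) x (fun v => (d * a v) *: x + k (a x) *: v).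
Proof.
move=> kd; have [Ll [K K0 LK] H] := is_fder_support kd; split.
- move=> c u v; rewrite Ll scalerDr scalerDl -[c *: (d * a u)]/(c * (d * a u)).
  rewrite scalerDr !scalerA [k (a x) * c]mulrC.
  by rewrite addrACA.
- exists (K * nm x + nm (k (a x) : C)); first by rewrite addr_ge0 ?mulr_ge0 ?nm_ge0.
  move=> y; apply: le_trans (nm_leD _ _) _; rewrite !nmZ mulrDl lerD //.
  by rewrite mulrAC ler_wpM2r ?nm_ge0.
- move=> eps eps0; have x1 : 0 < nm x + 1 by rewrite ltr_wpDl ?nm_ge0.
  have e2 : 0 < eps / 2 by rewrite divr_gt0.
  have [d1 d10 H1] := H _ (divr_gt0 e2 x1).
  have [d2 d20 H2] := is_cder_cont kd e2.
  exists (Num.min d1 d2); first by rewrite lt_min d10.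
  move=> y; rewrite lt_min => /andP[/H1 h1 yd2].
  have h := support_le e1 ae y.
  have E : a (x + y) - a x = a y by rewrite linearD addrC addKr.
  have := H2 (a (x + y)); rewrite E => /(_ (le_lt_trans h yd2)) h2.
  set A := k (a (x + y)) in h1 h2 *; set B := k (a x) in h1 h2 *.
  set D := d * a y in h1 *.
  have -> : A *: (x + y) - B *: x - (D *: x + B *: y) =
      (A - B - D : C) *: x + (A - B : C) *: y.
    by rewrite scalerDr !scalerBl opprD; 
       move: (A *: x) (A *: y) (B *: x) (B *: y) (D *: x) => p q r s t; zmod.
  apply: le_trans (nm_leD _ _) _; rewrite !nmZ.
  apply: (@le_trans _ _ (eps / 2 / (nm x + 1) * nm y * nm x + eps / 2 * nm y)).
    by rewrite lerD // ler_wpM2r ?nm_ge0.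
  have : eps / 2 / (nm x + 1) * nm y * nm x <= eps / 2 * nm y.
    rewrite mulrAC ler_wpM2r ?nm_ge0 // mulrAC ler_pdivrMr // ler_pM2l //; lra.
  lra.
Qed.

(** For any [b] in [J(x)] one has [b (h x) = k (a x) |x|^2], so membership reduces to the real part
    of [k]. The polynomials come from [h (t v) = k (t a(v)) t v] and uniqueness of the expansion. *)
Lemma extremal_properties (k : R[i]^o -> R[i]^o) (p1 p2 : C) :
  caratheodory k p1 p2 ->
  let h x := k (a x) *: x in
  [/\ class_M h,
      forall v, taylor_poly h 2 v = (p1 * a v) *: v &
      forall v, taylor_poly h 3 v = (p2 * a v ^+ 2) *: v].
Proof.
move=> [dk rk k0 sk] h.
have au x : unit_ball x -> nm (a x) < 1.
  by rewrite /unit_ball /= nm_lt1; apply: le_lt_trans (support_le e1 ae x).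
have nh : normalized_holomorphic h.
  split.
  - move=> x /au /dk [d Hd]; exact: (is_fder_diff (is_fder_extremal Hd)).1.
  - by rewrite /h scaler0.
  - move=> v; have a0 : a 0 = 0 by rewrite linear0.
    have [d Hd] : exists d, is_cder k (a 0) d by apply: dk; rewrite a0 nm0.
    have := (is_fder_diff (is_fder_extremal Hd)).2 v.
    by rewrite a0 k0 scaler0 add0r scale1r.
have exp v : taylor_poly h 2 v = (p1 * a v) *: v /\
             taylor_poly h 3 v = (p2 * a v ^+ 2) *: v.
  apply: (expansion_unique nh) => eps eps0.
  have av0 := nm_ge0 (a v : C); have v0 := nm_ge0 v.
  have m1 : 0 < nm (a v : C) + 1 by lra.
  have M0 : 0 < (nm (a v : C) + 1) ^+ 2 * (nm v + 1).
    by rewrite mulr_gt0 ?exprn_gt0 //; lra.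
  have [del del0 Hd] := sk _ (divr_gt0 eps0 M0).
  exists (del / (nm (a v : C) + 1)); first by rewrite divr_gt0.
  move=> t; rewrite ltr_pdivlMr // => ht.
  have tn := nm_ge0 t.
  have tw : nm (t * a v : C) < del by rewrite nmM; nra.
  have := Hd _ tw; rewrite /h.
  have -> : a (t *: v) = t * a v by rewrite linearZ.
  set w := a v in av0 m1 M0 tw ht *; set F := (X in nm X <= _ -> _) => hF.
  have -> : k (t * w) *: (t *: v) - (t *: v + t ^+ 2 *: ((p1 * w) *: v) +
      t ^+ 3 *: ((p2 * w ^+ 2) *: v)) = (t * F) *: v.
    rewrite !scalerA -!scalerDl -scalerBl /F; congr (_ *: _); ring.
  rewrite nmZ nmM.
  apply: (@le_trans _ _ (nm t * (eps / ((nm (w : C) + 1) ^+ 2 * (nm v + 1)) *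
      nm (t * w : C) ^+ 2) * nm v)).
    by rewrite ler_wpM2r // ler_wpM2l.
  set q := eps / _; have qE : q * ((nm (w : C) + 1) ^+ 2 * (nm v + 1)) = eps.
    by rewrite /q divfK // gt_eqF.
  have q0 : 0 < q by rewrite divr_gt0.
  rewrite nmM exprMn -{}qE.
  have -> : nm t * (q * (nm t ^+ 2 * nm (w : C) ^+ 2)) * nm v =
     q * (nm (w : C) ^+ 2 * nm v) * nm t ^+ 3 by ring.
  rewrite ler_wpM2r ?exprn_ge0 // ler_pM2l //.
  apply: ler_pM; rewrite ?exprn_ge0 //; last lra.
  by rewrite lerXn2r ?nnegrE //; lra.
split; last by move=> v; case: (exp v).
  split=> // x b xb x0 [_ _ bx]; rewrite /h functionalZ.
  rewrite bx nmE -rmorphXn cReM /= mulr0 subr0.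
  by rewrite mulr_ge0 ?sqr_ge0 ?rk ?au.
by move=> v; case: (exp v).
Qed.

Lemma one_dim_type_support (P : X -> X) (k : R[i]^o -> R[i]^o) :
  (forall z, exists d, is_cder k z d) -> (forall x, P x = (k (a x) : C) *: x) ->
  one_dim_type P.
Proof.
move=> dk PE; exists (fun x => k (a x)); split=> // x _.
by have [d Hd] := dk (a x); exact: (is_fder_diff (is_fder_support Hd)).1.
Qed.

(** One mapping serves both sharpness claims and all [m] at once, because its Fekete-Szegő vector is
    a multiple of [e] that does not involve [m]. *)
Lemma fekete_szego_sharp (l : C) : exists h : X -> X,
  [/\ class_M h, one_dim_type (taylor_poly h 2), one_dim_type (taylor_poly h 3)
    & exists2 c : C, forall m, fekete_szego e a h l m = c *: e
      & nm c = 2 * Num.max 1 (nm (2 * l - 1))].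
Proof.
have [k [p1 [p2 [kC E]]]] := caratheodory_sharp l.
have [Mh T2 T3] := extremal_properties kC.
exists (fun x => k (a x) *: x); split=> //.
- apply: (@one_dim_type_support _ (fun z => p1 * z)) => // z.
  by eexists; exact: is_cderM (is_cder_cst (p1 : R[i]^o) z) (is_cder_id z).
- apply: (@one_dim_type_support _ (fun z => p2 * z ^+ 2)) => // z.
  have [d Hd] := is_cderX 2 (is_cder_id z).
  by eexists; exact: is_cderM (is_cder_cst (p2 : R[i]^o) z) Hd.
exists (p2 - l * p1 ^+ 2) => // m.
apply: (fekete_szego_one_dim e1 ae _ _ Mh.1).
  by rewrite T2 (support_e e1 ae) mulr1.
by rewrite T3 (support_e e1 ae) expr1n mulr1.
Qed.

End Sharpness.

(** The maximum in the statement is taken in [R[i]], whose order is partial; both entries are real,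
    so it agrees with the maximum in [R]. *)
Lemma max1_nm (R : realType) (w : R[i]) :
  2 * Num.max 1 `|w| = (2 * Num.max 1 (nm w))%:C.
Proof.
rewrite rmorphM rmorph_nat; congr (_ * _); rewrite nmE !maxEle.
by rewrite -[1]/((1 : R)%:C) lecR; case: ifP.
Qed.

Unset Implicit Arguments.

Theorem theorem5p2 (R : realType) (X : completeNormedModType R[i]) :
  (forall (h : X -> X), class_M h ->
   forall (e : X) (a : {linear X -> R[i]^o}), `|e| = 1 -> duality_map e a ->
   [/\ (forall f : X -> X, normalized_holomorphic f ->
          (forall x, unit_ball x -> 'd f x (h x) = f x) ->
          forall lambda mu : R[i],
            fekete_szego e a h (2 * lambda) (2 * mu) =
            (- 2 : R[i]) *: fekete_szego e a f (1 - lambda) (1 - mu)),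
       (forall lambda : R[i],
          `|a (fekete_szego e a h lambda 0)| <=
          2 * Num.max 1 `|2 * lambda - 1|)
     & (one_dim_type (taylor_poly h 2) -> one_dim_type (taylor_poly h 3) ->
        forall lambda mu : R[i],
          `|fekete_szego e a h lambda mu| <=
          2 * Num.max 1 `|2 * lambda - 1|)])
  /\
  (forall (e : X) (a : {linear X -> R[i]^o}), `|e| = 1 -> duality_map e a ->
   (forall lambda : R[i], exists h : X -> X,
      class_M h /\
      `|a (fekete_szego e a h lambda 0)| =
      2 * Num.max 1 `|2 * lambda - 1|)
   /\
   (forall lambda mu : R[i], exists h : X -> X,
      [/\ class_M h, one_dim_type (taylor_poly h 2),
          one_dim_type (taylor_poly h 3)
        & `|fekete_szego e a h lambda mu| =
          2 * Num.max 1 `|2 * lambda - 1|])).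
Proof.
split.
  move=> h Mh e a e1 ae; have nh := Mh.1; split.
  - move=> f nf E l m; exact: fekete_szego_starlike nf nh E.
  - by move=> l; rewrite max1_nm nm_le; exact: fekete_szego_bound.
  - move=> [s2 [_ T2]] [s3 [_ T3]] l m.
    (* For every [m'] the vector is the same multiple of [e]; applying [a] at [m' = 0] recovers the
       scalar, so the scalar estimate bounds the norm. *)
    have F m' := fekete_szego_one_dim e1 ae l m' nh (T2 e) (T3 e).
    have := fekete_szego_bound e1 ae l Mh.
    have aE c : a (c *: e) = c by rewrite functionalZ (support_e e1 ae) mulr1.
    by rewrite max1_nm nm_le !F aE nmZ (nm_e e1) mulr1.
move=> e a e1 ae.
have aE c : a (c *: e) = c by rewrite functionalZ (support_e e1 ae) mulr1.
split=> [l|l m]; have [h [Mh h2 h3 [c Fc nc]]] := fekete_szego_sharp e1 ae l.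
  by exists h; split=> //; rewrite Fc aE max1_nm nmE nc.
by exists h; split=> //; rewrite Fc max1_nm nmE nmZ (nm_e e1) mulr1 nc.
Qed.
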